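(* Let $G=(V,E)$ be a graph and let $T\subseteq V$ be a set of terminals, with $B=T\times T$ (all pairs of distinct terminals), so that $T(B)=T$. There is an algorithm that enumerates all the minimal edge multiway cuts of $(G,T)$ with delay $O(|T(B)|\cdot|V|\cdot|E|)$ using polynomial space.
   Context: Graphs are finite, undirected, connected, without self-loops or parallel edges. An edge multiway cut of $(G,T)$ is a set $M\subseteq E$ such that in $G-M$ no two distinct terminals of $T$ are joined by a path; it is minimal if no proper subset of it is an edge multiway cut. An enumeration algorithm has delay $f$ if it outputs all solutions without duplication and the running time before the first output, between any two consecutive outputs, and after the last output is at most $f$. *)

(* Defs.v *)
From HB Require Import structures.
From mathcomp Require Import all_boot.

Set Implicit Arguments.
Unset Strict Implicit.
Unset Printing Implicit Defensive.

Section Graphs.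

Variable V : finType.
Implicit Types (E M : {set {set V}}) (T : {set V}).

(* The edge between x and y is the unordered pair [set x; y]; edge sets of
   two-element sets therefore have neither self-loops nor parallel edges. *)
Definition simple_graph E : bool := [forall e in E, #|e| == 2].

Definition adj E : rel V := fun x y => [set x; y] \in E.

Definition connected_graph E : bool := [forall x, forall y, connect (adj E) x y].

Definition multiway_cut E T M : bool :=
  (M \subset E) &&
  [forall s in T, forall t in T, (s != t) ==> ~~ connect (adj (E :\: M)) s t].

Definition minimal_multiway_cut E T M : bool := minset (multiway_cut E T) M.

End Graphs.

(* A word RAM with structured control flow.  A program uses finitely many
   registers and a random-access memory, both initialised to 0 outside of the
   input.  [IEmit] writes one word on a write-only output tape and [IEndSol]
   terminates the solution being written.  In the comments below, x, y and z
   stand for the contents of the registers of these numbers.  Every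
   instruction, and every evaluation of the guard of an [IIf] or an [IWhile],
   takes one time unit. *)
Inductive instr : Type :=
| IConst (x n : nat)              (* x := n *)
| IAdd (x y z : nat)              (* x := y + z *)
| ISub (x y z : nat)              (* x := y - z, truncated at 0 *)
| IMul (x y z : nat)              (* x := y * z *)
| IRead (x y : nat)               (* x := mem[y] *)
| IWrite (x y : nat)              (* mem[x] := y *)
| IEmit (x : nat)
| IEndSol
| IIf (x : nat) (b1 b2 : seq instr)   (* b1 if x != 0, b2 otherwise *)
| IWhile (x : nat) (b : seq instr).   (* repeat b as long as x != 0 *)

Definition program := seq instr.

(* [ccode] is the program that remains to be executed.  It plays the part of a
   program counter: there being no procedure calls, a fixed program only gives
   rise to finitely many continuations, so [ccode] does not count as space. *)
Record config := Config {
  ccode : program;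
  cregs : seq nat;
  cmem : seq nat;
  cbuf : seq nat;         (* words emitted since the last IEndSol *)
  csols : seq (seq nat)    (* finished solutions, in order of output *)
}.

Definition step (s : config) : config :=
  let: Config c R m o os := s in
  let r x := nth 0 R x in
  let set x v := set_nth 0 R x v in
  match c with
  | [::] => s
  | IConst x n :: k => Config k (set x n) m o os
  | IAdd x y z :: k => Config k (set x (r y + r z)) m o os
  | ISub x y z :: k => Config k (set x (r y - r z)) m o os
  | IMul x y z :: k => Config k (set x (r y * r z)) m o os
  | IRead x y :: k => Config k (set x (nth 0 m (r y))) m o os
  | IWrite x y :: k => Config k R (set_nth 0 m (r x) (r y)) o os
  | IEmit x :: k => Config k R m (rcons o (r x)) os
  | IEndSol :: k => Config k R m [::] (rcons os o)
  | IIf x b1 b2 :: k => Config ((if r x != 0 then b1 else b2) ++ k) R m o os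
  | IWhile x b :: k => Config (if r x != 0 then b ++ c else k) R m o os
  end.

Definition run (p : program) (w : seq nat) (t : nat) : config :=
  iter t step (Config p [::] w [::] [::]).

Definition halted (s : config) : bool := nilp (ccode s).

Definition halts_at (p : program) (w : seq nat) (h : nat) : Prop :=
  halted (run p w h) /\ forall t, t < h -> ~~ halted (run p w t).

(* The time units, up to h, at the end of which a solution is completed. *)
Definition output_times (p : program) (w : seq nat) (h : nat) : seq nat :=
  [seq t <- iota 1 h | size (csols (run p w t.-1)) < size (csols (run p w t))].

(* h being the halting time: the time before the first output, between two
   consecutive outputs and after the last output is at most f. *)
Definition delay_at_most (p : program) (w : seq nat) (h f : nat) : bool :=
  path (fun a b => b - a <= f) 0 (rcons (output_times p w h) h).

(* At most s words are in use and none exceeds s.  Writing at address i makes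
   the memory at least i + 1 words long, so untouched gaps are counted.  For s
   polynomial in the length N of the input, this says that words have O(log N)
   bits, which is what makes unit-cost arithmetic legitimate, and that the
   space used is polynomial, be it counted in words or in bits.  The output
   tape, which cannot be read, is not counted. *)
Definition space_at_most (s : nat) (x : config) : bool :=
  (size (cregs x ++ cmem x) <= s) && all (fun v => v <= s) (cregs x ++ cmem x).

Section Encoding.

Variable V : finType.

(* The vertices, the edges, each with its two endpoints in some order, and the
   terminals of the instance, all listed in an arbitrary order. *)
Definition presents (E : {set {set V}}) (T : {set V})
    (vs : seq V) (es : seq (V * V)) (ts : seq V) : Prop :=
  [/\ perm_eq vs (enum V),
      perm_eq [seq [set e.1; e.2] | e <- es] (enum E)
    & perm_eq ts (enum T)].

Definition encode (vs : seq V) (es : seq (V * V)) (ts : seq V) : seq nat :=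
  [:: size vs; size es; size ts]
  ++ flatten [seq [:: index e.1 vs; index e.2 vs] | e <- es]
  ++ [seq index t vs | t <- ts].

(* A set of edges is output as the list, in any order and without repetition,
   of the positions of its elements in es. *)
Definition valid_output (es : seq (V * V)) (o : seq nat) : bool :=
  uniq o && all (fun i => i < size es) o.

Definition decode (es : seq (V * V)) (o : seq nat) : {set {set V}} :=
  [set:: [seq nth set0 [seq [set e.1; e.2] | e <- es] i | i <- o]].

(* Every member of F has been output exactly once, and nothing else has. *)
Definition lists_exactly (es : seq (V * V)) (F : {set {set {set V}}})
    (x : config) : bool :=
  [&& all (valid_output es) (csols x),
      perm_eq [seq decode es o | o <- csols x] (enum F)
    & nilp (cbuf x)].

End Encoding.

(* Main.v *)
Require Import Defs.
From HB Require Import structures.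
From mathcomp Require Import all_boot zify.

Set Implicit Arguments.
Unset Strict Implicit.
Unset Printing Implicit Defensive.

(** If there are k > 0 terminals, the minimal multiway cuts are the edge
    boundaries of the partitions of the vertices into k connected classes, each
    containing exactly one terminal.  These partitions are grown one class at a
    time, in the order of the terminals.  A vertex w adjacent to the current
    class i is either excluded from it, or included together with all the
    vertices that w separates from the terminals of index larger than i.
    Excluding w can always be completed to a partition; including w can be,
    unless one of the vertices that follow w has been excluded before.  So every
    node of this binary search tree has a leaf below it, and there are at most
    k |V| branchings on a path, each of which costs one graph search, O(|E|).

    No stack is kept: the program stores the decisions leading to the current
    leaf and the last position where the second child was available but not
    taken, which determine the path to the next leaf; for every leaf it walks
    down again from the root.  This stays within the O(k |V| |E|) delay and
    needs polynomial space only. *)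

(** * Structured programs over registers and arrays *)

(** The invariant behind the search is that every unassigned vertex stays linked, through unassigned
    vertices, to a terminal whose class is still to come. Excluding a vertex changes no label, so it
    preserves this. Including [w] preserves it because the vertices cut off by [w] go along; they
    have no other place, since a later class is connected, contains its terminal and misses [w].
    When no terminal is left, no vertex is unassigned. An exclusion is stored as the number of the
    last class refused, so that a new class voids all exclusions without clean-up. A graph search
    costs O(|V| + |E| + k). This is O(|E|) because connectivity gives |V| <= 2|E| as soon as there
    are two vertices. The delay concerns the instants of output, whereas correctness is proved round
    by round, with one output somewhere inside each round. Two consecutive rounds cover any gap,
    which doubles the constant. Programs are verified in a small timed language with arrays, and one
    simulation lemma carries time and space over to the RAM. Without terminals the empty set is the
    only minimal cut, and a separate branch of the program outputs it. *)

Inductive cmd : Type :=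
| Skip
| Const (x v : nat)
| Add (x y z : nat)
| Minus (x y z : nat)
| Mul (x y z : nat)
| Get (x j y : nat)
| Put (j x y : nat)
| Emit (x : nat)
| EndSol
| Seq (c1 c2 : cmd)
| If (x : nat) (c1 c2 : cmd)
| While (x : nat) (c : cmd).

Notation "c1 ;; c2" := (Seq c1 c2) (at level 85, right associativity).

(* Register allocation: 0 to 19 are the variables of the program; 20 to 24 hold
   constants, 20 always holding 1; 25 is scratch for address computations; and
   26 + j holds the base address of the array j. *)
Definition nuser := 20.
Definition noper := 25.
Definition rtmp := 25.
Definition rbase := 26.
Definition narr := 9.
Definition nreg := 35.

Fixpoint compile (c : cmd) : program :=
  match c with
  | Skip => [::]
  | Const x v => [:: IConst x v]
  | Add x y z => [:: IAdd x y z]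
  | Minus x y z => [:: ISub x y z]
  | Mul x y z => [:: IMul x y z]
  | Get x j y => [:: IAdd rtmp (rbase + j) y; IRead x rtmp]
  | Put j x y => [:: IAdd rtmp (rbase + j) x; IWrite rtmp y]
  | Emit x => [:: IEmit x]
  | EndSol => [:: IEndSol]
  | Seq c1 c2 => compile c1 ++ compile c2
  | If x c1 c2 => [:: IIf x (compile c1) (compile c2)]
  | While x c => [:: IWhile x (compile c)]
  end.

Fixpoint wf (c : cmd) : bool :=
  match c with
  | Skip => true
  | Const x v => x < nuser
  | Add x y z | Minus x y z | Mul x y z => [&& x < nuser, y < noper & z < noper]
  | Get x j y => [&& x < nuser, j < narr & y < noper]
  | Put j x y => [&& j < narr, x < noper & y < noper]
  | Emit x => x < noper
  | EndSol => true
  | Seq c1 c2 => wf c1 && wf c2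
  | If x c1 c2 => [&& x < noper, wf c1 & wf c2]
  | While x c => (x < noper) && wf c
  end.

Record ast := Ast {
  rg : nat -> nat;
  ar : nat -> nat -> nat;
  ob : seq nat;
  os : seq (seq nat)
}.

Definition set (a : ast) (x v : nat) : ast :=
  Ast (fun y => if y == x then v else rg a y) (ar a) (ob a) (os a).

Definition put (a : ast) (j i v : nat) : ast :=
  Ast (rg a) (fun j' i' => if (j' == j) && (i' == i) then v else ar a j' i')
      (ob a) (os a).

Fixpoint modr (c : cmd) : seq nat :=
  match c with
  | Const x _ | Add x _ _ | Minus x _ _ | Mul x _ _ | Get x _ _ => [:: x]
  | Seq c1 c2 | If _ c1 c2 => modr c1 ++ modr c2
  | While _ c => modr c
  | _ => [::]
  end.

Fixpoint moda (c : cmd) : seq nat :=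
  match c with
  | Put j _ _ => [:: j]
  | Seq c1 c2 | If _ c1 c2 => moda c1 ++ moda c2
  | While _ c => moda c
  | _ => [::]
  end.

Fixpoint silent (c : cmd) : bool :=
  match c with
  | Emit _ | EndSol => false
  | Seq c1 c2 | If _ c1 c2 => silent c1 && silent c2
  | While _ c => silent c
  | _ => true
  end.

(** Worst-case time of loop-free code. The value at [While] is a dummy: [wp] is [False] there, so
    [spec_wp] never relies on it. *)
Fixpoint tm (c : cmd) : nat :=
  match c with
  | Skip => 0
  | Get _ _ _ | Put _ _ _ => 2
  | Seq c1 c2 => tm c1 + tm c2
  | If _ c1 c2 => (maxn (tm c1) (tm c2)).+1
  | While _ _ => 0
  | _ => 1
  end.

Section Semantics.

Variables (alen cst : nat -> nat) (S : nat).

(** Registers from [nuser] on are looked up in the fixed table [cst], so that no assignment can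
    disturb the constants and they need no frame argument. *)
Definition rval (a : ast) (x : nat) : nat := if x < nuser then rg a x else cst x.

Lemma rval_set a x v y :
  x < nuser -> rval (set a x v) y = if y == x then v else rval a y.
Proof.
rewrite /rval /= => xU; case: eqP => [->|_]; first by rewrite xU.
by case: ifP.
Qed.

Lemma rval_put a j i v y : rval (put a j i v) y = rval a y.
Proof. by []. Qed.

(** The side conditions are what the compiled code needs to stay within space [S]: constants, sums
    and products must not exceed [S] and accesses must be in range. Differences and copied values
    are bounded by values already stored. An array access takes two units, one of them for the
    address. *)
Inductive ev : cmd -> ast -> nat -> ast -> Prop :=
| EvSkip a : ev Skip a 0 a
| EvConst a x v : v <= S -> ev (Const x v) a 1 (set a x v)
| EvAdd a x y z : rval a y + rval a z <= S ->
    ev (Add x y z) a 1 (set a x (rval a y + rval a z))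
| EvMinus a x y z : ev (Minus x y z) a 1 (set a x (rval a y - rval a z))
| EvMul a x y z : rval a y * rval a z <= S ->
    ev (Mul x y z) a 1 (set a x (rval a y * rval a z))
| EvGet a x j y : rval a y < alen j ->
    ev (Get x j y) a 2 (set a x (ar a j (rval a y)))
| EvPut a j x y : rval a x < alen j ->
    ev (Put j x y) a 2 (put a j (rval a x) (rval a y))
| EvEmit a x : ev (Emit x) a 1 (Ast (rg a) (ar a) (rcons (ob a) (rval a x)) (os a))
| EvEndSol a : ev EndSol a 1 (Ast (rg a) (ar a) [::] (rcons (os a) (ob a)))
| EvSeq c1 c2 a1 a2 a3 t1 t2 : ev c1 a1 t1 a2 -> ev c2 a2 t2 a3 ->
    ev (Seq c1 c2) a1 (t1 + t2) a3
| EvIfT x c1 c2 a t a' : rval a x != 0 -> ev c1 a t a' -> ev (If x c1 c2) a t.+1 a'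
| EvIfF x c1 c2 a t a' : rval a x = 0 -> ev c2 a t a' -> ev (If x c1 c2) a t.+1 a'
| EvWhileT x c a1 a2 a3 t1 t2 : rval a1 x != 0 -> ev c a1 t1 a2 ->
    ev (While x c) a2 t2 a3 -> ev (While x c) a1 (t1 + t2).+1 a3
| EvWhileF x c a : rval a x = 0 -> ev (While x c) a 1 a.

(** A frame condition read off the syntax. [spec_seq] hands it over after each command, so a
    postcondition only has to mention what changes. *)
Definition same (c : cmd) (a a' : ast) : Prop :=
  [/\ forall x : nat, x \notin modr c -> rval a' x = rval a x,
      forall j i : nat, j \notin moda c -> ar a' j i = ar a j i
    & silent c -> ob a' = ob a /\ os a' = os a].

Lemma same_trans c c1 c2 a1 a2 a3 :
  {subset modr c1 <= modr c} -> {subset moda c1 <= moda c} ->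
  (silent c -> silent c1) ->
  {subset modr c2 <= modr c} -> {subset moda c2 <= moda c} ->
  (silent c -> silent c2) ->
  same c1 a1 a2 -> same c2 a2 a3 -> same c a1 a3.
Proof.
move=> r1 j1 s1 r2 j2 s2 [hr1 hj1 hs1] [hr2 hj2 hs2]; split.
- by move=> x nx; rewrite hr2 ?hr1 //; apply: contra nx; [exact: r1|exact: r2].
- by move=> j i nj; rewrite hj2 ?hj1 //; apply: contra nj; [exact: j1|exact: j2].
- by move=> sc; case: (hs1 (s1 sc)) (hs2 (s2 sc)) => -> -> [-> ->].
Qed.

Lemma same_sub c c1 a1 a2 :
  {subset modr c1 <= modr c} -> {subset moda c1 <= moda c} ->
  (silent c -> silent c1) -> same c1 a1 a2 -> same c a1 a2.
Proof. by move=> r1 j1 s1 h1; apply: (same_trans r1 j1 s1 r1 j1 s1 h1). Qed.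

Lemma ev_same c a t a' : ev c a t a' -> same c a a'.
Proof.
have vs a1 x v : forall y, y \notin [:: x] -> rval (set a1 x v) y = rval a1 y.
  move=> y; rewrite inE => yx; rewrite /rval /=; case: ifP => // _.
  by rewrite (negbTE yx).
elim=> {c a t a'}.
- by [].
- by move=> a x v _; split=> //; exact: vs.
- by move=> a x y z _; split=> //; exact: vs.
- by move=> a x y z; split=> //; exact: vs.
- by move=> a x y z _; split=> //; exact: vs.
- by move=> a x y z _; split=> //; exact: vs.
- move=> a j x y _; split=> //= j' i; rewrite inE => /negbTE ->; by [].
- by move=> a x; split.
- by move=> a; split.
- move=> c1 c2 a1 a2 a3 t1 t2 _ h1 _ h2; apply: same_trans h1 h2 => /=.
  + by move=> x; rewrite mem_cat => ->.
  + by move=> x; rewrite mem_cat => ->.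
  + by case/andP.
  + by move=> x; rewrite mem_cat => ->; rewrite orbT.
  + by move=> x; rewrite mem_cat => ->; rewrite orbT.
  + by case/andP.
- move=> x c1 c2 a t a' _ _; apply: same_sub => /=.
  + by move=> y; rewrite mem_cat => ->.
  + by move=> y; rewrite mem_cat => ->.
  + by case/andP.
- move=> x c1 c2 a t a' _ _; apply: same_sub => /=.
  + by move=> y; rewrite mem_cat => ->; rewrite orbT.
  + by move=> y; rewrite mem_cat => ->; rewrite orbT.
  + by case/andP.
- by move=> x c a1 a2 a3 t1 t2 _ _ h1 _ h2; apply: same_trans h1 h2.
- by [].
Qed.

(** Asking for the existence of an evaluation makes termination and the time bound part of the
    specification; [compile_ok] then turns this evaluation into the actual run. *)
Definition spec (c : cmd) (a : ast) (N : nat) (P : ast -> Prop) : Prop :=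
  exists t a', [/\ ev c a t a', t <= N & P a'].

Lemma spec_weak c a N N' (P P' : ast -> Prop) :
  spec c a N P -> N <= N' -> (forall a', same c a a' -> P a' -> P' a') ->
  spec c a N' P'.
Proof.
move=> [t [a' [h1 h2 h3]]] le PP; exists t, a'; split=> //.
  exact: leq_trans le.
by apply: PP h3; apply: ev_same h1.
Qed.

Lemma spec_seq c1 c2 a N1 N2 N (Q P : ast -> Prop) :
  spec c1 a N1 Q -> (forall a', same c1 a a' -> Q a' -> spec c2 a' N2 P) ->
  N1 + N2 <= N -> spec (c1 ;; c2) a N P.
Proof.
move=> [t1 [a1 [h1 h2 h3]]] h le.
have [t2 [a2 [g1 g2 g3]]] := h a1 (ev_same h1) h3.
exists (t1 + t2), a2; split=> //; first exact: EvSeq h1 g1.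
by apply: leq_trans le; apply: leq_add.
Qed.

(* The computed values are bound by a universal quantifier instead of being
   substituted, so that they are not duplicated along the program. *)
Fixpoint wp (c : cmd) (P : ast -> Prop) (a : ast) : Prop :=
  match c with
  | Skip => P a
  | Const x v => v <= S /\ P (set a x v)
  | Add x y z => rval a y + rval a z <= S /\
      forall v, v = rval a y + rval a z -> P (set a x v)
  | Minus x y z => forall v, v = rval a y - rval a z -> P (set a x v)
  | Mul x y z => rval a y * rval a z <= S /\
      forall v, v = rval a y * rval a z -> P (set a x v)
  | Get x j y => rval a y < alen j /\
      forall v, v = ar a j (rval a y) -> P (set a x v)
  | Put j x y => rval a x < alen j /\ P (put a j (rval a x) (rval a y))
  | Emit x => P (Ast (rg a) (ar a) (rcons (ob a) (rval a x)) (os a))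
  | EndSol => P (Ast (rg a) (ar a) [::] (rcons (os a) (ob a)))
  | Seq c1 c2 => wp c1 (wp c2 P) a
  | If x c1 c2 => if rval a x == 0 then wp c2 P a else wp c1 P a
  | While _ _ => False
  end.

Lemma spec_wp c a N P : wp c P a -> tm c <= N -> spec c a N P.
Proof.
suff h : wp c P a -> spec c a (tm c) P.
  by move=> /h + le => /spec_weak; apply.
elim: c a P => /=.
- by move=> a P Pa; exists 0, a; split=> //; exact: EvSkip.
- by move=> x v a P [h Pa]; exists 1; eexists; split; [exact: EvConst| |exact: Pa].
- by move=> x y z a P [h Pa]; exists 1; eexists; split; [exact: EvAdd| |exact: Pa].
- by move=> x y z a P Pa; exists 1; eexists; split; [exact: EvMinus| |exact: Pa].
- by move=> x y z a P [h Pa]; exists 1; eexists; split; [exact: EvMul| |exact: Pa].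
- by move=> x y z a P [h Pa]; exists 2; eexists; split; [exact: EvGet| |exact: Pa].
- by move=> x y z a P [h Pa]; exists 2; eexists; split; [exact: EvPut| |exact: Pa].
- by move=> x a P Pa; exists 1; eexists; split; [exact: EvEmit| |exact: Pa].
- by move=> a P Pa; exists 1; eexists; split; [exact: EvEndSol| |exact: Pa].
- move=> c1 h1 c2 h2 a P /h1 /spec_seq; apply; last exact: leqnn.
  by move=> a' _; apply: h2.
- move=> x c1 h1 c2 h2 a P; case: eqP => [x0 /h2|/eqP x0 /h1] [t [a' [g1 g2 g3]]];
    exists t.+1, a'; split=> //; try by rewrite ltnS leq_max g2 ?orbT.
    exact: EvIfF.
  exact: EvIfT.
- by [].
Qed.

Lemma spec_if x c1 c2 a N P :
  (rval a x != 0 -> spec c1 a N P) -> (rval a x = 0 -> spec c2 a N P) ->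
  spec (If x c1 c2) a N.+1 P.
Proof.
case: (eqVneq (rval a x) 0) => [x0 _ /(_ x0)|x0 /(_ isT) + _];
  move=> [t [a' [h1 h2 h3]]]; exists t.+1, a'; split=> //.
  exact: EvIfF.
exact: EvIfT.
Qed.

(* The number carried by the invariant is a potential that pays for the running
   time. *)
Lemma spec_while x c a p (I : nat -> ast -> Prop) :
  I p a ->
  (forall p1 a1, I p1 a1 -> same c a a1 -> rval a1 x != 0 ->
     exists2 N, N < p1
     & spec c a1 N (fun a2 => exists2 p2, I p2 a2 & p2 + N < p1)) ->
  spec (While x c) a p.+1 (fun a' => (exists p', I p' a') /\ rval a' x = 0).
Proof.
move=> Ia h.
suff H N p1 a1 : p1 <= N -> I p1 a1 -> same c a a1 ->
    spec (While x c) a1 p1.+1 (fun a' => (exists p', I p' a') /\ rval a' x = 0).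
  by apply: H (leqnn _) Ia _.
elim: N p1 a1 => [|N IH] p1 a1 le Ia1 s1; case: (eqVneq (rval a1 x) 0) => [x0|x0].
- by exists 1, a1; split=> //; [apply: EvWhileF|split=> //; exists p1].
- by have [N ] := h _ _ Ia1 s1 x0; lia.
- by exists 1, a1; split=> //; [apply: EvWhileF|split=> //; exists p1].
have [N1 lt [t [a2 [h1 h2 [p2 h3 h4]]]]] := h _ _ Ia1 s1 x0.
have [||t' [a3 [g1 g2 g3]]] := IH p2 a2 _ h3; first lia.
  by apply: same_trans s1 (ev_same h1).
(* The strict inequality [p2 + N1 < p1] leaves one unit, which pays for evaluating the guard. *)
exists (t + t').+1, a3; split=> //; last lia.
exact: EvWhileT h1 g1.
Qed.

(** The counter is not initialised, so that a loop may start anywhere; [reach] uses this to visit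
    only the terminals of later classes. *)
Definition For (x g y : nat) (c : cmd) : cmd :=
  Minus g y x ;; While g (c ;; Add x x 20 ;; Minus g y x).

Hypothesis cst1 : cst 20 = 1.

(** Each turn adds three units to the body: the increment, the recomputation of [g] and the guard.
    The final 2 stands for the first computation of [g] and the last guard. The invariant must be
    insensitive to [x] and [g], which the loop itself modifies. *)
Lemma spec_for (x g y : nat) c a K N (I : nat -> ast -> Prop) :
  [&& x < nuser, g < nuser, x != g, y != x & y != g] ->
  [&& x \notin modr c, y \notin modr c & g \notin modr c] ->
  rval a y <= S -> rval a x <= rval a y ->
  (forall i a1 (z : nat) v, (z == x) || (z == g) -> I i a1 -> I i (set a1 z v)) ->
  I (rval a x) a ->
  (forall i a1, i < rval a y -> same (For x g y c) a a1 -> I i a1 -> rval a1 x = i ->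
      spec c a1 K (I i.+1)) ->
  (rval a y - rval a x) * K.+3 + 2 <= N ->
  spec (For x g y c) a N
    (fun a' => I (rval a y) a' /\ rval a' x = rval a y).
Proof.
move=> /and5P [xU gU xg yx yg] /and3P [xm ym gm] ltS le Iset I0 H hN.
have gx : (g == x) = false by rewrite eq_sym (negbTE xg).
apply: (spec_seq (N1 := 1) (N2 := ((rval a y - rval a x) * K.+3).+1)
   (Q := fun a' => [/\ I (rval a' x) a', rval a' g = rval a' y - rval a' x,
     rval a' y = rval a y & rval a' x = rval a x])); last by lia.
  apply: spec_wp => //= v ->; rewrite !rval_set // eqxx (negbTE xg) (negbTE yg).
  by split=> //; apply: Iset => //; rewrite eqxx orbT.
move=> a1 s1 [Ia1 ga1 ya1 xa1]; rewrite -ya1 -xa1.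
apply: spec_weak (leqnn _) _.
  apply: (spec_while
    (I := fun p a' => p = (rval a' y - rval a' x) * K.+3 /\ [/\ I (rval a' x) a', rval a' g = rval a' y - rval a' x,
     rval a' y = rval a y & rval a' x <= rval a' y])).
    by split=> //; split=> //; lia.
  move=> p2 a2 [-> [Ia2 ga2 ya2 xa2]] s2 g0; exists (K + 2).
    by rewrite -ga2; case: (rval a2 g) g0 => // q _; lia.
  have sa2 : same (For x g y c) a a2.
    by apply: (same_trans _ _ _ _ _ _ s1 s2) => //= z; rewrite !(inE, mem_cat);
       do ?case: (z \in _); case: (z == x); case: (z == g).
  have lt2 : rval a2 x < rval a y by lia.
  have := H _ _ lt2 sa2 Ia2 erefl => h.
  apply: (spec_seq (N1 := K) (N2 := 2) h); last exact: leqnn.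
  move=> a3 [h1 _ _] Ia3; apply: spec_wp => //=.
  have v20 : rval a3 20 = 1 by [].
  split; first by rewrite v20 !h1 //; lia.
  move=> w -> v ->; exists ((rval a2 y - (rval a2 x + 1)) * K.+3); last first.
    have -> : rval a2 y - rval a2 x = (rval a2 y - (rval a2 x + 1)).+1 by lia.
    by rewrite mulSn; lia.
  rewrite !rval_set // eqxx (negbTE xg) (negbTE yx) (negbTE yg).
  rewrite v20 eqxx !h1 //; split=> //; split=> //; try lia.
  by rewrite addn1; apply: (Iset); rewrite ?eqxx ?orbT //; apply: (Iset); rewrite ?eqxx.
move=> a2 s2 [[p [_ [h1 h2 h3 h4]]] h5]; have e : rval a2 x = rval a y by lia.
by rewrite ya1 -e.
Qed.
End Semantics.

(** * Compilation to the word RAM, output times *)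

Lemma iter_step_cat S (s0 s1 s2 : config) t1 t2 :
  iter t1 step s0 = s1 -> iter t2 step s1 = s2 ->
  (forall u, u <= t1 -> space_at_most S (iter u step s0)) ->
  (forall u, u <= t2 -> space_at_most S (iter u step s1)) ->
  iter (t1 + t2) step s0 = s2 /\
  forall u, u <= t1 + t2 -> space_at_most S (iter u step s0).
Proof.
move=> e1 e2 h1 h2; rewrite addnC iterD e1; split=> // u le.
case: (leqP u t1) => [/h1 //|lt].
by rewrite -(subnK (ltnW lt)) iterD e1; apply: h2; lia.
Qed.

Lemma step1 S s s' : step s = s' -> space_at_most S s -> space_at_most S s' ->
  iter 1 step s = s' /\ forall u, u <= 1 -> space_at_most S (iter u step s).
Proof. by move=> <- h h'; split=> // -[|[|]]. Qed.

Section Compile.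

Variables (alen cst : nat -> nat) (S : nat).

(** The offset 3 skips the three counts that head the input. The first two arrays thus coincide with
    the edge and terminal lists as they already lie in memory. *)
Definition abase j := 3 + \sum_(l < j) alen l.

Hypothesis spaceS : nreg + abase narr <= S.

Lemma abase_mono j j' : j < j' -> abase j + alen j <= abase j'.
Proof.
move=> lt; have e l : abase l.+1 = abase l + alen l.
  by rewrite /abase big_ord_recr /= addnA.
rewrite -e -(subnKC lt); elim: (j' - j.+1) => [|d IH]; first by rewrite addn0.
by rewrite addnS (e (_ + d)) (leq_trans IH) ?leq_addr.
Qed.

Lemma abase_inj j i j' i' :
  i < alen j -> i' < alen j' -> abase j + i = abase j' + i' -> j = j' /\ i = i'.
Proof.
move=> h h' e; case: (ltngtP j j') => [/abase_mono|/abase_mono|jj]; try by lia.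
by subst j'; split=> //; lia.
Qed.

(** Both lists may be shorter than the layout, the missing cells reading as 0. The scratch register
    [rtmp] equals [noper], so [repr_rg] leaves it unconstrained. *)
Record repr (R m : seq nat) (a : ast) : Prop := Repr {
  repr_sizeR : size R <= nreg;
  repr_sizem : size m <= abase narr;
  repr_leR : forall x, nth 0 R x <= S;
  repr_lem : forall x, nth 0 m x <= S;
  repr_rg : forall x, x < noper -> nth 0 R x = rval cst a x;
  repr_base : forall j, j < narr -> nth 0 R (rbase + j) = abase j;
  repr_ar : forall j i, j < narr -> i < alen j -> nth 0 m (abase j + i) = ar a j i
}.

Lemma repr_space R m a c B O : repr R m a -> space_at_most S (Config c R m B O).
Proof.
move=> [h1 h2 h3 h4 _ _ _]; rewrite /space_at_most /= size_cat all_cat.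
apply/and3P; split; first by apply: leq_trans spaceS; apply: leq_add.
  by apply/(all_nthP 0) => i _; apply: h3.
by apply/(all_nthP 0) => i _; apply: h4.
Qed.

Lemma repr_set R m a x v :
  x < nuser -> v <= S -> repr R m a -> repr (set_nth 0 R x v) m (set a x v).
Proof.
move=> xU vS [h1 h2 h3 h4 h5 h6 h7]; split=> //.
- by rewrite size_set_nth geq_max h1 andbT; apply: leq_trans xU _.
- by move=> y; rewrite nth_set_nth /=; case: eqP.
- by move=> y yN; rewrite nth_set_nth /= rval_set // h5.
- move=> j jN; rewrite nth_set_nth /= h6 //; case: eqP => // e.
  by move: xU; rewrite -e.
Qed.

Lemma repr_tmp R m a v :
  v <= S -> repr R m a -> repr (set_nth 0 R rtmp v) m a.
Proof.
move=> vS [h1 h2 h3 h4 h5 h6 h7]; split=> //.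
- by rewrite size_set_nth geq_max h1 andbT.
- by move=> y; rewrite nth_set_nth /=; case: eqP.
- by move=> y yN; rewrite nth_set_nth /= h5 //; case: eqP => // e; move: yN; rewrite e.
- by move=> j jN; rewrite nth_set_nth /= h6.
Qed.

Lemma repr_put R m a j i v :
  j < narr -> i < alen j -> v <= S -> repr R m a ->
  repr R (set_nth 0 m (abase j + i) v) (put a j i v).
Proof.
move=> jN il vS [h1 h2 h3 h4 h5 h6 h7]; split=> //.
- rewrite size_set_nth geq_max h2 andbT.
  by apply: leq_trans (abase_mono jN); rewrite -addnS leq_add2l.
- by move=> y; rewrite nth_set_nth /=; case: eqP.
- move=> j' i' jN' il'; rewrite nth_set_nth /= h7 //.
  case: eqP => [/(abase_inj il' il) [-> ->]|ne]; first by rewrite !eqxx.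
  case: eqP => //= ej; case: eqP => //= ei; case: ne; by rewrite ej ei.
Qed.

(** Quantifying over the continuation [k] lets runs be chained, and lets a loop body return to the
    loop that follows it in the code. *)
Definition exec (c : cmd) R m a t R' m' a' : Prop :=
  forall k, iter t step (Config (compile c ++ k) R m (ob a) (os a))
              = Config k R' m' (ob a') (os a')
  /\ forall u, u <= t ->
       space_at_most S (iter u step (Config (compile c ++ k) R m (ob a) (os a))).

Lemma exec1 (c : cmd) R m a R' m' a' : repr R m a -> repr R' m' a' ->
  (forall k, step (Config (compile c ++ k) R m (ob a) (os a))
           = Config k R' m' (ob a') (os a')) ->
  exec c R m a 1 R' m' a'.
Proof.
by move=> r r' h k; apply: step1; [exact: h|exact: repr_space r|exact: repr_space r'].
Qed.

Lemma compile_ok c a t a' R m :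
  wf c -> ev alen cst S c a t a' -> repr R m a ->
  exists R' m', repr R' m' a' /\ exec c R m a t R' m' a'.
Proof.
move=> + e; elim: e R m => {c a t a'}.
- move=> a R m _ r; exists R, m; split=> // k; split=> // u.
  by rewrite leqn0 => /eqP ->; apply: repr_space r.
- move=> a x v vS R m /= xU r; have r' := repr_set xU vS r.
  by eexists; eexists; split; [exact: r'|exact: exec1].
- move=> a x y z vS R m /= /and3P [xU yN zN] r; have r' := repr_set xU vS r.
  eexists; eexists; split; first exact: r'.
  by apply: exec1 => //= k; rewrite !(repr_rg r).
- move=> a x y z R m /= /and3P [xU yN zN] r.
  have vS : rval cst a y - rval cst a z <= S.
    by apply: leq_trans (leq_subr _ _) _; rewrite -(repr_rg r) ?(repr_leR r).
  have r' := repr_set xU vS r.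
  eexists; eexists; split; first exact: r'.
  by apply: exec1 => //= k; rewrite !(repr_rg r).
- move=> a x y z vS R m /= /and3P [xU yN zN] r; have r' := repr_set xU vS r.
  eexists; eexists; split; first exact: r'.
  by apply: exec1 => //= k; rewrite !(repr_rg r).
- move=> a x j y yl R m /= /and3P [xU jN yN] r.
  have aS : abase j + rval cst a y <= S.
    apply: leq_trans spaceS; apply: (@leq_trans (abase narr)); last exact: leq_addl.
    by apply: leq_trans (abase_mono jN); rewrite leq_add2l ltnW.
  have r1 := repr_tmp aS r.
  have vS : ar a j (rval cst a y) <= S by rewrite -(repr_ar r) ?(repr_lem r).
  have r2 := repr_set xU vS r1.
  eexists; eexists; split; first exact: r2.
  move=> k; apply: (iter_step_cat (t1 := 1) (t2 := 1)
     (s1 := Config (IRead x rtmp :: k) (set_nth 0 R rtmp (abase j + rval cst a y)) m (ob a) (os a))).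
  + by rewrite /= (repr_base r) // (repr_rg r).
  + by rewrite /= nth_set_nth /= (repr_ar r).
  + by apply: (proj2 (step1 erefl _ _));
      rewrite /= ?(repr_base r) // ?(repr_rg r) //; apply: repr_space; eassumption.
  + by apply: (proj2 (step1 erefl _ _));
      rewrite /= ?nth_set_nth /= ?eqxx ?(repr_ar r) //; apply: repr_space; eassumption.
- move=> a j x y yl R m /= /and3P [jN xN yN] r.
  have aS : abase j + rval cst a x <= S.
    apply: leq_trans spaceS; apply: (@leq_trans (abase narr)); last exact: leq_addl.
    by apply: leq_trans (abase_mono jN); rewrite leq_add2l ltnW.
  have r1 := repr_tmp aS r.
  have vS : rval cst a y <= S by rewrite -(repr_rg r) ?(repr_leR r).
  have r2 := repr_put jN yl vS r1.
  eexists; eexists; split; first exact: r2.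
  (* The address goes to [rtmp] before the write; it must not overwrite the value that is about to
     be written. *)
  have yt : (y == rtmp) = false by apply/eqP => e; move: yN; rewrite e.
  move=> k; apply: (iter_step_cat (t1 := 1) (t2 := 1)
     (s1 := Config (IWrite rtmp y :: k) (set_nth 0 R rtmp (abase j + rval cst a x)) m (ob a) (os a))).
  + by rewrite /= (repr_base r) // (repr_rg r).
  + by rewrite /= !nth_set_nth /= yt (repr_rg r).
  + by apply: (proj2 (step1 erefl _ _));
      rewrite /= ?(repr_base r) // ?(repr_rg r) //; apply: repr_space; eassumption.
  + by apply: (proj2 (step1 erefl _ _));
      rewrite /= ?nth_set_nth /= ?eqxx ?yt ?(repr_rg r) //; apply: repr_space; eassumption.
- move=> a x R m /= xN r; exists R, m.
  have r' : repr R m (Ast (rg a) (ar a) (rcons (ob a) (rval cst a x)) (os a)) by case: r.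
  by split=> //; apply: exec1 => // k /=; rewrite (repr_rg r).
- move=> a R m _ r; exists R, m.
  have r' : repr R m (Ast (rg a) (ar a) [::] (rcons (os a) (ob a))) by case: r.
  by split=> //; apply: exec1.
- move=> c1 c2 a1 a2 a3 t1 t2 _ h1 _ h2 R m /= /andP [w1 w2] r.
  have [R1 [m1 [r1 e1]]] := h1 _ _ w1 r.
  have [R2 [m2 [r2 e2]]] := h2 _ _ w2 r1.
  exists R2, m2; split=> // k /=; rewrite -catA.
  have [a b] := e1 (compile c2 ++ k); have [a' b'] := e2 k.
  exact: iter_step_cat a a' b b'.
- move=> x c1 c2 a t a' x0 _ h R m /= /and3P [xN w1 w2] r.
  have [R1 [m1 [r1 e1]]] := h _ _ w1 r.
  exists R1, m1; split=> // k; have [f g] := e1 k.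
  apply: (iter_step_cat (t1 := 1) (t2 := t)) f _ g; first by rewrite /= (repr_rg r) // x0.
  by apply: (proj2 (step1 erefl _ _)); rewrite /= ?(repr_rg r) ?x0 //; apply: repr_space r.
- move=> x c1 c2 a t a' x0 _ h R m /= /and3P [xN w1 w2] r.
  have [R1 [m1 [r1 e1]]] := h _ _ w2 r.
  exists R1, m1; split=> // k; have [f g] := e1 k.
  apply: (iter_step_cat (t1 := 1) (t2 := t)) f _ g; first by rewrite /= (repr_rg r) // x0.
  by apply: (proj2 (step1 erefl _ _)); rewrite /= ?(repr_rg r) ?x0 //; apply: repr_space r.
- move=> x c a1 a2 a3 t1 t2 x0 _ h1 _ h2 R m /= /[dup] w /andP [xN w1] r.
  have [R1 [m1 [r1 e1]]] := h1 _ _ w1 r.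
  have [R2 [m2 [r2 e2]]] := h2 _ _ w r1.
  exists R2, m2; split=> // k; have [f g] := e1 (compile (While x c) ++ k).
  have [f' g'] := e2 k.
  rewrite -addn1 addnC; apply: (iter_step_cat (t1 := 1) (t2 := t1 + t2)
     (s1 := Config (compile c ++ compile (While x c) ++ k) R m (ob a1) (os a1))).
  + by rewrite /= (repr_rg r) // x0.
  + by have [] := iter_step_cat f f' g g'.
  + by apply: (proj2 (step1 erefl _ _)); rewrite /= ?(repr_rg r) ?x0 //; apply: repr_space r.
  + by have [] := iter_step_cat f f' g g'.
- move=> x c a x0 R m /= /andP [xN w1] r; exists R, m; split=> //.
  by apply: exec1 => // k; rewrite /= (repr_rg r) // x0.
Qed.

End Compile.

(** The checkpoints are program points, namely ends of rounds, at most [f] steps apart, with an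
    output somewhere between two of them. This is what an induction over rounds yields; the instants
    of output are only recovered afterwards. *)
Inductive prog (f : nat) : config -> Prop :=
| prog_halt s u : u <= f -> halted (iter u step s) -> prog f s
| prog_out s u : u <= f -> size (csols s) < size (csols (iter u step s)) ->
    prog f (iter u step s) -> prog f s.

Lemma csols_step s : size (csols s) <= size (csols (step s)).
Proof.
by case: s => -[|[] *] * /=; rewrite ?size_rcons.
Qed.

Lemma csols_mono s t u : t <= u -> size (csols (iter t step s)) <= size (csols (iter u step s)).
Proof.
move=> /subnK <-; elim: (u - t) => //= d IH.
by apply: leq_trans IH (csols_step _).
Qed.

Lemma halted_stay s t u : t <= u -> halted (iter t step s) -> iter u step s = iter t step s.
Proof.
move=> /subnK <-; rewrite iterD; case: (iter t step s) => -[|//] R m B O _.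
by elim: (u - t) => //= d ->.
Qed.

Lemma prog_inv f s : prog f s ->
  (exists u, u <= f /\ halted (iter u step s)) \/
  (exists u, u <= f /\ size (csols s) < size (csols (iter u step s))).
Proof. by case=> s' u le; [left|right]; exists u. Qed.

(** The segment containing [t] may have made its output before [t]. The next segment then halts or
    makes another one, and both are over by [t + f.*2]. *)
Lemma prog_delay f s : prog f s -> forall t,
  halted (iter (t + f.*2) step s) \/
  size (csols (iter t step s)) < size (csols (iter (t + f.*2) step s)).
Proof.
elim=> {s} [s u uf hs|s u uf lt p IH] t.
  left; rewrite (halted_stay (t := u)) //; lia.
case: (leqP u t) => ut.
  have := IH (t - u); rewrite -!iterD addnAC subnK // addnC; exact.
have [[u' [le' hs]]|[u' [le' lt']]] := prog_inv p.
  by left; rewrite (halted_stay (t := u' + u)) ?iterD //; lia.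
rewrite -iterD in lt'.
right; apply: (leq_ltn_trans (csols_mono s (ltnW ut))).
by apply: leq_trans lt' _; apply: csols_mono; lia.
Qed.

(** In the induction [t0] is the last instant of output, or 0, and [t1] the current time. A gap
    longer than [f] after [t0] would contradict the hypothesis at [t0], since by minimality of [h]
    the machine has not halted by [t0 + f]. *)
Lemma delay_of_prog p w f h :
  (forall t, halted (run p w (t + f)) \/
     size (csols (run p w t)) < size (csols (run p w (t + f)))) ->
  halts_at p w h -> delay_at_most p w h f.
Proof.
move=> D [hh hmin]; rewrite /delay_at_most /output_times.
set z := fun t => size (csols (run p w t)).
have {}D t : t + f < h -> z t < z (t + f).
  by move=> /hmin nh; case: (D t) => // H; rewrite H in nh.
have zm t u : t <= u -> z t <= z u by apply: csols_mono.
suff H l t0 t1 : t0 <= t1 -> t1 + l = h -> z t0 = z t1 ->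
    path (fun a b => b - a <= f) t0
      (rcons [seq t <- iota t1.+1 l | z t.-1 < z t] h).
  by have := H h 0 0; apply.
elim: l t0 t1 => [|l IH] t0 t1 le e ez /=.
  rewrite andbT leqNgt; apply/negP => lt.
  have := D t0; have := zm (t0 + f) t1; lia.
case: ifP => [lt|/negbT nlt] /=.
  rewrite IH ?andbT //; try lia.
  rewrite leqNgt; apply/negP => lt'; have := D t0; have := zm (t0 + f) t1; lia.
by apply: IH; try lia; have := zm t1 t1.+1; lia.
Qed.

(** * The search tree *)

Lemma connect_map (T : finType) (e e' : rel T) (P : T -> Prop) x y :
  (forall a b, P a -> e a b -> P b /\ e' a b) -> P x -> connect e x y ->
  P y /\ connect e' x y.
Proof.
move=> h Px /connectP [p ep ->]; elim: p x Px ep => [|z p IH] x Px /=.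
  by move=> _; split.
case/andP=> xz pz; have [Pz e'xz] := h _ _ Px xz.
have [Py c] := IH z Pz pz; split=> //.
by apply: connect_trans c; apply: connect1.
Qed.

Lemma connect_ind (T : finType) (e : rel T) (P : T -> Prop) x y :
  (forall a b, P a -> e a b -> P b) -> P x -> connect e x y -> P y.
Proof.
move=> h Px c; have [] // := connect_map (e' := e) (P := P) _ Px c.
by move=> a b Pa eab; split=> //; apply: h Pa eab.
Qed.

Section Labellings.

Variables (V : finType) (E : {set {set V}}) (ts : seq V).
Hypothesis uts : uniq ts.

Implicit Types (f lab ex : {ffun V -> nat}) (u v w t : V).

Local Notation k := (size ts).

Lemma adj_sym x y : adj E x y = adj E y x.
Proof. by rewrite /adj setUC. Qed.

Definition mono f : rel V := fun x y => adj E x y && (f x == f y).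

(** Classes are numbered from 1, so that label 0 can mean unassigned. In [troot] the argument [u]
    only serves as the default of [nth]. *)
Definition idx t := (index t ts).+1.
Definition troot u i := nth u ts i.-1.

Definition sol f : Prop :=
  [/\ forall u, 0 < f u <= k,
      forall t, t \in ts -> f t = idx t
    & forall u, connect (mono f) (troot u (f u)) u].

(* The terminals of index larger than i are the ones whose class is still to be
   grown; [lab x = 0] says that x has not been assigned to a class yet. *)
Definition mono_avoid lab v : rel V :=
  fun x y => [&& mono lab x y, x != v & y != v].

(** Terminals of later classes are unassigned and [mono_avoid] preserves labels, so these paths run
    through unassigned vertices only. The unassigned vertices left out are [v] and those it
    separates from all later terminals. *)
Definition reached i lab v u : bool :=
  [exists t, [&& t \in ts, i < idx t, t != v & connect (mono_avoid lab v) t u]].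

Definition unreached i lab v u : bool := (lab u == 0) && ~~ reached i lab v u.

Definition absorb i lab v : {ffun V -> nat} :=
  [ffun u => if unreached i lab v u then i else lab u].

Lemma unreached_self i lab v : lab v = 0 -> unreached i lab v v.
Proof.
move=> v0; rewrite /unreached v0 eqxx; apply/existsP => -[t /and4P [_ _ tv]].
case/connectP => p; elim/last_ind: p => [|p z _] /=; first by move=> _ e; rewrite e eqxx in tv.
rewrite rcons_path last_rcons => /andP [_ +] e; rewrite -e => /and3P [_ _].
by rewrite eqxx.
Qed.

Lemma connect_mono_class lab x y : connect (mono lab) x y -> lab y = lab x.
Proof.
by apply: (connect_ind (P := fun y => lab y = lab x)) => // a b <- /andP [_ /eqP].
Qed.

Definition sep i lab : Prop := forall t, t \in ts -> lab t = if idx t <= i then idx t else 0.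

Lemma idx_root u i : 0 < i <= k -> troot u i \in ts /\ idx (troot u i) = i.
Proof.
case: i => // i ik; rewrite /troot /= mem_nth //; split=> //.
by rewrite /idx index_uniq.
Qed.

(** * Absorbing a vertex into class [i]: its terminal when the class starts, or a pivot later on *)

Section Absorb.

Variables (i : nat) (lab : {ffun V -> nat}) (v : V).
Hypotheses (ik : 0 < i <= k) (v0 : lab v = 0).
Hypothesis lab_le : forall u, lab u <= i.
Hypothesis lab_ts : forall t, t \in ts -> t != v -> lab t = if idx t <= i then idx t else 0.
Hypothesis lab_conn : forall u, lab u != 0 -> connect (mono lab) (troot u (lab u)) u.
Hypothesis lab_rest : forall u, lab u = 0 ->
  exists t, [/\ t \in ts, (i < idx t) || (t == v) & connect (mono lab) t u].
Hypothesis v_ts : v \in ts -> idx v = i.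
Hypothesis v_nb : troot v i = v \/ exists2 w, lab w = i & adj E w v.

Local Notation lab' := (absorb i lab v).

Lemma absorb_keep u : lab u != 0 -> lab' u = lab u.
Proof. by rewrite ffunE /unreached => /negbTE ->. Qed.

Lemma absorb_le u : lab' u <= i.
Proof. by rewrite ffunE; case: ifP. Qed.

Lemma absorb_ts : sep i lab'.
Proof.
move=> t; case: (eqVneq t v) => [->|tv tts].
  by move=> vts; rewrite ffunE unreached_self // v_ts ?leqnn.
have := lab_ts tts tv; case: (leqP (idx t) i) => [le|lt] e.
  by rewrite absorb_keep e.
rewrite ffunE ifF // /unreached e eqxx /=; apply/negbTE; rewrite negbK.
by apply/existsP; exists t; rewrite tts lt tv connect0.
Qed.

(** Every vertex on a path from [t] avoiding [v] is itself reached, hence keeps label 0, and the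
    whole path survives the relabelling. *)
Lemma reached_keep t u : t \in ts -> i < idx t -> t != v -> lab t = 0 ->
  connect (mono_avoid lab v) t u -> lab' u = 0 /\ connect (mono lab') t u.
Proof.
move=> tts lt tv t0 c.
have h : forall u, connect (mono_avoid lab v) t u -> lab u = 0 -> lab' u = 0.
  move=> x cx x0; rewrite ffunE ifF // /unreached x0 eqxx /=; apply/negbTE.
  by rewrite negbK; apply/existsP; exists t; rewrite tts lt tv cx.
pose P x := connect (mono_avoid lab v) t x /\ lab x = 0.
have [] := connect_map (e' := mono lab') (P := P) _ _ c.
- move=> a b [ca a0] ab; have [/andP [adjab /eqP lab_ab] _ _] := and3P ab.
  have cb : connect (mono_avoid lab v) t b by apply: connect_trans ca (connect1 ab).
  have b0 : lab b = 0 by rewrite -lab_ab.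
  by split; [split|rewrite /mono adjab !h].
- by split; rewrite ?connect0.
- by move=> [c1 u0] c2; split=> //; apply: h.
Qed.

Lemma absorb_rest u : lab' u = 0 ->
  exists t, [/\ t \in ts, i < idx t & connect (mono lab') t u].
Proof.
rewrite ffunE; case: ifP => [_ e|nu u0]; first by move: ik; rewrite e.
move: nu; rewrite /unreached u0 eqxx /= => /negbT; rewrite negbK.
case/existsP=> t /and4P [tts lt tv c]; exists t; split=> //.
have t0 : lab t = 0 by rewrite lab_ts // leqNgt lt.
by case: (reached_keep tts lt tv t0 c).
Qed.

(** Follow a path of unassigned vertices from a later terminal, or from [v], to [u]. An edge from a
    reached vertex other than [v] leads to a reached vertex or to [v], so unreached vertices are
    entered through [v] only, and from there the path stays in the new class. *)
Lemma unreached_conn u : unreached i lab v u -> connect (mono lab') v u.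
Proof.
move=> nu; have u0 : lab u = 0 by case/andP: nu => /eqP.
have [t [tts tor c]] := lab_rest u0.
pose P x := lab x = 0 /\ (unreached i lab v x -> connect (mono lab') v x).
have t0 : lab t = 0 by rewrite -u0 (connect_mono_class c).
suff [_ H] : P u by apply: H.
apply: (connect_ind _ _ c).
  move=> a b [a0 ca] /[dup] mab /andP [adjab /eqP eab].
  have b0 : lab b = 0 by rewrite -eab.
  split=> // nb; case: (eqVneq b v) => [-> //|bv].
  case na : (unreached i lab v a).
    apply: connect_trans (ca na) (connect1 _).
    by rewrite /mono adjab !ffunE na nb eqxx.
  have av : a != v by apply: contraFN na => /eqP ->; apply: unreached_self.
  move: na nb; rewrite /unreached a0 b0 !eqxx /= => /negbT; rewrite negbK.
  case/existsP=> s /and4P [sts lts sv cs] /existsP; case; exists s.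
  rewrite sts lts sv; apply: connect_trans cs (connect1 _).
  by rewrite /mono_avoid mab av bv.
split=> //; case: (eqVneq t v) tor => [-> //|tv]; rewrite orbF => lt.
rewrite /unreached t0 eqxx /= => /existsP; case; exists t.
by rewrite tts lt tv connect0.
Qed.

Lemma keep_conn x u : lab x != 0 -> connect (mono lab) x u -> connect (mono lab') x u.
Proof.
move=> x0 cxu; have [] // := connect_map (e' := mono lab') (P := fun x => lab x != 0) _ x0 cxu.
move=> a b a0 /andP [adjab /eqP e]; have b0 : lab b != 0 by rewrite -e.
by split=> //; rewrite /mono adjab !absorb_keep // e eqxx.
Qed.

Lemma absorb_conn u : lab' u != 0 -> connect (mono lab') (troot u (lab' u)) u.
Proof.
case nu : (unreached i lab v u); last first.
  rewrite ffunE nu => u0; have c := lab_conn u0.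
  by apply: (keep_conn _ c); rewrite -(connect_mono_class c).
move=> _; rewrite ffunE nu; apply: connect_trans (unreached_conn nu).
have rE : troot u i = troot v i.
  by case: i ik => // i' i'k; rewrite /troot; apply: set_nth_default.
have v' : lab' v = i by rewrite ffunE unreached_self.
rewrite rE; case: v_nb => [-> //|[w wi wv]].
have w0 : lab w != 0 by rewrite wi; case: (i) ik.
have c := lab_conn w0; have rw : troot w (lab w) = troot v i.
  by rewrite wi; case: i ik => // i' i'k; rewrite /troot; apply: set_nth_default.
rewrite rw in c; apply: connect_trans (keep_conn _ c) (connect1 _).
  by rewrite -(connect_mono_class c).
by rewrite /mono wv v' absorb_keep // wi eqxx.
Qed.

(** If [f u] exceeded [i], the class of [u] would link it to a later terminal. All its vertices are
    unassigned in [lab], whose labels are at most [i], and differ from [v], so [u] would be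
    reached. *)
Lemma absorb_forced f u : sol f -> (forall x, lab x != 0 -> f x = lab x) ->
  (forall x, lab x = 0 -> i <= f x) -> f v = i -> unreached i lab v u -> f u = i.
Proof.
move=> [f1 f2 f3] fk fi fv /andP [/eqP u0 nu].
apply/eqP; rewrite eqn_leq fi // andbT leqNgt; apply: contra nu => lt.
have [rts ri] := idx_root u (f1 u); set r := troot u (f u) in rts ri.
have fr : f r = f u by rewrite f2.
apply/existsP; exists r; rewrite rts ri lt /=; apply/andP; split.
  by apply/eqP => e; move: lt; rewrite -fr e fv ltnn.
have h x : f x = f u -> lab x = 0 /\ x != v.
  move=> fx; split; last by apply/eqP => e; move: lt; rewrite -fx e fv ltnn.
  apply/eqP; case: (eqVneq (lab x) 0) => // /fk e.
  by have := lab_le x; rewrite -e fx leqNgt lt.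
have [] // := connect_map (e' := mono_avoid lab v) (P := fun x => f x = f u) _ fr (f3 u).
move=> a b fa /andP [ab /eqP eab]; have fb : f b = f u by rewrite -eab.
have [a0 av] := h _ fa; have [b0 bv] := h _ fb.
by split=> //; rewrite /mono_avoid /mono ab a0 b0 av bv.
Qed.

End Absorb.

(** The solutions to be enumerated below a state. For nonterminals [i <= ex u] amounts to
    [ex u = i], by [good_ex]; the inequality also covers terminals, which carry [k.+1]. *)
Definition compat i lab (ex : {ffun V -> nat}) f : Prop :=
  [/\ sol f, forall u, lab u != 0 -> f u = lab u,
      forall u, lab u = 0 -> i <= f u
    & forall u, lab u = 0 -> i <= ex u -> f u != i].

(** The field [good_rest] rules out dead ends: at [i = k] there is no later terminal, so no vertex
    can be unassigned and the labelling is a solution. *)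
Record good i lab (ex : {ffun V -> nat}) : Prop := Good {
  good_ik : i <= k;
  good_le : forall u, lab u <= i;
  good_sep : sep i lab;
  good_conn : forall u, lab u != 0 -> connect (mono lab) (troot u (lab u)) u;
  good_rest : forall u, lab u = 0 ->
    exists t, [/\ t \in ts, i < idx t & connect (mono lab) t u];
  good_ts : forall t, t \in ts -> ex t = k.+1;
  good_ex : forall u, u \notin ts -> ex u <= i
}.

Variable es : seq (V * V).
Hypothesis adj_es : forall x y, adj E x y = ((x, y) \in es) || ((y, x) \in es).

Definition cand i lab ex u w := [&& lab u == i, lab w == 0 & (ex : {ffun V -> nat}) w < i].

Definition cands i lab ex : seq V :=
  flatten [seq (if cand i lab ex e.1 e.2 then [:: e.2] else [::])
            ++ (if cand i lab ex e.2 e.1 then [:: e.1] else [::]) | e <- es].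

(** Any candidate would do, provided the choice is the same on every replay. The last one is what a
    scan of the edge list leaves in the register that it overwrites. *)
Definition pivot i lab ex : option V :=
  if cands i lab ex is w :: s then Some (last w s) else None.

Lemma cands_mem i lab ex w :
  reflect (exists2 u, adj E u w & cand i lab ex u w) (w \in cands i lab ex).
Proof.
apply: (iffP flatten_mapP) => [[[x y] xy]|[u]] /=.
  rewrite mem_cat => /orP [|]; case: ifP => // c; rewrite inE => /eqP ->.
    by exists x; rewrite // adj_es xy.
  by exists y; rewrite // adj_es xy orbT.
rewrite adj_es => /orP [] uw c; [exists (u, w) | exists (w, u)] => //=;
  by rewrite mem_cat c inE eqxx ?orbT.
Qed.

Lemma pivot_some i lab ex v : pivot i lab ex = Some v ->
  exists2 u, adj E u v & cand i lab ex u v.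
Proof.
move=> h; apply/cands_mem; move: h; rewrite /pivot.
by case: cands => // w s [<-]; apply: mem_last.
Qed.

Lemma pivot_none i lab ex u v : pivot i lab ex = None -> adj E u v ->
  ~~ cand i lab ex u v.
Proof.
rewrite /pivot; case c : cands => // _ uv; apply/negP => cuv.
by have : v \in cands i lab ex; [apply/cands_mem; exists u|rewrite c].
Qed.

Definition exclude i (ex : {ffun V -> nat}) v : {ffun V -> nat} :=
  [ffun u => if u == v then i else ex u].

Definition bad i lab (ex : {ffun V -> nat}) v : bool :=
  [exists u, unreached i lab v u && (i <= ex u)].

Lemma idx_inj t t' : t \in ts -> t' \in ts -> idx t = idx t' -> t = t'.
Proof. by move=> tts t'ts [e]; rewrite -(nth_index t tts) e nth_index. Qed.

Lemma idx_le t : t \in ts -> idx t <= k.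
Proof. by rewrite -index_mem. Qed.

Lemma root_idx u t : t \in ts -> troot u (idx t) = t.
Proof. exact: nth_index. Qed.

Section Stage.

Variables (i : nat) (lab ex : {ffun V -> nat}) (v : V).
Hypotheses (g : good i lab ex) (vts : v \in ts) (iv : idx v = i.+1).

Let ik : 0 < i.+1 <= k. Proof. by rewrite -iv idx_le. Qed.

Let v0 : lab v = 0. Proof. by rewrite (good_sep g) // iv ltnn. Qed.

Let lab_le u : lab u <= i.+1.
Proof. by apply: leq_trans (good_le g u) _. Qed.

Let lab_ts t : t \in ts -> t != v -> lab t = if idx t <= i.+1 then idx t else 0.
Proof.
move=> tts tv; rewrite (good_sep g) // [in RHS]leq_eqVlt ltnS.
by case: eqP => [e|//]; case/eqP: tv; apply: idx_inj; rewrite // iv.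
Qed.

Let lab_rest u : lab u = 0 ->
  exists t, [/\ t \in ts, (i.+1 < idx t) || (t == v) & connect (mono lab) t u].
Proof.
move=> /(good_rest g) [t [tts lt c]]; exists t; split=> //.
rewrite leq_eqVlt in lt; case/orP: lt => [/eqP e|-> //].
by rewrite (idx_inj tts vts) ?eqxx ?orbT // iv.
Qed.

Let v_root : troot v i.+1 = v \/ exists2 w, lab w = i.+1 & adj E w v.
Proof. by left; rewrite -iv root_idx. Qed.

Lemma good_stage : good i.+1 (absorb i.+1 lab v) ex.
Proof.
split.
- by case/andP: ik.
- exact: absorb_le.
- exact: absorb_ts.
- exact: (absorb_conn ik v0 (good_conn g) lab_rest v_root).
- exact: (absorb_rest ik lab_ts).
- exact: good_ts g.
- by move=> u /(good_ex g) /leqW.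
Qed.

(** Without a pivot class [i] is complete: along a path inside the class of [f] that starts at its
    terminal, a first unassigned vertex would be a candidate unless excluded, and [f] respects
    exclusions. Conversely the absorbed vertices get label [i.+1], hence violate no exclusion from
    class [i]. *)
Lemma compat_stage f : pivot i lab ex = None ->
  compat i lab ex f <-> compat i.+1 (absorb i.+1 lab v) ex f.
Proof.
move=> np; split=> [[sf c1 c2 c3]|[sf c1 c2 c3]].
  have c2' u : lab u = 0 -> i < f u.
    move=> u0; rewrite ltn_neqAle c2 // andbT eq_sym; apply/eqP => fu.
    have [f1 f2 f3] := sf.
    have [rts ri] := idx_root u (f1 u); set r := troot u (f u) in rts ri.
    have fr : f r = f u by rewrite f2.
    have ri' : lab r = i by rewrite (good_sep g) // ri fu leqnn.
    have i0 : i != 0 by rewrite -fu; case: (f u) (f1 u).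
    have : lab u = i; last by move=> e; rewrite -e u0 in i0.
    pose P x := f x = i /\ lab x = i.
    suff [] : P u by [].
    apply: (connect_ind _ _ (f3 u)); last by rewrite /P -/r fr.
    move=> a b [fa la] /andP [ab /eqP eab]; have fb : f b = i by rewrite -eab.
    split=> //; case: (eqVneq (lab b) 0) => [b0|/c1 <- //].
    have := pivot_none np ab; rewrite /cand la b0 !eqxx /= -leqNgt => le.
    by have := c3 _ b0 le; rewrite fb eqxx.
  have [f1 f2 f3] := sf.
  have fv : f v = i.+1 by rewrite f2.
  have forced := absorb_forced lab_le sf c1 c2' fv.
  split=> // u; rewrite ffunE; case: ifP => // nu.
  - by move=> _; apply: forced.
  - exact: c1.
  - exact: c2'.
  (* Old exclusions are at most [i] and lapse. A terminal stays excluded, rightly so, since only [v]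
     has index [i.+1]. *)
  move=> u0; case uts' : (u \in ts); last first.
    by move/negbT: uts' => /(good_ex g); lia.
  move=> _; rewrite f2 //; apply/eqP => e.
  by move: nu; rewrite (idx_inj uts' vts) ?unreached_self // iv.
have keep u : lab u != 0 -> f u = lab u.
  by move=> u0; rewrite c1 absorb_keep.
split=> //.
- move=> u u0; case nu : (unreached i.+1 lab v u).
    by rewrite c1 ffunE nu.
  by apply/ltnW/c2; rewrite ffunE nu.
- move=> u u0 _; case nu : (unreached i.+1 lab v u).
    by rewrite c1 ffunE nu // eq_sym (ltn_eqF (ltnSn i)).
  have : i < f u by apply: c2; rewrite ffunE nu.
  by rewrite neq_ltn orbC => ->.
Qed.

End Stage.
Section Branch.

Variables (i : nat) (lab ex : {ffun V -> nat}) (v : V).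
Hypotheses (g : good i lab ex) (pv : pivot i lab ex = Some v).

Lemma pivot_facts : [/\ 0 < i, lab v = 0, v \notin ts & ex v < i].
Proof.
have [u _ /and3P [_ /eqP v0 exv]] := pivot_some pv; split=> //.
  by apply: leq_ltn_trans exv.
apply/negP => /(good_ts g) e; have := good_ik g; lia.
Qed.

Let ik : 0 < i <= k. Proof. by have [-> _ _ _] := pivot_facts; rewrite (good_ik g). Qed.

Let v0 : lab v = 0. Proof. by case: pivot_facts. Qed.

Let vts : v \notin ts. Proof. by case: pivot_facts. Qed.

Let lab_rest u : lab u = 0 ->
  exists t, [/\ t \in ts, (i < idx t) || (t == v) & connect (mono lab) t u].
Proof. by move=> /(good_rest g) [t [tts lt c]]; exists t; rewrite lt. Qed.

Let lab_ts t : t \in ts -> t != v -> lab t = if idx t <= i then idx t else 0.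
Proof. by move=> tts _; apply: (good_sep g). Qed.

Let v_root : troot v i = v \/ exists2 w, lab w = i & adj E w v.
Proof. by right; have [u uv /andP [/eqP ui _]] := pivot_some pv; exists u. Qed.

Let v_ts : v \in ts -> idx v = i. Proof. by rewrite (negbTE vts). Qed.

Lemma good_include : good i (absorb i lab v) ex.
Proof.
split.
- exact: good_ik g.
- exact: absorb_le (good_le g).
- exact: absorb_ts.
- exact: (absorb_conn ik v0 (good_conn g) lab_rest v_root).
- exact: (absorb_rest ik lab_ts).
- exact: good_ts g.
- exact: good_ex g.
Qed.

Lemma good_exclude : good i lab (exclude i ex v).
Proof.
case: (g) => *; split=> //.
- by move=> t tts; rewrite ffunE; case: eqP => [e|_]; [move: vts; rewrite -e tts|auto].
- by move=> u uts'; rewrite ffunE; case: eqP => // _; auto.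
Qed.

Lemma compat_exclude f :
  compat i lab (exclude i ex v) f <-> compat i lab ex f /\ f v != i.
Proof.
split=> [[sf c1 c2 c3]|[[sf c1 c2 c3] fv]].
  have fv : f v != i by apply: c3; rewrite // ffunE eqxx.
  split=> //; split=> // u u0 le; case: (eqVneq u v) => [-> //|uv].
  by apply: c3; rewrite // ffunE (negbTE uv).
by split=> // u u0; rewrite ffunE; case: eqP => [-> //|_]; apply: c3.
Qed.

(** By [absorb_forced], putting [v] in class [i] forces all unreached vertices there; this
    contradicts an exclusion exactly when [bad] holds. *)
Lemma compat_include f :
  ~~ bad i lab ex v /\ compat i (absorb i lab v) ex f <-> compat i lab ex f /\ f v = i.
Proof.
split=> [[nb [sf c1 c2 c3]]|[[sf c1 c2 c3] fv]].
  have keep u : lab u != 0 -> f u = lab u.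
    by move=> u0; rewrite c1 absorb_keep.
  have fi u : unreached i lab v u -> f u = i.
    by move=> nu; rewrite c1 ffunE nu //; case: (i) ik.
  split; last by apply/fi/unreached_self.
  split=> // u u0; case nu : (unreached i lab v u).
  - by rewrite fi.
  - by apply: c2; rewrite ffunE nu.
  - by move=> le; case/existsP: nb; exists u; rewrite nu.
  - by apply: c3; rewrite ffunE nu.
have forced := absorb_forced (good_le g) sf c1 c2 fv.
split.
  apply/existsP => -[u /andP [/[dup] nu /andP [/eqP u0 _] le]].
  by have := c3 _ u0 le; rewrite forced ?eqxx.
by split=> // u; rewrite ffunE; case: ifP => // nu; auto; move=> e; move: ik; rewrite e.
Qed.

End Branch.

(** There is no empty tree, so every subtree contains a leaf. A forced exclusion still makes a node,
    hence a path records one decision per pivot; passing to the next class makes none. *)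
Inductive tree : Type :=
| Leaf of {ffun V -> nat}
| Node1 of tree
| Node2 of tree & tree.

Fixpoint leaves T : seq {ffun V -> nat} :=
  match T with
  | Leaf f => [:: f]
  | Node1 T0 => leaves T0
  | Node2 T0 T1 => leaves T0 ++ leaves T1
  end.

(* In a path, true stands for the second child of a Node2.  [rest T s] lists the
   leaves of T that are not on the left of the path s. *)
Fixpoint vpath T (s : seq bool) {struct s} : bool :=
  match s, T with
  | [::], _ => true
  | false :: s', Node1 T0 => vpath T0 s'
  | false :: s', Node2 T0 _ => vpath T0 s'
  | true :: s', Node2 _ T1 => vpath T1 s'
  | _, _ => false
  end.

Fixpoint rest T (s : seq bool) {struct s} : seq {ffun V -> nat} :=
  match s, T with
  | [::], _ => leaves T
  | false :: s', Node1 T0 => rest T0 s'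
  | false :: s', Node2 T0 T1 => rest T0 s' ++ leaves T1
  | true :: s', Node2 _ T1 => rest T1 s'
  | _, _ => [::]
  end.

Inductive grows : nat -> {ffun V -> nat} -> {ffun V -> nat} -> tree -> Prop :=
| GrowLeaf lab ex : pivot k lab ex = None -> grows k lab ex (Leaf lab)
| GrowStage i lab ex v T : pivot i lab ex = None -> v \in ts -> idx v = i.+1 ->
    grows i.+1 (absorb i.+1 lab v) ex T -> grows i lab ex T
| GrowNode1 i lab ex v T0 : pivot i lab ex = Some v -> bad i lab ex v ->
    grows i lab (exclude i ex v) T0 -> grows i lab ex (Node1 T0)
| GrowNode2 i lab ex v T0 T1 : pivot i lab ex = Some v -> ~~ bad i lab ex v ->
    grows i lab (exclude i ex v) T0 -> grows i (absorb i lab v) ex T1 ->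
    grows i lab ex (Node2 T0 T1).

Definition free i lab (ex : {ffun V -> nat}) := #|[set u | (lab u == 0) && (ex u < i)]|.

(* Bounds the number of branchings below a state. *)
Definition height i lab ex := (k - i) * #|V| + free i lab ex.

Lemma free_lt i lab ex lab' ex' v : (lab v == 0) && (ex v < i) ->
  (forall u, (lab' u == 0) && (ex' u < i) -> (lab u == 0) && (ex u < i)) ->
  ~~ ((lab' v == 0) && (ex' v < i)) -> free i lab' ex' < free i lab ex.
Proof.
move=> hv sub nv; apply/proper_card/properP; split.
  by apply/subsetP => u; rewrite !inE; apply: sub.
by exists v; rewrite inE.
Qed.

Lemma height_exclude i lab ex v : pivot i lab ex = Some v ->
  height i lab (exclude i ex v) < height i lab ex.
Proof.
move=> pv; have [u _ /and3P [_ v0 exv]] := pivot_some pv.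
rewrite ltn_add2l; apply: (free_lt (v := v)); first by rewrite v0.
  by move=> x; rewrite ffunE; case: (x =P v) => // _; rewrite ltnn andbF.
by rewrite ffunE eqxx ltnn andbF.
Qed.

Lemma height_include i lab ex v : pivot i lab ex = Some v ->
  height i (absorb i lab v) ex < height i lab ex.
Proof.
move=> pv; have [u _ /and3P [_ v0 exv]] := pivot_some pv.
have i0 : (i == 0) = false by case: (i) exv.
rewrite ltn_add2l; apply: (free_lt (v := v)); first by rewrite v0.
  by move=> x; rewrite ffunE; case: ifP; rewrite // i0.
by rewrite ffunE unreached_self ?i0 //; apply/eqP.
Qed.

(** A new class makes excluded vertices free again; the summand [#|V|] given up with the finished
    class pays for this. *)
Lemma height_stage i lab lab' ex : i < k ->
  height i.+1 lab' ex <= height i lab ex.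
Proof.
move=> ik; apply: (@leq_trans ((k - i.+1) * #|V| + #|V|)).
  by rewrite leq_add2l max_card.
apply: leq_trans (leq_addr _ _).
by rewrite -[X in _ + X]mul1n -mulnDl leq_mul2r; apply/orP; right; lia.
Qed.

Lemma grows_exists i lab ex : good i lab ex -> exists T, grows i lab ex T.
Proof.
(* The term [k - i] is there because [height] may stay the same when a class ends. *)
have [N] := ubnP (height i lab ex + (k - i)).
elim: N i lab ex => // N IH i lab ex lt g.
case pv : (pivot i lab ex) => [v|]; last first.
  have := good_ik g; rewrite leq_eqVlt => /orP [/eqP ei|ik].
    by subst i; exists (Leaf lab); apply: GrowLeaf.
  have [w _] : exists w : V, w \in ts.
    by case: (ts) ik => // w s _; exists w; rewrite inE eqxx.
  have [rts ri] := idx_root w (ik : 0 < i.+1 <= k).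
  have [|T gT] := IH _ _ _ _ (good_stage g rts ri).
    by have := height_stage lab (absorb i.+1 lab (troot w i.+1)) ex ik; lia.
  by exists T; apply: GrowStage gT.
have [|T0 g0] := IH _ _ _ _ (good_exclude g pv).
  by have := height_exclude pv; lia.
case b : (bad i lab ex v).
  by exists (Node1 T0); apply: GrowNode1 g0.
have [|T1 g1] := IH _ _ _ _ (good_include g pv).
  by have := height_include pv; lia.
by exists (Node2 T0 T1); apply: GrowNode2 g0 g1; rewrite ?b.
Qed.

Lemma good_final lab ex u : good k lab ex -> lab u != 0.
Proof.
move=> g; apply/eqP => /(good_rest g) [t [/idx_le h1 h2 _]]; lia.
Qed.

Lemma sol_final lab ex : good k lab ex -> sol lab.
Proof.
move=> g; have n0 u := good_final u g; split=> //.
- by move=> u; rewrite lt0n n0 (good_le g).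
- by move=> t tts; rewrite (good_sep g) // idx_le.
- by move=> u; apply: (good_conn g).
Qed.

Lemma leavesP i lab ex T : grows i lab ex T -> good i lab ex ->
  uniq (leaves T) /\ forall f, f \in leaves T <-> compat i lab ex f.
Proof.
elim=> {i lab ex T}.
- move=> lab ex np g; split=> //= f; rewrite inE; split=> [/eqP ->|[sf c1 c2 c3]].
    have n0 u := good_final u g.
    by split=> // [|u e|u e]; [exact: sol_final g|move: (n0 u)..]; rewrite e.
  by apply/eqP/ffunP => u; rewrite c1 // (good_final u g).
- move=> i lab ex v T np vts iv _ IH g.
  have [u h] := IH (good_stage g vts iv); split=> // f.
  by rewrite h (compat_stage g vts iv _ np).
- move=> i lab ex v T0 pv b _ IH g.
  have [u h] := IH (good_exclude g pv); split=> // f.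
  rewrite /= h (compat_exclude g pv); split=> [[]//|c]; split=> //.
  apply/eqP => fv; have [_] := compat_include g pv f.
  by rewrite b => -[].
- move=> i lab ex v T0 T1 pv b _ IH0 _ IH1 g.
  have [u0 h0] := IH0 (good_exclude g pv); have [u1 h1] := IH1 (good_include g pv).
  split=> [|f] /=.
    rewrite cat_uniq u0 u1 andbT /=; apply/hasPn => f /h1 c1.
    apply/negP => /h0 /(compat_exclude g pv) [_ /eqP]; apply.
    by have [[]] := compat_include g pv f.
  rewrite mem_cat; split.
    case/orP => [/h0 /(compat_exclude g pv) [] //|/h1 c].
    by have [[]] := compat_include g pv f.
  move=> c; case: (eqVneq (f v) i) => fv; apply/orP; [right|left].
    by apply/h1; have [_ []] := compat_include g pv f.
  by apply/h0/(compat_exclude g pv).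
Qed.

(** Inversion in the form that the program follows: the pivot and [bad] determine the
    constructor. *)
Lemma grows_some i lab ex T v : grows i lab ex T -> pivot i lab ex = Some v ->
  (bad i lab ex v /\ exists2 T0, T = Node1 T0 & grows i lab (exclude i ex v) T0) \/
  (~~ bad i lab ex v /\ exists T0 T1, [/\ T = Node2 T0 T1,
     grows i lab (exclude i ex v) T0 & grows i (absorb i lab v) ex T1]).
Proof.
case=> {i lab ex T}.
- by move=> lab ex ->.
- by move=> i lab ex w T ->.
- by move=> i lab ex w T0 pv b g; rewrite pv => -[<-]; left; split=> //; exists T0.
- move=> i lab ex w T0 T1 pv b g0 g1; rewrite pv => -[<-].
  by right; split=> //; exists T0, T1.
Qed.

Lemma grows_none i lab ex T v : grows i lab ex T -> pivot i lab ex = None ->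
  v \in ts -> idx v = i.+1 -> grows i.+1 (absorb i.+1 lab v) ex T.
Proof.
case=> {i lab ex T}.
- by move=> lab ex _ _ /idx_le; rewrite leqNgt => /negP h e; case: h; rewrite e.
- by move=> i lab ex w T _ wts iw g _ vts iv; rewrite (idx_inj vts wts) // iv.
- by move=> i lab ex w T0 ->.
- by move=> i lab ex w T0 T1 ->.
Qed.

Lemma grows_leaf i lab ex T : grows i lab ex T -> pivot i lab ex = None -> i = k ->
  T = Leaf lab.
Proof.
case=> {i lab ex T} //.
- by move=> i lab ex w T _ /idx_le; rewrite leqNgt => /negP h e _ _ ik; case: h; rewrite e ik.
- by move=> i lab ex w T0 ->.
- by move=> i lab ex w T0 T1 ->.
Qed.

(** [L] is the list of leaves to the right of [p]. Changing one decision, at position [l], gives a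
    path whose [rest] is all of [L]; this is why a single number replaces a stack. *)
Definition pending T (p : seq bool) L (last : nat) : Prop :=
  if last is l.+1 then
    [/\ l < size p, vpath T (rcons (take l p) true)
      & L = rest T (rcons (take l p) true)]
  else L = [::].

(** [s0] is the path to be replayed from the root of [T], [p] the part walked so far, leading to the
    subtree [T'], and [s] the part still to be replayed. *)
Definition pathinv T s0 T' p s L last : Prop :=
  [/\ vpath T' s, rest T s0 = rest T' s ++ L,
      forall q, rest T (p ++ q) = rest T' q ++ L,
      forall q, vpath T (p ++ q) = vpath T' q
    & pending T p L last].

Lemma pathinv_start T s : vpath T s -> pathinv T s T [::] s [::] 0.
Proof. by split=> // [|q]; rewrite cats0. Qed.

Lemma pending_rcons T p d L last : pending T p L last -> pending T (rcons p d) L last.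
Proof.
case: last => // l [lp v e]; rewrite /pending size_rcons ltnS (ltnW lp).
by rewrite -(cats1 p) takel_cat // ltnW.
Qed.

Lemma pathinv_node1 T s0 T0 p s L last : pathinv T s0 (Node1 T0) p s L last ->
  head false s = false /\ pathinv T s0 T0 (rcons p false) (behead s) L last.
Proof.
case=> h1 h2 h3 h4 h5; split; first by case: s h1 {h2} => [|[]].
split.
- by case: s h1 {h2} => [|[]].
- by case: s h1 h2 => [|[]].
- by move=> q; rewrite cat_rcons h3.
- by move=> q; rewrite cat_rcons h4.
- exact: pending_rcons.
Qed.

(** The leaves of [T1] come before the older [L], so the deepest open alternative replaces the
    previous one. *)
Lemma pathinv_left T s0 T0 T1 p s L last : pathinv T s0 (Node2 T0 T1) p s L last ->
  head false s = false ->
  pathinv T s0 T0 (rcons p false) (behead s) (leaves T1 ++ L) (size p).+1.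
Proof.
case=> h1 h2 h3 h4 h5 hs; split.
- by case: s hs h1 {h2} => [|[]].
- by case: s hs h1 h2 => [|[]] //= *; rewrite catA.
- by move=> q; rewrite cat_rcons h3 /= catA.
- by move=> q; rewrite cat_rcons h4.
- by rewrite /pending size_rcons ltnSn -(cats1 p) takel_cat // take_size -cats1 h4 h3.
Qed.

Lemma pathinv_right T s0 T0 T1 p s L last : pathinv T s0 (Node2 T0 T1) p s L last ->
  head false s = true -> pathinv T s0 T1 (rcons p true) (behead s) L last.
Proof.
case=> h1 h2 h3 h4 h5 hs; split.
- by case: s hs h1 {h2} => [|[]].
- by case: s hs h1 h2 => [|[]].
- by move=> q; rewrite cat_rcons h3.
- by move=> q; rewrite cat_rcons h4.
- exact: pending_rcons.
Qed.

Lemma pathinv_leaf T s0 f p s L last : pathinv T s0 (Leaf f) p s L last ->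
  rest T s0 = f :: L.
Proof. by case=> + -> _ _ _; case: s => // -[]. Qed.

End Labellings.

(** * Labellings and minimal multiway cuts *)

Section Cuts.

Variables (V : finType) (E : {set {set V}}) (ts : seq V).
Hypothesis uts : uniq ts.

Implicit Types (f : {ffun V -> nat}) (M : {set {set V}}).

Local Notation k := (size ts).
Local Notation T := [set t in ts].

Definition cut f : {set {set V}} :=
  [set e in E | [exists x, exists y, (e == [set x; y]) && (f x != f y)]].

Lemma set2_inj (x y a b : V) : [set x; y] = [set a; b] ->
  (x = a /\ y = b) \/ (x = b /\ y = a).
Proof.
move=> e; have hx : x \in [set a; b] by rewrite -e set21.
have hy : y \in [set a; b] by rewrite -e set22.
have ha : a \in [set x; y] by rewrite e set21.
have hb : b \in [set x; y] by rewrite e set22.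
move: hx hy ha hb; rewrite !inE.
by do 4![case/orP=> /eqP ?]; subst; auto.
Qed.

Lemma cutE f x y : ([set x; y] \in cut f) = adj E x y && (f x != f y).
Proof.
rewrite inE /adj; congr andb; apply/existsP/idP => [[a /existsP [b /andP [/eqP e ab]]]|xy].
  by case: (set2_inj e) => -[-> ->] //; rewrite eq_sym.
by exists x; apply/existsP; exists y; rewrite eqxx.
Qed.

Lemma adj_cut f : adj (E :\: cut f) =2 mono E f.
Proof.
move=> x y; rewrite {1}/adj inE cutE /mono; case: (boolP (adj E x y)) => [h|/negbTE h].
  by rewrite /= negbK andbC; rewrite /adj in h; rewrite h.
by rewrite /adj in h; rewrite h andbF.
Qed.

Lemma mono_class f x y : connect (mono E f) x y -> f y = f x.
Proof. exact: connect_mono_class. Qed.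

Lemma cut_multiway f : sol E ts f -> multiway_cut E T (cut f).
Proof.
case=> f1 f2 f3; apply/andP; split; first by apply/subsetP => e; rewrite inE => /andP [].
apply/forall_inP => s; rewrite inE => sts; apply/forall_inP => t; rewrite inE => tts.
apply/implyP; apply: contra; rewrite (eq_connect (adj_cut f)) => /mono_class.
by rewrite !f2 // => e; rewrite (idx_inj sts tts) // e.
Qed.

Lemma sub_adj M M' : M' \subset M -> subrel (adj (E :\: M)) (adj (E :\: M')).
Proof. by move=> s x y; apply/subsetP; rewrite setDS. Qed.

(** Putting back an edge [xy] between two classes joins their terminals: each class is connected, so
    one can go from one terminal to [x], across, and on to the other. *)
Lemma cut_minimal f : sol E ts f -> minimal_multiway_cut E T (cut f).
Proof.
move=> sf; have [f1 f2 f3] := sf; apply/minsetP; split; first exact: cut_multiway.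
move=> M /andP [ME Mcut] sub; apply/eqP; rewrite eqEsubset sub /=.
apply/subsetP => e; rewrite inE => /andP [eE] /existsP [x /existsP [y /andP [/eqP exy fxy]]].
apply/negPn/negP => eM; pose r u := troot ts u (f u).
have [rx ix] := idx_root uts x (f1 x); have [ry iy] := idx_root uts y (f1 y).
have := forall_inP Mcut (r x); rewrite inE rx => /(_ isT) /forall_inP /(_ (r y)).
rewrite inE ry => /(_ isT) /implyP; case/(_ _)/negP.
  by apply: contra fxy => /eqP e'; rewrite -ix -iy -[troot _ y _]/(r y) -e'.
have h a b : connect (mono E f) a b -> connect (adj (E :\: M)) a b.
  apply: connect_sub => u v; rewrite -adj_cut => /(sub_adj sub); exact: connect1.
apply: connect_trans (h _ _ (f3 x)) _; apply: (@connect_trans _ _ y).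
  by apply: connect1; rewrite /adj inE -exy eM.
rewrite sym_connect_sym; first exact/h/f3.
by move=> ? ?; rewrite adj_sym.
Qed.

Lemma cut_inj f g : sol E ts f -> sol E ts g -> cut f = cut g -> f = g.
Proof.
move=> [f1 f2 f3] [g1 g2 g3] e; apply/ffunP => u.
have [rts ri] := idx_root uts u (f1 u).
have := f3 u; rewrite -(eq_connect (adj_cut f)) e (eq_connect (adj_cut g)).
by move/mono_class => ->; rewrite g2 // ri.
Qed.

Hypothesis conn : connected_graph E.

(** Each component of the graph without [M] contains exactly one terminal, and [f] numbers the
    components by these terminals. *)
Lemma minimal_cut M : 0 < k -> minimal_multiway_cut E T M -> exists2 f, sol E ts f & M = cut f.
Proof.
move=> k0 /minsetP [/andP [ME Mcut] Mmin].
set R := adj (E :\: M).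
have Rsym : connect_sym R by apply: sym_connect_sym => ? ?; rewrite /R adj_sym.
have sepM s t : s \in ts -> t \in ts -> connect R s t -> s = t.
  move=> sts tts c; apply/eqP/negPn/negP => st.
  have := forall_inP Mcut s; rewrite inE sts => /(_ isT) /forall_inP /(_ t).
  by rewrite inE tts st c => /(_ isT).
have cov u : exists2 t, t \in ts & connect R t u.
  apply/exists_inP; apply: contraT => nt.
  have [t0 t0ts] : exists t, t \in ts.
    by case: (ts) k0 => // t s _; exists t; rewrite inE eqxx.
  have nD t : t \in ts -> ~~ connect R u t.
    move=> tts; apply: contra nt => c; apply/exists_inP; exists t => //.
    by rewrite Rsym.
  (* The component of [u] has no terminal, so by connectivity some edge [xy] leaves it. Restoring
     this edge merges the component with that of [y] and joins no two terminals, contrary to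
     minimality. *)
  have [x [y [ux uy xy]]] : exists x y, [/\ connect R u x, ~~ connect R u y & adj E x y].
    have /forallP /(_ u) /forallP /(_ t0) /connectP [p pp e] := conn.
    have := nD _ t0ts; rewrite e {e}; have := connect0 R u.
    suff H a : path (adj E) a p -> connect R u a -> ~~ connect R u (last a p) ->
      exists x y, [/\ connect R u x, ~~ connect R u y & adj E x y] by exact: H.
    elim: p a {pp} => [|b p IH] a /=; first by move=> _ ->.
    move=> /andP [ab pb] ua ul; case: (boolP (connect R u b)) => ub.
      exact: IH pb ub ul.
    by exists a, b.
  have xyM : [set x; y] \in M.
    apply: contraR uy => nM; apply: connect_trans ux (connect1 _).
    by rewrite /R /adj inE nM.
  have := Mmin (M :\ [set x; y]); rewrite subD1set => /(_ _ isT) e.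
  suff /e eM : multiway_cut E T (M :\ [set x; y]).
    by move: xyM; rewrite -eM !inE eqxx.
  apply/andP; split; first by apply: subset_trans ME; apply: subD1set.
  apply/forall_inP => s; rewrite inE => sts; apply/forall_inP => t; rewrite inE => tts.
  apply/implyP; apply: contra => c; apply/eqP/sepM => //.
  (* The component of a vertex after the merge; it is constant along all edges that remain, [xy]
     included. *)
  pose g v := root R (if connect R u v then y else v).
  have gE a b : connect R a b -> g a = g b.
    move=> ab; rewrite /g; have -> : connect R u b = connect R u a.
      by apply/idP/idP => h; apply: connect_trans h _; rewrite // Rsym.
    by case: ifP => // _; apply/eqP; rewrite (root_connect Rsym).
  have gxy : g x = g y by rewrite /g ux (negbTE uy).
  have : g s = g t.
    apply/esym; apply: (connect_ind (P := fun v => g v = g s) _ _ c) => // a b <-.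
    rewrite /adj !inE => /andP [nab abE]; case: (boolP ([set a; b] \in M)) => abM; last first.
      by apply/esym/gE/connect1; rewrite /R /adj inE abM.
    rewrite abM andbT negbK in nab.
    by case: (set2_inj (eqP nab)) => -[-> ->].
  rewrite /g (negbTE (nD _ sts)) (negbTE (nD _ tts)) => /eqP.
  by rewrite (root_connect Rsym).
pose p u := find (fun t => connect R t u) ts.
have p_ts u : p u < k by rewrite -has_find; apply/hasP; case: (cov u) => t; exists t.
have pc u t0 : connect R (nth t0 ts (p u)) u.
  have h : has (fun t => connect R t u) ts by rewrite has_find p_ts.
  by rewrite (set_nth_default u) //; apply: (nth_find u h).
pose f := [ffun u => (p u).+1].
have fR a b : connect R a b -> f a = f b.
  move=> ab; rewrite !ffunE /p; congr _.+1; apply: eq_find => t.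
  by apply/idP/idP => h; apply: connect_trans h _; rewrite // Rsym.
have sub : cut f \subset M.
  apply/subsetP => e; rewrite inE => /andP [eE] /existsP [x /existsP [y /andP [/eqP exy]]].
  apply: contraR => eM; apply/eqP/fR/connect1; by rewrite /R /adj inE -exy eM.
have sf : sol E ts f.
  split=> [u|t tts|u].
  - by rewrite ffunE p_ts.
  - rewrite ffunE /idx -[in RHS](sepM (nth t ts (p t)) t) ?index_uniq //.
    by rewrite mem_nth.
  - rewrite ffunE /troot /=; have := pc u u.
    apply: connect_sub => a b ab; apply: connect1; rewrite /mono (fR a b) ?connect1 //.
    by rewrite eqxx andbT; move: ab; rewrite /R /adj inE => /andP [].
exists f => //; apply/esym/Mmin => //; exact: cut_multiway.
Qed.

End Cuts.

(** With at least two vertices, connectivity puts every vertex on an edge, and an edge covers two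
    vertices. *)
Lemma card_le_edges (V : finType) (E : {set {set V}}) :
  simple_graph E -> connected_graph E -> 1 < #|V| -> #|V| <= 2 * #|E|.
Proof.
move=> /forall_inP sg cg lt; rewrite mulnC -sum_nat_const.
rewrite (eq_bigr (fun e : {set V} => #|e|)); last by move=> e /sg /eqP.
apply: (@leq_trans #|cover E|); last exact: leq_card_cover.
rewrite -cardsT; apply/subset_leq_card/subsetP => u _.
have [w uw] : exists w, w != u.
  apply/existsP; apply: contraLR lt => /existsPn h; rewrite -leqNgt -cardsT.
  rewrite -(cards1 u); apply/subset_leq_card/subsetP => w _; rewrite inE.
  by have := h w; rewrite negbK.
have /forallP /(_ u) /forallP /(_ w) /connectP [[|b p]] := cg; first by move=> _ e; rewrite e eqxx in uw.
by case/andP=> ub _ _; apply/bigcupP; exists [set u; b]; rewrite ?set21.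
Qed.

(** * The program *)

(* Arrays.  Input: endpoints of the edges, terminals.  LAB: class of a vertex, 0
   for none.  EX: last class from which a vertex has been excluded, k + 1 for the
   terminals.  MK, QU: marks and queue of the graph search.  DEG, ADJ: adjacency
   lists, the neighbours of u being stored from position 2mu on.  DEC: decisions.
   Registers: 0 is the current class, 1 the pivot, 2 tells whether there is one, 3
   is the depth, 4 the number of decisions to replay, 5 is 1 + the last position
   where the decision can be changed (0 if none), 6 and 7 are loop guards. *)
Definition ED := 0.
Definition TM := 1.
Definition LAB := 2.
Definition EX := 3.
Definition MK := 4.
Definition QU := 5.
Definition DEG := 6.
Definition ADJ := 7.
Definition DEC := 8.

(** Each vertex has a row of fixed width [2 * m] in [ADJ], which bounds its degree, so that
    addresses are computed by a product. [DEC] has length [k * n], the bound on the number of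
    decisions. *)
Definition lens (n m k j : nat) : nat :=
  match j with
  | 0 => 2 * m
  | 1 => k
  | 2 | 3 | 4 | 5 | 6 => n
  | 7 => n * (2 * m)
  | _ => k * n
  end.

Definition consts (n m k x : nat) : nat :=
  match x with 20 => 1 | 21 => n | 22 => m | 23 => k | _ => 2 * m end.

Definition append_to (x y : nat) : cmd :=
  Get 15 DEG x ;; Mul 16 x 24 ;; Add 16 16 15 ;; Put ADJ 16 y ;;
  Add 15 15 20 ;; Put DEG x 15.

Definition read_edge : cmd :=
  Add 12 8 8 ;; Get 13 ED 12 ;; Add 12 12 20 ;; Get 14 ED 12.

Definition build : cmd :=
  Const 8 0 ;; For 8 9 22 (read_edge ;; append_to 13 14 ;; append_to 14 13).

(** Two truncated subtractions test equality with the current class; [Const 1 0 ;; Add 1 1 y] copies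
    a register. *)
Definition check (x y : nat) : cmd :=
  Get 15 LAB x ;; Minus 16 15 0 ;;
  If 16 Skip (Minus 16 0 15 ;;
  If 16 Skip (Get 15 LAB y ;;
  If 15 Skip (Get 15 EX y ;; Minus 15 0 15 ;;
  If 15 (Const 1 0 ;; Add 1 1 y ;; Const 2 1) Skip))).

Definition find_pivot : cmd :=
  Const 2 0 ;; Const 8 0 ;; For 8 9 22 (read_edge ;; check 13 14 ;; check 14 13).

Definition push (x : nat) : cmd :=
  Get 15 MK x ;; If 15 Skip (Put MK x 20 ;; Put QU 17 x ;; Add 17 17 20).

Definition search : cmd :=
  While 19 (Get 12 QU 18 ;; Add 18 18 20 ;; Get 13 DEG 12 ;; Mul 14 12 24 ;;
    Const 10 0 ;; For 10 11 13 (Add 15 14 10 ;; Get 16 ADJ 15 ;; push 16) ;;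
    Minus 19 17 18).

(** Copying the labels into [MK] makes assigned vertices count as visited. The vertex in register 1
    is marked to block the search and unmarked afterwards, as it is itself unreached. The loop over
    terminals starts at position [i], the terminal of class [i.+1]. *)
Definition reach : cmd :=
  (Const 8 0 ;; For 8 9 21 (Get 12 LAB 8 ;; Put MK 8 12)) ;;
  Put MK 1 20 ;;
  Const 17 0 ;; Const 8 0 ;; Add 8 8 0 ;;
  For 8 9 23 (Get 12 TM 8 ;; push 12) ;;
  Const 18 0 ;; Minus 19 17 18 ;; search ;;
  Const 12 0 ;; Put MK 1 12.

Definition test_bad : cmd :=
  Const 13 0 ;; Const 8 0 ;;
  For 8 9 21 (Get 12 MK 8 ;;
    If 12 Skip (Get 12 EX 8 ;; Add 12 12 20 ;; Minus 12 12 0 ;; If 12 (Const 13 1) Skip)).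

Definition relabel : cmd :=
  Const 8 0 ;; For 8 9 21 (Get 12 MK 8 ;; If 12 Skip (Put LAB 8 0)).

Definition branch : cmd :=
  reach ;; test_bad ;;
  (Const 14 0 ;; Minus 15 4 3 ;; If 15 (Get 14 DEC 3) Skip) ;;
  If 14 relabel (Put EX 1 0 ;; If 13 Skip (Add 5 3 20)) ;;
  Put DEC 3 14 ;; Add 3 3 20.

Definition next_stage : cmd :=
  Minus 15 23 0 ;; If 15 (Get 1 TM 0 ;; Add 0 0 20 ;; reach ;; relabel) (Const 7 0).

Definition descend : cmd := find_pivot ;; If 2 branch next_stage.

Definition init : cmd :=
  (Const 8 0 ;; Const 12 0 ;; For 8 9 21 (Put LAB 8 12 ;; Put EX 8 12)) ;;
  (Const 8 0 ;; Add 13 23 20 ;; For 8 9 23 (Get 12 TM 8 ;; Put EX 12 13)) ;;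
  Const 0 0 ;; Const 3 0 ;; Const 5 0 ;; Const 7 1.

Definition output : cmd :=
  (Const 8 0 ;; For 8 9 22 (read_edge ;; Get 13 LAB 13 ;; Get 14 LAB 14 ;;
    Minus 12 13 14 ;; If 12 (Emit 8) (Minus 12 14 13 ;; If 12 (Emit 8) Skip))) ;;
  EndSol.

Definition advance : cmd :=
  If 5 (Minus 5 5 20 ;; Put DEC 5 20 ;; Const 4 0 ;; Add 4 5 20) (Const 6 0).

Definition round : cmd := init ;; While 7 descend ;; output ;; advance.

Definition setup : cmd := Const 4 0 ;; Const 6 1 ;; build.

Section Neighbours.

Variable V : finType.
Implicit Type es : seq (V * V).

Definition nbs es (u : V) : seq V :=
  flatten [seq (if e.1 == u then [:: e.2] else [::])
            ++ (if e.2 == u then [:: e.1] else [::]) | e <- es].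

Lemma mem_nbs es u w : (w \in nbs es u) = ((u, w) \in es) || ((w, u) \in es).
Proof.
apply/flatten_mapP/idP => [[[x y] xy]|]; rewrite /=.
  by rewrite mem_cat => /orP []; case: eqP => // <-; rewrite inE => /eqP ->;
     rewrite xy ?orbT.
by case/orP => h; [exists (u, w)|exists (w, u)]; rewrite // mem_cat eqxx inE eqxx ?orbT.
Qed.

(** The handshake identity, which makes the search linear in the number of edges. *)
Lemma sum_nbs es : \sum_u size (nbs es u) = 2 * size es.
Proof.
elim: es => [|e es IH]; first by rewrite big1.
rewrite (eq_bigr (fun u => (e.1 == u) + (e.2 == u) + size (nbs es u))); last first.
  by move=> u _; rewrite /nbs /= !size_cat -/(nbs es u); case: eqP; case: eqP.
have one (x : V) : \sum_u (x == u : nat) = 1.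
  by rewrite (bigD1 x) //= eqxx big1 // => u; rewrite eq_sym => /negbTE ->.
by rewrite !big_split /= !one IH; lia.
Qed.

Lemma size_nbs es u : size (nbs es u) <= 2 * size es.
Proof.
rewrite /nbs size_flatten /shape -map_comp; elim: es => //= e es IH.
rewrite size_cat; have h (b : bool) (x : V) : size (if b then [:: x] else [::]) <= 1 by case: b.
have := h (e.1 == u) e.2; have := h (e.2 == u) e.1; lia.
Qed.

Section Push.

Variables (lab : {ffun V -> nat}) (v : V).
Implicit Types q l : seq V.

Definition fresh (q : seq V) (x : V) : bool := [&& lab x == 0, x != v & x \notin q].

Definition pushq (q : seq V) (x : V) : seq V := if fresh q x then rcons q x else q.

Lemma mem_pushq q x y :
  (y \in pushq q x) = (y \in q) || [&& y == x, lab x == 0 & x != v].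
Proof.
rewrite /pushq /fresh; case: (lab x == 0); case: (x != v); rewrite ?andbF ?orbF ?andbT //=.
by case: (boolP (x \in q)) => xq; rewrite /= ?mem_rcons ?inE;
   case: eqP => [->|]; rewrite ?xq ?orbT ?orbF.
Qed.

Lemma mem_foldl_pushq q l y :
  (y \in foldl pushq q l) = (y \in q) || [&& y \in l, lab y == 0 & y != v].
Proof.
elim: l q => [|x l IH] q /=; first by rewrite orbF.
rewrite IH mem_pushq inE; case: (y =P x) => [->|_] /=; last by rewrite orbF.
by case: (lab x == 0); case: (x != v); rewrite ?andbF ?orbF ?andbT ?orbT.
Qed.

Lemma foldl_pushq_cat q l : exists s, foldl pushq q l = q ++ s.
Proof.
elim: l q => [|x l IH] q /=; first by exists [::]; rewrite cats0.
have [s ->] := IH (pushq q x); rewrite /pushq; case: ifP => _; last by exists s.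
by exists (x :: s); rewrite cat_rcons.
Qed.

End Push.
End Neighbours.

Section Correctness.

Variables (V : finType) (E : {set {set V}}) (vs ts : seq V) (es : seq (V * V)).
Variable S : nat.

Local Notation n := (size vs).
Local Notation m := (size es).
Local Notation k := (size ts).

Hypotheses (uvs : uniq vs) (mvs : forall u, u \in vs) (uts : uniq ts).
Hypothesis adj_es : forall x y, adj E x y = ((x, y) \in es) || ((y, x) \in es).
Hypothesis hS : n + 2 * m + k + n * (2 * m) + k * n + 3 <= S.

Local Notation val := (rval (consts n m k)).
Local Notation spec := (spec (lens n m k) (consts n m k) S).

Lemma v20 a : val a 20 = 1. Proof. by []. Qed.
Lemma v21 a : val a 21 = n. Proof. by []. Qed.
Lemma v22 a : val a 22 = m. Proof. by []. Qed.
Lemma v23 a : val a 23 = k. Proof. by []. Qed.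
Lemma v24 a : val a 24 = 2 * m. Proof. by []. Qed.

Definition ix (u : V) : nat := index u vs.

Lemma ix_lt u : ix u < n. Proof. by rewrite index_mem. Qed.
Lemma ix_inj : injective ix.
Proof. by move=> u v e; rewrite -(nth_index u (mvs u)) -/(ix u) e nth_index. Qed.
Lemma ix_eq u v : (ix u == ix v) = (u == v).
Proof. exact: inj_eq ix_inj _ _. Qed.
Lemma ixP x : x < n -> exists u, x = ix u.
Proof.
move=> lt; have v0 : V by case: vs lt.
by exists (nth v0 vs x); rewrite /ix index_uniq.
Qed.

Definition instance (a : ast) : Prop :=
  (forall e0 j, j < m -> ar a ED (2 * j) = ix (nth e0 es j).1 /\
                         ar a ED (2 * j).+1 = ix (nth e0 es j).2)
  /\ forall t0 j, j < k -> ar a TM j = ix (nth t0 ts j).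

Definition arr (a : ast) (j : nat) (f : V -> nat) : Prop := forall u, ar a j (ix u) = f u.

Lemma spec_read_edge a e0 : instance a -> val a 8 < m ->
  spec read_edge a 6 (fun a' =>
    val a' 13 = ix (nth e0 es (val a 8)).1 /\ val a' 14 = ix (nth e0 es (val a 8)).2).
Proof.
move=> [he _] lt; apply: spec_wp => //=.
have [h1 h2] := he e0 _ lt.
have d : val a 8 + val a 8 = 2 * val a 8 by lia.
rewrite d; split; first by lia.
move=> p ->; rewrite rval_set //=; split; first by lia.
move=> u ->; rewrite v20 !rval_set //= addn1; split; first lia.
move=> p' ->; rewrite rval_set //=; split; first lia.
by move=> w ->; rewrite !rval_set //= h1 h2.
Qed.

Definition found_last (c : seq V) (a : ast) : Prop :=
  if c is w :: s then val a 2 = 1 /\ val a 1 = ix (last w s) else val a 2 = 0.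

Lemma spec_check a x y i (lab ex : {ffun V -> nat}) u w c :
  (x, y) \in [:: (13, 14); (14, 13)] ->
  arr a LAB lab -> arr a EX ex -> val a 0 = i -> val a x = ix u -> val a y = ix w ->
  found_last c a ->
  spec (check x y) a 16
    (found_last (c ++ if cand i lab ex u w then [:: w] else [::])).
Proof.
move=> xy hl he i0 xu yw fc; have ul := ix_lt u; have wl := ix_lt w.
have fr a' : val a' 2 = 1 -> val a' 1 = ix w -> found_last (c ++ [:: w]) a'.
  by case: c {fc} => // z s; rewrite /= last_cat.
suff H : wp (lens n m k) (consts n m k) S (check x y)
    (found_last (c ++ (if cand i lab ex u w then [:: w] else [::]))) a.
  exact: (spec_wp H).
have xy0 : val a x < n /\ val a y < n by rewrite xu yw.
move: xy; rewrite !inE => /orP [] /eqP [ex' ey]; subst x y; case: xy0 => xn yn;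
  split=> // t1; rewrite xu hl => -> t2; rewrite !rval_set //= i0 => ->.
all: case: eqP => h1; last first.
all: try by rewrite /cand (_ : (lab u == i) = false) ?cats0 //; apply/eqP; clear -h1; lia.
all: move=> t3 ->; rewrite rval_set //=.
all: case: eqP => h2; last first.
all: try by rewrite /cand (_ : (lab u == i) = false) ?cats0 //; apply/eqP; clear -h2; lia.
all: rewrite !rval_set //=; split=> // t4; rewrite yw hl => ->; rewrite !rval_set //=.
all: rewrite /cand (_ : (lab u == i) = true); last by apply/eqP; clear -h1 h2; lia.
all: case: eqP => h3; rewrite /= ?cats0 //.
all: split=> // t5; rewrite yw he => ->.
all: move=> t6; rewrite !rval_set //= i0 => ->.
all: case: eqP => h4; first by rewrite ifF ?cats0 //; apply/negbTE; clear -h4; lia.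
all: split=> //; rewrite ?rval_set //= yw; split; first lia.
all: move=> t7 ->; split; first lia.
all: by rewrite ifT; [apply: fr; rewrite !rval_set //= add0n|clear -h4; lia].
Qed.

Lemma same_val c a a' (x : nat) :
  same (consts n m k) c a a' -> x \notin modr c -> val a' x = val a x.
Proof. by case=> h _ _; apply: h. Qed.

Lemma same_ar c a a' (j : nat) i :
  same (consts n m k) c a a' -> j \notin moda c -> ar a' j i = ar a j i.
Proof. by case=> _ h _; apply: h. Qed.

Lemma same_arr c a a' (j : nat) f :
  same (consts n m k) c a a' -> j \notin moda c -> arr a j f -> arr a' j f.
Proof. by move=> s nj h u; rewrite (same_ar _ s). Qed.

Lemma same_instance c a a' : same (consts n m k) c a a' ->
  (ED \notin moda c) && (TM \notin moda c) -> instance a -> instance a'.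
Proof.
move=> s /andP [n0 n1] [h0 h1]; split=> [e0 j jm|t0 j jk].
  by rewrite !(same_ar _ s) //; apply: h0.
by rewrite (same_ar _ s) //; apply: h1.
Qed.

Lemma take_nthS (T : Type) (x0 : T) s j : j < size s ->
  take j.+1 s = take j s ++ [:: nth x0 s j].
Proof. by move=> lt; rewrite (take_nth x0) // cats1. Qed.

Lemma spec_find_pivot a i (lab ex : {ffun V -> nat}) :
  instance a -> arr a LAB lab -> arr a EX ex -> val a 0 = i ->
  spec find_pivot a (m * 41 + 4) (fun a' =>
    if pivot es i lab ex is Some v then val a' 2 = 1 /\ val a' 1 = ix v
    else val a' 2 = 0).
Proof.
move=> ia hl he i0.
apply: (spec_seq (N1 := 1) (N2 := m * 41 + 3) (Q := fun a' => val a' 2 = 0)); last lia.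
  by apply: spec_wp => //=; rewrite rval_set.
move=> a1 s1 z1.
apply: (spec_seq (N1 := 1) (N2 := m * 41 + 2) (Q := fun a' => val a' 8 = 0)); last lia.
  by apply: spec_wp => //=; rewrite rval_set.
move=> a2 s2 x0.
have i2 : instance a2 by apply: (same_instance s2 _ (same_instance s1 _ _)).
have l2 : arr a2 LAB lab by apply: (same_arr s2 _ (same_arr s1 _ _)).
have e2 : arr a2 EX ex by apply: (same_arr s2 _ (same_arr s1 _ _)).
have i02 : val a2 0 = i by rewrite (same_val s2) // (same_val s1).
have z2 : val a2 2 = 0 by rewrite (same_val s2).
pose I j a' := found_last (cands (take j es) i lab ex) a'.
apply: spec_weak (leqnn _) _.
  apply: (spec_for (cst := consts n m k) erefl (K := 38) (I := I)) => //.
  - by rewrite v22; lia.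
  - by rewrite x0.
  - by move=> j a3 z v /orP [] /eqP ->.
  - by rewrite x0 /I take0.
  - rewrite v22 => j a3 jm s3 Ia3 xj.
    have e0 : V * V by case: es jm.
    have i3 := same_instance s3 isT i2; have l3 := same_arr s3 isT l2.
    have e3 := same_arr s3 isT e2; have i03 : val a3 0 = i by rewrite (same_val s3).
    have jm' : val a3 8 < m by rewrite xj.
    have xj' : val a3 8 = j by rewrite xj.
    apply: (spec_seq (N1 := 6) (N2 := 32) (spec_read_edge e0 i3 jm')); last by [].
    rewrite xj' => a4 s4 [u4 w4].
    have := take_nthS e0 jm; set e := nth e0 es j in u4 w4 * => te.
    have f4 : found_last (cands (take j es) i lab ex) a4.
      move: Ia3; rewrite /I /found_last; case: (cands _ _ _ _) => [|? ?];
      by rewrite !(same_val s4).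
    apply: (spec_seq (N1 := 16) (N2 := 16)
      (spec_check (u := e.1) (w := e.2) (i := i) (c := cands (take j es) i lab ex) _
         (same_arr s4 isT l3) (same_arr s4 isT e3) _ u4 w4 f4)); rewrite ?(same_val s4) //.
    move=> a5 s5 f5.
    apply: spec_weak (leqnn _) _.
      apply: (spec_check (u := e.2) (w := e.1) (i := i) _ _ _ _ _ _ f5) => //.
      + exact: (same_arr s5 isT (same_arr s4 isT l3)).
      + exact: (same_arr s5 isT (same_arr s4 isT e3)).
      + by rewrite (same_val s5) // (same_val s4).
      + by rewrite (same_val s5).
      + by rewrite (same_val s5).
    move=> a6 _; rewrite /I te /cands map_cat flatten_cat /= cats0 catA; exact.
  - by rewrite v22 x0 subn0.
move=> a3 _ [Ia3 _]; move: Ia3; rewrite v22 /I take_size /found_last /pivot.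
by case: (cands _ _ _ _).
Qed.

Definition bfs (lab : {ffun V -> nat}) (v : V) (q : seq V) (a : ast) : Prop :=
  [/\ uniq q, val a 17 = size q,
      forall u0 j, j < size q -> ar a QU j = ix (nth u0 q j)
    & forall u, (ar a MK (ix u) == 0) = fresh lab v q u].

Lemma uniq_size (q : seq V) : uniq q -> size q <= n.
Proof. by move=> uq; apply: uniq_leq_size => // u _; apply: mvs. Qed.

Lemma same_bfs c a a' lab v q : same (consts n m k) c a a' ->
  [&& 17 \notin modr c, QU \notin moda c & MK \notin moda c] ->
  bfs lab v q a -> bfs lab v q a'.
Proof.
move=> s /and3P [h1 h2 h3] [b1 b2 b3 b4]; split=> //.
- by rewrite (same_val s).
- by move=> u0 j jq; rewrite (same_ar _ s) //; apply: b3.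
- by move=> u; rewrite (same_ar _ s).
Qed.

Lemma spec_push lab v a (r : nat) x q : r \in [:: 12; 16] ->
  val a r = ix x -> bfs lab v q a -> spec (push r) a 8 (bfs lab v (pushq lab v q x)).
Proof.
move=> r12 rx [b1 b2 b3 b4].
suff H : wp (lens n m k) (consts n m k) S (push r) (bfs lab v (pushq lab v q x)) a.
  exact: (spec_wp H).
have xl := ix_lt x; rewrite /push /= rx; split=> // t ->.
rewrite rval_set //= b4 /pushq; case fx: (fresh lab v q x); last first.
  by split; rewrite ?rval_set.
have [_ _ xq] := and3P fx.
(* The queue holds distinct vertices, so a new one still fits in the array. *)
have lt : size q < n.
  by rewrite -(size_rcons q x); apply: uniq_size; rewrite rcons_uniq xq.
have r' : forall b w, rval (consts n m k) (set b 15 w) r = val b r.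
  by move=> b w; rewrite rval_set //; move: r12; rewrite !inE => /orP [] /eqP ->.
rewrite r' rx; split=> //; rewrite !rval_put !r' rx !rval_set //= b2; split=> //.
split; first by rewrite v20; lia.
move=> w ->; split.
- by rewrite rcons_uniq xq.
- by rewrite rval_set //= v20 size_rcons addn1.
- move=> u0 j; rewrite size_rcons ltnS leq_eqVlt nth_rcons /= => /orP [/eqP ->|jq].
    by rewrite ltnn !eqxx.
  by rewrite jq (ltn_eqF jq); apply: b3.
- move=> u /=; rewrite ix_eq; case: (u =P x) => [->|/eqP ux].
    by rewrite v20 /fresh mem_rcons inE eqxx !andbF.
  by rewrite b4 /fresh mem_rcons inE (negbTE ux).
Qed.

Definition adjacency (L : V -> seq V) (a : ast) : Prop :=
  forall u, [/\ size (L u) <= 2 * m, ar a DEG (ix u) = size (L u)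
    & forall w0 j, j < size (L u) -> ar a ADJ (ix u * (2 * m) + j) = ix (nth w0 (L u) j)].

Lemma same_adjacency c a a' L : same (consts n m k) c a a' ->
  (DEG \notin moda c) && (ADJ \notin moda c) -> adjacency L a -> adjacency L a'.
Proof.
move=> s /andP [h1 h2] h u; have [l1 l2 l3] := h u; split=> //.
  by rewrite (same_ar _ s).
by move=> w0 j lt; rewrite (same_ar _ s) //; apply: l3.
Qed.

Lemma adj_addr u j : j < 2 * m -> ix u * (2 * m) + j < n * (2 * m).
Proof.
move=> lt; have ul := ix_lt u.
by apply: (@leq_trans ((ix u).+1 * (2 * m))); rewrite ?leq_mul2r ?ul ?orbT // mulSn addnC ltn_add2r.
Qed.

Lemma spec_search i lab v a q0 :
  adjacency (nbs es) a -> bfs lab v q0 a -> val a 18 = 0 -> val a 19 = size q0 ->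
  {in q0, forall u, [/\ lab u = 0, u != v & reached E ts i lab v u]} ->
  (forall t, t \in ts -> i < idx ts t -> t != v -> t \in q0) ->
  spec search a (28 * m + 11 * n + 1) (fun a' =>
    forall u, (ar a' MK (ix u) == 0) = [&& lab u == 0, u != v & ~~ reached E ts i lab v u]).
Proof.
move=> hadj b0 h0 t0 r0 src.
pose inv q hd a' := [/\ bfs lab v q a', val a' 18 = hd, hd <= size q,
   val a' 19 = size q - hd & [/\ {subset q0 <= q},
   {in q, forall u, [/\ lab u = 0, u != v & reached E ts i lab v u]} &
   {in take hd q, forall u w, adj E u w -> lab w = 0 -> w != v -> w \in q}]].
(* A vertex not yet dequeued keeps a credit for its later treatment: 14 per neighbour, that is 11
   for the body and 3 for the loop, plus 11 for the rest. The initial sum is evaluated by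
   [sum_nbs]. *)
pose I p a' := exists q hd, inv q hd a' /\
   p = \sum_(u | u \notin take hd q) (14 * size (nbs es u) + 11).
have Ia : I (28 * m + 11 * n) a.
  exists q0, 0; split; first by split=> //; rewrite ?take0 ?subn0 //; split.
  rewrite take0 (eq_bigl xpredT) // big_split /= -big_distrr /= sum_nbs.
  rewrite sum_nat_const; have -> : #|V| = n.
    by rewrite -(card_uniqP uvs); apply: eq_card => u; rewrite mvs.
  by lia.
rewrite addn1; apply: spec_weak (leqnn _) _; first apply: (spec_while Ia).
  move=> p a1 [q [hd [[b1 h1 le1 t1 [sub1 re1 cl1]] ->]]] s1 nz.
  have lt : hd < size q by rewrite -subn_gt0 -t1 lt0n.
  have [u0 _] : exists u0 : V, True by case: q lt {b1 le1 t1 sub1 re1 cl1} => // u0; exists u0.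
  set u := nth u0 q hd; have [uq q17 qu mk] := b1.
  have uin : u \in q by apply: mem_nth.
  have un : u \notin take hd q.
    have : uniq (take hd q ++ u :: drop hd.+1 q) by rewrite -drop_nth // cat_take_drop.
    by rewrite cat_uniq /= negb_or => /and3P [_ /andP []].
  rewrite (bigD1 u) //=; set p' := \sum_(_ | _) _.
  have [d1 d2 d3] := hadj u.
  exists (14 * size (nbs es u) + 10); first by lia.
  apply: (spec_seq (N1 := 2) (N2 := 14 * size (nbs es u) + 8)
     (Q := fun a' => val a' 12 = ix u)); last lia.
    apply: spec_wp => //=; rewrite h1; split; first exact: leq_trans (uniq_size uq).
    by move=> w ->; rewrite rval_set //= (qu u0).
  move=> a2 s2 x2.
  apply: (spec_seq (N1 := 1) (N2 := 14 * size (nbs es u) + 7)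
     (Q := fun a' => val a' 18 = hd.+1)); last lia.
    apply: spec_wp => //=; rewrite (same_val s2) // h1 v20; split; first by have := uniq_size uq; lia.
    by move=> w ->; rewrite rval_set //= addn1.
  move=> a3 s3 x3.
  have x12 : val a3 12 = ix u by rewrite (same_val s3).
  apply: (spec_seq (N1 := 2) (N2 := 14 * size (nbs es u) + 5)
     (Q := fun a' => val a' 13 = size (nbs es u))); last lia.
    apply: spec_wp => //=; rewrite x12; split; first exact: ix_lt.
    by move=> w ->; rewrite rval_set //= (same_ar _ s3) // (same_ar _ s2) // (same_ar _ s1).
  move=> a4 s4 x4.
  apply: (spec_seq (N1 := 1) (N2 := 14 * size (nbs es u) + 4)
     (Q := fun a' => val a' 14 = ix u * (2 * m))); last lia.
    apply: spec_wp => //=; rewrite (same_val s4) // x12 v24.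
    have : ix u * (2 * m) <= n * (2 * m) by rewrite leq_mul2r (ltnW (ix_lt u)) orbT.
    by split; [lia|move=> w ->; rewrite rval_set].
  move=> a5 s5 x5.
  apply: (spec_seq (N1 := 1) (N2 := 14 * size (nbs es u) + 3)
     (Q := fun a' => val a' 10 = 0)); last lia.
    by apply: spec_wp => //=; rewrite rval_set.
  move=> a6 s6 x6.
  have y13 : val a6 13 = size (nbs es u) by rewrite (same_val s6) // (same_val s5).
  have y14 : val a6 14 = ix u * (2 * m) by rewrite (same_val s6).
  have y18 : val a6 18 = hd.+1.
    by rewrite (same_val s6) // (same_val s5) // (same_val s4).
  have b6 : bfs lab v q a6.
    apply: (same_bfs s6) => //; apply: (same_bfs s5) => //; apply: (same_bfs s4) => //.
    by apply: (same_bfs s3) => //; apply: (same_bfs s2).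
  have A6 : adjacency (nbs es) a6.
    apply: (same_adjacency s6) => //; apply: (same_adjacency s5) => //.
    apply: (same_adjacency s4) => //; apply: (same_adjacency s3) => //.
    by apply: (same_adjacency s2) => //; apply: (same_adjacency s1).
  set q' := foldl (pushq lab v) q (nbs es u).
  apply: (spec_seq (N1 := 14 * size (nbs es u) + 2) (N2 := 1)
     (Q := bfs lab v q')); last lia.
    apply: spec_weak (leqnn _) _.
      apply: (spec_for (cst := consts n m k) erefl (K := 11)
        (I := fun j a' => bfs lab v (foldl (pushq lab v) q (take j (nbs es u))) a')) => //.
      - by rewrite y13; lia.
      - by rewrite x6.
      - by move=> j a' z w /orP [] /eqP -> [c1 c2 c3 c4]; split=> //; rewrite rval_set.
      - by rewrite x6 take0.
      - rewrite y13 => j a7 jl s7 b7 xj.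
        have [l1 l2 l3] := same_adjacency s7 isT A6 u.
        have lt' := adj_addr u (leq_trans jl l1).
        apply: (spec_seq (N1 := 1) (N2 := 10)
           (Q := fun a' => val a' 15 = ix u * (2 * m) + j)); last by [].
          apply: spec_wp => //=; rewrite (same_val s7) // y14 xj; split; first by lia.
          by move=> w ->; rewrite rval_set.
        move=> a7' s7' x7'.
        apply: (spec_seq (N1 := 2) (N2 := 8)
           (Q := fun a' => val a' 16 = ix (nth u0 (nbs es u) j))); last by [].
          apply: spec_wp => //=; rewrite x7'; split=> //.
          by move=> w ->; rewrite rval_set //= (same_ar _ s7') // (l3 u0).
        move=> a8 s8 x8; rewrite (take_nthS u0 jl) foldl_cat /=.
        by apply: spec_push => //; apply: (same_bfs s8) => //; apply: (same_bfs s7').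
      - by rewrite x6 y13 subn0 addn2; lia.
    by rewrite y13 => a7 _ [+ _]; rewrite take_size.
  move=> a7 s7 b7; apply: spec_wp => //= w ->.
  have z18 : val a7 18 = hd.+1 by rewrite (same_val s7).
  have [s eq'] := foldl_pushq_cat lab v q (nbs es u); rewrite -/q' in eq'.
  have [uq' q17' qu' mk'] := b7.
  have tk : take hd.+1 q' = rcons (take hd q) u.
    by rewrite eq' take_cat; case: ltnP => le; [rewrite (take_nth u0)|
      rewrite -[in RHS](take_nth u0) // (_ : hd.+1 - size q = 0) ?take0 ?cats0 ?take_oversize //; lia].
  exists p'; last by lia.
  exists q', hd.+1; split; last first.
    by apply: eq_bigl => x; rewrite tk mem_rcons inE negb_or andbC.
  have lt' : hd < size q' by rewrite eq' size_cat; lia.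
  have mq' y : y \in q' = (y \in q) || [&& y \in nbs es u, lab y == 0 & y != v].
    exact: mem_foldl_pushq.
  split; [by split; rewrite ?rval_set|by rewrite rval_set|by []|
    by rewrite rval_set //= q17' z18|split].
  - by move=> x /sub1 xq; rewrite mq' xq.
  - move=> x; rewrite mq' => /orP [/re1 //|/and3P [xu /eqP x0 xv]]; split=> //.
    have [ul uv ru] := re1 _ uin.
    move: ru => /existsP [t /and4P [tts lti tv ct]]; apply/existsP; exists t.
    rewrite tts lti tv; apply: connect_trans ct (connect1 _).
    by rewrite /mono_avoid /mono uv xv ul x0 eqxx adj_es -mem_nbs xu.
  - move=> x; rewrite tk mem_rcons inE => /orP [/eqP ->|xt] w' xw w0 wv.
      by rewrite mq' w0 wv eqxx mem_nbs -adj_es xw orbT.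
    by rewrite mq' (cl1 x).
move=> a1 s1 [[p [q [hd [[[b1 b2 b3 b4] h1 le1 t1 [sub1 re1 cl1]] _]]]] z] u.
have hdE : hd = size q by lia.
(* With everything dequeued, the queue is closed under the edges of [mono_avoid], so it contains all
   that is reachable from the later terminals. *)
rewrite hdE take_size in cl1.
rewrite b4 /fresh; case: (eqVneq (lab u) 0) => u0 //=; case: (eqVneq u v) => uv //=.
congr negb; apply/idP/idP => [/re1 [] //|/existsP [t /and4P [tts lti tv]]].
apply: (connect_ind (P := fun x => x \in q)); last by apply/sub1/src.
move=> x y xq /and3P [/andP [xy /eqP exy] xv yv]; apply: (cl1 x xq y xy _ yv).
by rewrite -exy; case: (re1 x xq).
Qed.

Lemma ts_at t0 j : j < k -> nth t0 ts j \in ts /\ idx ts (nth t0 ts j) = j.+1.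
Proof. by move=> lt; rewrite mem_nth // /idx index_uniq. Qed.

Lemma spec_reach a i (lab : {ffun V -> nat}) v :
  instance a -> adjacency (nbs es) a -> arr a LAB lab ->
  val a 0 = i -> i <= k -> val a 1 = ix v -> lab v = 0 ->
  (forall t, t \in ts -> i < idx ts t -> lab t = 0) ->
  spec reach a (18 * n + 28 * m + 13 * k + 20) (fun a' =>
    forall u, (ar a' MK (ix u) == 0) = unreached E ts i lab v u).
Proof.
move=> ia hadj hl i0 ik v1 v0 tl.
apply: (spec_seq (N1 := 7 * n + 3) (N2 := 11 * n + 28 * m + 13 * k + 17)
  (Q := fun a' => arr a' MK lab)); last lia.
  apply: (spec_seq (N1 := 1) (N2 := 7 * n + 2) (Q := fun a' => val a' 8 = 0)); last lia.
    by apply: spec_wp => //=; rewrite rval_set.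
  move=> a1 s1 x1; apply: spec_weak (leqnn _) _.
    apply: (spec_for (cst := consts n m k) erefl (K := 4)
      (I := fun j a' => forall u, ix u < j -> ar a' MK (ix u) = lab u)) => //.
    - by rewrite v21; lia.
    - by rewrite x1.
    - by rewrite x1.
    - rewrite v21 => j a2 jn s2 I2 xj; have [u uj] := ixP jn.
      apply: spec_wp => //=; rewrite xj; split=> // w.
      rewrite (same_ar _ s2) // (same_ar _ s1) // uj hl => ->.
      rewrite !rval_set //= xj; split=> // u'; rewrite ltnS leq_eqVlt uj ix_eq /=.
      by case: (u' =P u) => [-> //|_] /=; rewrite -uj; apply: I2.
    - by rewrite v21 x1; lia.
  by move=> a2 s2 [+ _] u; rewrite v21; apply; apply: ix_lt.
move=> a1 s1 m1.
apply: (spec_seq (N1 := 2) (N2 := 11 * n + 28 * m + 13 * k + 15)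
  (Q := fun a' => forall u, (ar a' MK (ix u) == 0) = fresh lab v [::] u)); last lia.
  apply: spec_wp => //=; rewrite (same_val s1) // v1; split; first exact: ix_lt.
  move=> u; rewrite ix_eq v20 /fresh in_nil andbT.
  by case: (u =P v) => [->|_]; rewrite ?andbF // m1 andbT.
move=> a2 s2 m2.
apply: (spec_seq (N1 := 1) (N2 := 11 * n + 28 * m + 13 * k + 14)
  (Q := bfs lab v [::])); last lia.
  by apply: spec_wp => //=; split=> //; split=> //; rewrite rval_set.
move=> a3 s3 b3.
apply: (spec_seq (N1 := 1) (N2 := 11 * n + 28 * m + 13 * k + 13)
  (Q := fun a' => val a' 8 = 0)); last lia.
  by apply: spec_wp => //=; rewrite rval_set.
move=> a4 s4 x4.
have i4 : val a4 0 = i.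
  by rewrite (same_val s4) // (same_val s3) // (same_val s2) // (same_val s1).
apply: (spec_seq (N1 := 1) (N2 := 11 * n + 28 * m + 13 * k + 12)
  (Q := fun a' => val a' 8 = i)); last lia.
  apply: spec_wp => //=; rewrite x4 i4; split; first by lia.
  by move=> w ->; rewrite rval_set.
move=> a5 s5 x5.
have b5 : bfs lab v [::] a5 by apply: (same_bfs s5) => //; apply: (same_bfs s4).
have in5 : instance a5.
  apply: (same_instance s5) => //; apply: (same_instance s4) => //; apply: (same_instance s3) => //; apply: (same_instance s2) => //.
  exact: (same_instance s1).
(* After position [j - 1] of the terminal list has been treated, the terminals of index at most [j]
   have been seen, since [idx] counts from 1. *)
pose srcs (j : nat) (q : seq V) := [/\ i <= j, {in q, forall u, [/\ lab u = 0, u != v & reached E ts i lab v u]}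
  & forall t, t \in ts -> i < idx ts t -> idx ts t <= j -> t != v -> t \in q].
apply: (spec_seq (N1 := 13 * k + 2) (N2 := 11 * n + 28 * m + 10)
  (Q := fun a' => exists2 q, bfs lab v q a' & srcs k q)); last lia.
  apply: spec_weak (leqnn _) _.
    apply: (spec_for (cst := consts n m k) erefl (K := 10)
      (I := fun j a' => exists2 q, bfs lab v q a' & srcs j q)) => //.
    - by rewrite v23; lia.
    - by rewrite x5.
    - move=> j a' z w /orP [] /eqP -> [q [c1 c2 c3 c4] c5]; exists q => //;
      by split=> //; rewrite rval_set.
    - by exists [::] => //; rewrite x5; split=> // t _; lia.
    - rewrite v23 => j a6 jk s6 [q b6 [ij r6 t6]] xj.
      have [t0 _] : exists t0, t0 \in ts.
        by case: ts jk => // t s _; exists t; rewrite inE eqxx.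
      have [tts tj] := ts_at t0 jk; set t := nth t0 ts j in tts tj.
      apply: (spec_seq (N1 := 2) (N2 := 8) (Q := fun a' => val a' 12 = ix t)); last by [].
        apply: spec_wp => //=; rewrite xj; split=> // w ->.
        by rewrite rval_set //= (proj2 (same_instance s6 isT in5) t0).
      move=> a7 s7 x7; apply: spec_weak (leqnn _) _.
        by apply: (spec_push _ x7) => //; apply: (same_bfs s7) b6.
      move=> a8 _ b8; exists (pushq lab v q t) => //; split; first exact: leqW ij.
        move=> u; rewrite mem_pushq => /orP [/r6 //|/and3P [/eqP -> /eqP l0 tv]].
        by split=> //; apply/existsP; exists t; rewrite tts tv connect0 tj !andbT /= ltnS.
      move=> u uts' lt le uv; rewrite mem_pushq; move: le; rewrite leq_eqVlt => /orP [].
        rewrite -tj => /eqP /(idx_inj uts' tts) => eu; rewrite -eu uv tl // eqxx.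
        by rewrite eu eqxx orbT.
      by rewrite ltnS => le; rewrite t6.
    - by rewrite x5 v23; lia.
  by rewrite v23 => a6 _ [].
move=> a6 s6 [q b6 [_ r6 t6]].
apply: (spec_seq (N1 := 1) (N2 := 11 * n + 28 * m + 9)
  (Q := fun a' => val a' 18 = 0)); last lia.
  by apply: spec_wp => //=; rewrite rval_set.
move=> a7 s7 x7.
have b7 := same_bfs s7 isT b6.
apply: (spec_seq (N1 := 1) (N2 := 11 * n + 28 * m + 8)
  (Q := fun a' => val a' 19 = size q)); last lia.
  by apply: spec_wp => //= w ->; rewrite rval_set //= x7 subn0; case: b7.
move=> a8 s8 x8.
have b8 := same_bfs s8 isT b7.
have ad8 : adjacency (nbs es) a8.
  apply: (same_adjacency s8) => //; apply: (same_adjacency s7) => //; apply: (same_adjacency s6) => //; apply: (same_adjacency s5) => //.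
  apply: (same_adjacency s4) => //; apply: (same_adjacency s3) => //; apply: (same_adjacency s2) => //.
  exact: (same_adjacency s1).
apply: (spec_seq (N1 := 28 * m + 11 * n + 1) (N2 := 3)
  (spec_search (i := i) ad8 b8 _ x8 r6 _)); last by lia.
- by rewrite (same_val s8).
- by move=> t tts lt tv; apply: t6; rewrite // idx_le.
move=> a9 s9 m9.
have v9 : val a9 1 = ix v.
  by rewrite (same_val s9) // (same_val s8) // (same_val s7) // (same_val s6) //
    (same_val s5) // (same_val s4) // (same_val s3) // (same_val s2) // (same_val s1).
apply: spec_wp => //=; rewrite !rval_set //= v9; split=> //; split; first exact: ix_lt.
move=> u; rewrite ix_eq; case: (u =P v) => [->|uv]; first by rewrite unreached_self.
rewrite m9 /unreached; case: (lab u == 0) => //=.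
by case: eqP.
Qed.

Lemma spec_test_bad a i (lab ex : {ffun V -> nat}) v :
  arr a EX ex -> (forall u, ex u <= k.+1) -> val a 0 = i ->
  (forall u, (ar a MK (ix u) == 0) = unreached E ts i lab v u) ->
  spec test_bad a (12 * n + 4) (fun a' => (val a' 13 != 0) = bad E ts i lab ex v).
Proof.
move=> he ek i0 mk.
apply: (spec_seq (N1 := 1) (N2 := 12 * n + 3) (Q := fun a' => val a' 13 = 0)); last lia.
  by apply: spec_wp => //=; rewrite rval_set.
move=> a1 s1 x1.
apply: (spec_seq (N1 := 1) (N2 := 12 * n + 2) (Q := fun a' => val a' 8 = 0)); last lia.
  by apply: spec_wp => //=; rewrite rval_set.
move=> a2 s2 x2.
pose P j := [exists u, (ix u < j) && (unreached E ts i lab v u && (i <= ex u))].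
have PS j u : j = ix u -> P j.+1 = P j || (unreached E ts i lab v u && (i <= ex u)).
  move=> ju; apply/existsP/orP => [[w]|[/existsP [w /andP [h1 h2]]|h]].
  - rewrite ltnS leq_eqVlt ju ix_eq; case: (w =P u) => [-> /= h|_ /= h]; first by right.
    by left; apply/existsP; exists w.
  - by exists w; rewrite h2 (leqW h1).
  - by exists u; rewrite h ju leqnn.
apply: spec_weak (leqnn _) _.
  apply: (spec_for (cst := consts n m k) erefl (K := 9)
    (I := fun j a' => (val a' 13 != 0) = P j)) => //.
  - by rewrite v21; lia.
  - by rewrite x2.
  - by move=> j a' z w /orP [] /eqP -> <-; rewrite rval_set.
  - rewrite x2 (same_val s2) // x1 eqxx; symmetry; apply/existsP => -[u] /andP [].
    by rewrite ltn0.
  - rewrite v21 => j a3 jn s3 I3 xj; have [u uj] := ixP jn.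
    have v03 : val a3 0 = i by rewrite (same_val s3) // (same_val s2) // (same_val s1).
    rewrite (PS _ _ uj).
    apply: spec_wp => //=; rewrite xj; split=> // w; rewrite uj (same_ar _ s3) // (same_ar _ s2) // (same_ar _ s1) // => ->.
    rewrite rval_set //= mk; case nu : (unreached E ts i lab v u); last by rewrite orbF rval_set //= -uj.
    rewrite !rval_set //= xj; split=> // e; rewrite uj (same_ar _ s3) // (same_ar _ s2) // (same_ar _ s1) // he => ->.
    rewrite rval_set //= v20; split; first by have := ek u; lia.
    move=> f ->; rewrite /= => g; rewrite !rval_set //= v03 => ->.
    case: eqP => h.
      by rewrite I3 -uj (_ : (i <= ex u) = false) ?orbF //; lia.
    by split; [lia|symmetry; apply/orP; right; lia].
  - by rewrite v21 x2; lia.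
move=> a3 _ [-> _]; rewrite v21; apply: eq_existsb => u; by rewrite ix_lt.
Qed.

Lemma spec_relabel a i (lab : {ffun V -> nat}) v :
  arr a LAB lab -> val a 0 = i ->
  (forall u, (ar a MK (ix u) == 0) = unreached E ts i lab v u) ->
  spec relabel a (8 * n + 3) (fun a' => arr a' LAB (absorb E ts i lab v)).
Proof.
move=> hl i0 mk.
apply: (spec_seq (N1 := 1) (N2 := 8 * n + 2) (Q := fun a' => val a' 8 = 0)); last lia.
  by apply: spec_wp => //=; rewrite rval_set.
move=> a1 s1 x1; apply: spec_weak (leqnn _) _.
  apply: (spec_for (cst := consts n m k) erefl (K := 5)
    (I := fun j a' => forall u, ar a' LAB (ix u)
       = if ix u < j then absorb E ts i lab v u else lab u)) => //.
  - by rewrite v21; lia.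
  - by rewrite x1.
  - by rewrite x1 => u; rewrite ltn0 (same_ar _ s1).
  - rewrite v21 => j a2 jn s2 I2 xj; have [u uj] := ixP jn.
    apply: spec_wp => //=; rewrite xj; split=> // w.
    rewrite (same_ar _ s2) // (same_ar _ s1) // uj => ->.
    rewrite rval_set //= mk; case nu : (unreached E ts i lab v u).
      rewrite !rval_set //= xj; split=> // u'; rewrite uj ix_eq.
      rewrite (same_val s2) // (same_val s1) // i0 ltnS leq_eqVlt ix_eq -uj.
      by case: (u' =P u) => [->|_] //=; rewrite ffunE nu.
    move=> u'; rewrite ltnS leq_eqVlt I2 uj ix_eq.
    by case: (u' =P u) => [->|_] //=; rewrite ltnn ffunE nu.
  - by rewrite v21 x1; lia.
by move=> a2 _ [+ _] u; rewrite v21 => ->; rewrite ix_lt.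
Qed.

Lemma spec_append a (x y : nat) u w (L : V -> seq V) :
  (x, y) \in [:: (13, 14); (14, 13)] -> val a x = ix u -> val a y = ix w ->
  adjacency L a -> size (L u) < 2 * m ->
  spec (append_to x y) a 9
    (adjacency (fun u' => if u' == u then rcons (L u') w else L u')).
Proof.
move=> xy xu yw hL lt.
suff H : wp (lens n m k) (consts n m k) S (append_to x y)
    (adjacency (fun u' => if u' == u then rcons (L u') w else L u')) a.
  exact: (spec_wp H).
have xn := ix_lt u; have := adj_addr u lt; set A := ix u * (2 * m) + size (L u) => An.
have [l1 l2 l3] := hL u.
have fin b : (forall j i, ar b j i =
    if (j == DEG) && (i == ix u) then (size (L u)).+1
    else if (j == ADJ) && (i == A) then ix w else ar a j i) ->
  adjacency (fun u' => if u' == u then rcons (L u') w else L u') b.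
  move=> hb u'; have [l1' l2' l3'] := hL u'; split.
  - by case: eqP => // ->; rewrite size_rcons.
  - by rewrite hb /= ix_eq; case: (u' =P u) => // ->; rewrite size_rcons.
  - move=> w0 j jl; rewrite hb /=.
    have jm : j < 2 * m by apply: leq_trans jl _; case: eqP => // ->; rewrite size_rcons.
    have -> : (ix u' * (2 * m) + j == A) = (u' == u) && (j == size (L u)).
      apply/eqP/andP => [e|[/eqP -> /eqP -> //]].
      (* Rows do not overlap: dividing by the row width recovers the vertex. *)
      have e1 : ix u' = ix u.
        have := congr1 (fun z => z %/ (2 * m)) e; rewrite /A !divnMDl ?divn_small ?addn0 //; lia.
      move: e; rewrite /A e1 => /addnI ->; split=> //; by rewrite -ix_eq e1.
    case: (u' =P u) jl => [-> |_] /=; last by move=> jl; apply: l3'.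
    rewrite size_rcons ltnS leq_eqVlt nth_rcons => /orP [/eqP ->|jl].
      by rewrite eqxx ltnn.
    by rewrite (ltn_eqF jl) jl; apply: l3.
move: xy; rewrite !inE => /orP [] /eqP [ex' ey]; subst x y;
  rewrite /= xu; split=> // t; rewrite l2 => ->; rewrite !rval_set //= xu v24.
all: have Sm : ix u * (2 * m) <= n * (2 * m) by rewrite leq_mul2r ltnW ?orbT.
all: split; first lia.
all: move=> t2 ->; rewrite !rval_set //=; split; first by lia.
all: move=> t3 ->; rewrite !rval_set //=; split=> //.
all: rewrite !rval_put !rval_set //= v20; split; first lia.
all: move=> t4 ->; rewrite !rval_set //= !rval_put !rval_set //= xu; split=> //.
all: apply: fin => j i; rewrite /= ?rval_put ?rval_set //=.
all: by rewrite ?yw ?addn1.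
Qed.

Lemma spec_build a : instance a -> (forall i, ar a DEG i = 0) ->
  spec build a (27 * m + 3) (adjacency (nbs es)).
Proof.
move=> ia d0.
apply: (spec_seq (N1 := 1) (N2 := 27 * m + 2) (Q := fun a' => val a' 8 = 0)); last lia.
  by apply: spec_wp => //=; rewrite rval_set.
move=> a1 s1 x1; have i1 := same_instance s1 isT ia.
have ext L L' b : L =1 L' -> adjacency L b -> adjacency L' b.
  by move=> e h u; rewrite -e.
apply: spec_weak (leqnn _) _.
  apply: (spec_for (cst := consts n m k) erefl (K := 24)
    (I := fun j a' => adjacency (nbs (take j es)) a')) => //.
  - by rewrite v22; lia.
  - by rewrite x1.
  - by rewrite x1 take0 => u; split=> //; rewrite (same_ar _ s1).
  - rewrite v22 => j a2 jm s2 I2 xj.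
    have jm2 : (2 * j).+1 < 2 * m by lia.
    have [e0 _] : exists e0, e0 \in es.
      by case: es jm => // e s _; exists e; rewrite inE eqxx.
    have i2 := same_instance s2 isT i1; have xj' : val a2 8 < m by rewrite xj.
    apply: (spec_seq (N1 := 6) (N2 := 18) (spec_read_edge e0 i2 xj')); last by [].
    rewrite xj => a3 s3 [].
    have te := take_nthS e0 jm; set e := nth e0 es j in te * => u3 w3.
    have I3 := same_adjacency s3 isT I2.
    (* Before edge [j] a row holds at most [2 * j] entries, so there is room for two more, should
       both go to the same row. *)
    have sz : forall u, size (nbs (take j es) u) <= 2 * j.
      by move=> u; have := size_nbs (take j es) u; rewrite size_takel // ltnW.
    apply: (spec_seq (N1 := 9) (N2 := 9)
      (spec_append (w := e.2) _ u3 w3 I3 _)) => //.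
      exact: leq_ltn_trans (sz _) (ltnW jm2).
    move=> a4 s4; set L1 := fun u' => _; move=> I4.
    apply: spec_weak (leqnn _) _.
      apply: (spec_append (u := e.2) (w := e.1) _ _ _ I4) => //.
      + by rewrite (same_val s4).
      + by rewrite (same_val s4).
      + rewrite /L1; case: ifP => _; last exact: leq_ltn_trans (sz _) (ltnW jm2).
        by rewrite size_rcons; apply: leq_ltn_trans jm2; rewrite ltnS.
    move=> a5 _; apply: ext => u; rewrite te /nbs map_cat flatten_cat /= cats0.
    rewrite -/(nbs _ u) /L1 ![u == _]eq_sym; case: eqP => _; case: eqP => _;
      by rewrite ?cats0 -?cats1 -?catA.
  - by rewrite v22 x1; lia.
by move=> a2 _ [+ _]; rewrite v22 take_size.
Qed.

Definition base (a : ast) : Prop := instance a /\ adjacency (nbs es) a.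

Lemma same_base c a a' : same (consts n m k) c a a' ->
  [&& ED \notin moda c, TM \notin moda c, DEG \notin moda c & ADJ \notin moda c] ->
  base a -> base a'.
Proof.
move=> s /and4P [h1 h2 h3 h4] [b1 b2]; split.
  by apply: (same_instance s) b1; rewrite h1.
by apply: (same_adjacency s) b2; rewrite h3.
Qed.

Definition state (i : nat) (lab ex : {ffun V -> nat}) (a : ast) : Prop :=
  [/\ val a 0 = i, arr a LAB lab & arr a EX ex].

(** [d] is the decision to replay, or 0 once the replay is over. A nonzero [d] is obeyed without
    consulting [bad]; that it only occurs where a second child exists comes from the validity of the
    path, in [spec_descend]. *)
Lemma spec_branch a i lab ex v pos last :
  base a -> state i lab ex a -> good E ts i lab ex -> pivot es i lab ex = Some v ->
  val a 1 = ix v -> val a 3 = pos -> pos < k * n -> val a 5 = last ->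
  let d := if pos < val a 4 then ar a DEC pos else 0 in
  spec branch a (38 * n + 28 * m + 13 * k + 42) (fun a' =>
    [/\ if d != 0 then state i (absorb E ts i lab v) ex a' /\ val a' 5 = last
        else state i lab (exclude i ex v) a' /\
             val a' 5 = if bad E ts i lab ex v then last else pos.+1,
        val a' 3 = pos.+1
      & forall q, ar a' DEC q = if q == pos then d else ar a DEC q]).
Proof.
move=> [ia ad] [i0 hl he] g pv v1 p3 pl l5 d.
have [ipos v0 vts exv] := pivot_facts uts adj_es g pv.
have tl t : t \in ts -> i < idx ts t -> lab t = 0.
  by move=> tts lt; rewrite (good_sep g) // leqNgt lt.
have exk u : ex u <= k.+1.
  case uts' : (u \in ts); first by rewrite (good_ts g).
  by have := good_ex g (negbT uts'); have := good_ik g; lia.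
have pS : pos < S by lia.
apply: (spec_seq (N1 := 18 * n + 28 * m + 13 * k + 20) (N2 := 20 * n + 22)
  (spec_reach ia ad hl i0 (good_ik g) v1 v0 tl)); last lia.
move=> a1 s1 m1.
have hl1 := same_arr (j := LAB) s1 isT hl; have he1 := same_arr (j := EX) s1 isT he.
have i1 : val a1 0 = i by rewrite (same_val s1).
apply: (spec_seq (N1 := 12 * n + 4) (N2 := 8 * n + 18)
  (spec_test_bad he1 exk i1 m1)); last lia.
move=> a2 s2 b2.
have p32 : val a2 3 = pos by rewrite (same_val s2) // (same_val s1).
have l42 : val a2 4 = val a 4 by rewrite (same_val s2) // (same_val s1).
apply: (spec_seq (N1 := 5) (N2 := 8 * n + 13) (Q := fun a' => val a' 14 = d)); last lia.
  apply: spec_wp => //=; split=> // w; rewrite !rval_set //= => ->; rewrite p32 l42.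
  rewrite /d -subn_gt0; case: (val a 4 - pos) => //= z; split=> // w'.
  by rewrite (same_ar _ s2) // (same_ar _ s1) // => ->; rewrite rval_set.
move=> a3 s3 d3.
have m3 u : (ar a3 MK (ix u) == 0) = unreached E ts i lab v u.
  by rewrite (same_ar _ s3) // (same_ar _ s2).
have hl3 := same_arr (j := LAB) s3 isT (same_arr (j := LAB) s2 isT hl1).
have he3 := same_arr (j := EX) s3 isT (same_arr (j := EX) s2 isT he1).
have i3 : val a3 0 = i by rewrite (same_val s3) // (same_val s2).
have p33 : val a3 3 = pos by rewrite (same_val s3).
have l53 : val a3 5 = last.
  by rewrite (same_val s3) // (same_val s2) // (same_val s1).
have v13 : val a3 1 = ix v.
  by rewrite (same_val s3) // (same_val s2) // (same_val s1).
have b3 : (val a3 13 != 0) = bad E ts i lab ex v by rewrite (same_val s3).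
pose Q a' := if d != 0 then state i (absorb E ts i lab v) ex a' /\ val a' 5 = last
  else state i lab (exclude i ex v) a' /\
     val a' 5 = if bad E ts i lab ex v then last else pos.+1.
apply: (spec_seq (N1 := 8 * n + 8) (N2 := 3) (Q := Q)); last lia.
  rewrite addnS; apply: spec_if; rewrite /Q d3 => d0; rewrite d0 /=.
    apply: spec_weak (spec_relabel hl3 i3 m3) _ _; first by lia.
    move=> a4 s4 h4; split; last by rewrite (same_val s4).
    by split=> //; [rewrite (same_val s4)|apply: (same_arr s4)].
  apply: spec_wp; last by rewrite /=; lia.
  rewrite /= v13 i3; split; first exact: ix_lt.
  rewrite rval_put; case: eqP => [b0|/eqP b1].
    rewrite b0 /= in b3; rewrite -b3 rval_put p33 v20; split; first lia.
    move=> w ->; split; last by rewrite rval_set // addn1.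
    split; [by rewrite rval_set|by []|] => u /=.
    by rewrite ix_eq ffunE; case: eqP => // _; apply: he3.
  rewrite -b3 b1; split=> //; split=> // u /=.
  by rewrite ix_eq ffunE; case: eqP => // _; apply: he3.
move=> a4 s4 Q4.
have p34 : val a4 3 = pos by rewrite (same_val s4).
have d4 : val a4 14 = d by rewrite (same_val s4).
apply: spec_wp => //=; rewrite p34 d4; split=> //; rewrite rval_put p34 v20.
split; first lia; move=> w ->; split.
- move: Q4; rewrite /Q; case: ifP => _ [[h1 h2 h3] h4];
  by split; rewrite ?rval_set //=; split; rewrite ?rval_set.
- by rewrite rval_set // addn1.
- move=> q /=; case: eqP => // _.
  by rewrite (same_ar _ s4) // (same_ar _ s3) // (same_ar _ s2) // (same_ar _ s1).
Qed.

Lemma spec_next_stage a i lab ex :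
  base a -> state i lab ex a -> good E ts i lab ex ->
  spec next_stage a (26 * n + 28 * m + 13 * k + 30) (fun a' =>
    (i = k /\ val a' 7 = 0 /\ state i lab ex a') \/
    exists v, [/\ v \in ts, idx ts v = i.+1, val a' 7 = val a 7
      & state i.+1 (absorb E ts i.+1 lab v) ex a']).
Proof.
move=> [ia ad] [i0 hl he] g; have ik := good_ik g.
apply: (spec_seq (N1 := 1) (N2 := 26 * n + 28 * m + 13 * k + 28)
   (Q := fun a' => val a' 15 = k - i)); last lia.
  by apply: spec_wp => //= w ->; rewrite rval_set //= i0.
move=> a1 s1 x1; rewrite addnS; apply: spec_if; rewrite x1 => ki; last first.
  apply: spec_wp; last by rewrite /=; lia.
  split=> //; left; split; first by lia.
  split; first by rewrite rval_set.
  by split; rewrite ?rval_set ?(same_val s1) //; apply: (same_arr s1).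
have lt : i < k by lia.
have [v0 _] : exists v, v \in ts.
  by case: ts lt => // t s _; exists t; rewrite inE eqxx.
have [vts iv] := ts_at v0 lt; set v := nth v0 ts i in vts iv.
apply: (spec_seq (N1 := 2) (N2 := 26 * n + 28 * m + 13 * k + 25)
   (Q := fun a' => val a' 1 = ix v)); last lia.
  apply: spec_wp => //=; rewrite (same_val s1) // i0; split=> // w ->.
  by rewrite rval_set //= (same_ar _ s1) //; apply: (proj2 ia).
move=> a2 s2 x2.
apply: (spec_seq (N1 := 1) (N2 := 26 * n + 28 * m + 13 * k + 24)
   (Q := fun a' => val a' 0 = i.+1)); last lia.
  apply: spec_wp => //=; rewrite (same_val s2) // (same_val s1) // i0 v20; split; first lia.
  by move=> w ->; rewrite rval_set // addn1.
move=> a3 s3 x3.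
have [ia3 ad3] : base a3 by apply: (same_base s3) => //; apply: (same_base s2) => //; apply: (same_base s1).
have hl3 : arr a3 LAB lab by apply: (same_arr s3) => //; apply: (same_arr s2) => //; apply: (same_arr s1).
have v13 : val a3 1 = ix v by rewrite (same_val s3).
have v0' : lab v = 0 by rewrite (good_sep g) // iv ltnn.
have tl t : t \in ts -> i.+1 < idx ts t -> lab t = 0.
  by move=> tts lt'; rewrite (good_sep g) // leqNgt (ltnW lt').
apply: (spec_seq (N1 := 18 * n + 28 * m + 13 * k + 20) (N2 := 8 * n + 3)
  (spec_reach ia3 ad3 hl3 x3 lt v13 v0' tl)); last lia.
move=> a4 s4 m4.
have hl4 := same_arr (j := LAB) s4 isT hl3.
have i4 : val a4 0 = i.+1 by rewrite (same_val s4).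
apply: spec_weak (spec_relabel hl4 i4 m4) _ _ => // a5 s5 hl5.
right; exists v; split=> //.
  by rewrite (same_val s5) // (same_val s4) // (same_val s3) // (same_val s2) // (same_val s1).
split=> //; first by rewrite (same_val s5).
apply: (same_arr s5) => //; apply: (same_arr s4) => //; apply: (same_arr s3) => //.
by apply: (same_arr s2) => //; apply: (same_arr s1).
Qed.

(* The array DEC and register 4 hold the decisions already taken along the
   current path and, after them, the ones still to be replayed. *)
Definition decisions (a : ast) (p s : seq bool) : Prop :=
  (forall j, j < size (p ++ s) -> ar a DEC j = nth false (p ++ s) j)
  /\ if s is [::] then val a 4 <= size p else val a 4 = size (p ++ s).

Lemma decisions_head a p s : decisions a p s ->
  (if size p < val a 4 then ar a DEC (size p) else 0) = head false s.
Proof.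
case=> h1; case: s h1 => [|b s] h1 h2; case: ltnP => lt //=; try by lia.
  by rewrite h1 ?nth_cat ?ltnn ?subnn // size_cat /=; lia.
by move: h2 lt; rewrite size_cat /=; lia.
Qed.

Lemma decisions_step a a' p s : decisions a p s -> val a' 4 = val a 4 ->
  (forall q, ar a' DEC q = if q == size p then head false s : nat else ar a DEC q) ->
  decisions a' (rcons p (head false s)) (behead s).
Proof.
move=> [h1 h2] e4 hd; split.
  move=> j; rewrite hd; case: (j =P size p) => [->|/eqP ne].
    by rewrite cat_rcons nth_cat ltnn subnn.
  case: s h1 {h2 hd} => [|b s] h1 /=; last by rewrite cat_rcons; apply: h1.
  rewrite cats0 size_rcons ltnS leq_eqVlt (negbTE ne) /= => lt.
  by rewrite nth_rcons lt h1 ?cats0.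
rewrite e4; case: s h1 h2 {hd} => [|b [|c s]] /= h1 h2.
- by rewrite size_rcons leqW.
- by rewrite h2 cats1.
- by rewrite h2 cat_rcons.
Qed.

Section Descent.

Variables (T : tree V) (s0 : seq bool).

(** Depth plus [height] stays below [k * n], which keeps the accesses to [DEC] in range. Register 7
    is cleared only at a leaf. *)
Definition at_node (i : nat) (lab ex : {ffun V -> nat}) T' p s L (a : ast) : Prop :=
  [/\ good E ts i lab ex, grows E ts es i lab ex T', state i lab ex a,
      val a 3 = size p
    & [/\ size p + height ts i lab ex <= k * n, pathinv T s0 T' p s L (val a 5),
          decisions a p s
        & val a 7 = 0 -> i = k /\ pivot es i lab ex = None]].

Definition descent (r : nat) (a : ast) : Prop :=
  exists i lab ex T' p s L, at_node i lab ex T' p s L a /\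
    r = height ts i lab ex + (k - i) + (val a 7 != 0).

Definition cost := 38 * n + 69 * m + 13 * k + 47.

(** A branching lowers [height], a new class lowers [k - i] without raising [height], and arriving
    at a leaf clears the flag counted in [r]. *)
Lemma spec_descend a r : base a -> val a 7 != 0 -> descent r a ->
  spec descend a cost (fun a' => exists2 r', r' < r & descent r' a').
Proof.
move=> ba nz [i [lab [ex [T' [p [s [L [[g gr st3 p3 [hp hpi dec z7]] ->]]]]]]]].
have [ia ad] := ba; have [i0 hl he] := st3.
apply: (spec_seq (N1 := 41 * m + 4) (N2 := 38 * n + 28 * m + 13 * k + 43)); last 1 first.
- by rewrite /cost; lia.
- by rewrite mulnC; apply: (spec_find_pivot ia hl he i0).
move=> a1 s1; rewrite nz addn1; case pv : (pivot es i lab ex) => [v|] h1.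
  have {h1} [f1 v1] := h1.
  rewrite addnS; apply: spec_if; rewrite f1 // => _.
  have b1 := same_base s1 isT ba.
  have hl1 := same_arr (j := LAB) s1 isT hl; have he1 := same_arr (j := EX) s1 isT he.
  have st1 : state i lab ex a1 by split=> //; rewrite (same_val s1).
  have p31 : val a1 3 = size p by rewrite (same_val s1).
  have hx := height_exclude ts adj_es pv; have hi := height_include ts adj_es pv.
  have pl : size p < k * n by lia.
  have l51 : val a1 5 = val a 5 by rewrite (same_val s1).
  have dec1 : decisions a1 p s.
    by case: dec => d1 d2; split; [move=> j; rewrite (same_ar _ s1) //; apply: d1|
      rewrite (same_val s1)].
  have := spec_branch b1 st1 g pv v1 p31 pl l51.
  rewrite /= (decisions_head dec1) => sb; apply: spec_weak sb _ _; first by lia.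
  move=> a2 s2 [h2 p32 d2].
  have dec2 := decisions_step dec1 (same_val (x := 4) s2 isT) d2.
  have z72 : val a2 7 = val a 7 by rewrite (same_val s2) // (same_val s1).
  case: (grows_some gr pv) => [[b [T0 eT g0]]|[b [T0 [T1 [eT g0 g1]]]]]; rewrite eT in hpi.
    have [hs hpi'] := pathinv_node1 hpi; rewrite hs b /= in h2 dec2; case: h2 => st2 l52.
    exists (height ts i lab (exclude i ex v) + (k - i) + 1); first by lia.
    exists i, lab, (exclude i ex v), T0, (rcons p false), (behead s), L.
    rewrite z72 nz; split=> //; split=> //; first exact: (good_exclude uts adj_es g pv).
      by rewrite size_rcons.
    split=> //; first by rewrite size_rcons; lia.
      by rewrite l52.
    by rewrite z72 => e; rewrite e in nz.
  case hs : (head false s) h2 dec2 => /= -[st2 l52] dec2.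
    have hpi' := pathinv_right hpi hs.
    exists (height ts i (absorb E ts i lab v) ex + (k - i) + 1); first by lia.
    exists i, (absorb E ts i lab v), ex, T1, (rcons p true), (behead s), L.
    rewrite z72 nz; split=> //; split=> //; first exact: (good_include uts adj_es g pv).
      by rewrite size_rcons.
    split=> //; first by rewrite size_rcons; lia.
      by rewrite l52.
    by rewrite z72 => e; rewrite e in nz.
  rewrite (negbTE b) in l52; have hpi' := pathinv_left hpi hs.
  exists (height ts i lab (exclude i ex v) + (k - i) + 1); first by lia.
  exists i, lab, (exclude i ex v), T0, (rcons p false), (behead s), (leaves T1 ++ L).
  rewrite z72 nz; split=> //; split=> //; first exact: (good_exclude uts adj_es g pv).
    by rewrite size_rcons.
  split=> //; first by rewrite size_rcons; lia.
    by rewrite l52.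
  by rewrite z72 => e; rewrite e in nz.
rewrite addnS; apply: spec_if; rewrite h1 // => _.
have b1 := same_base s1 isT ba.
have hl1 := same_arr (j := LAB) s1 isT hl; have he1 := same_arr (j := EX) s1 isT he.
have st1 : state i lab ex a1 by split=> //; rewrite (same_val s1).
apply: spec_weak (spec_next_stage b1 st1 g) _ _; first by lia.
move=> a2 s2 h2.
have dec2 : decisions a2 p s.
  case: dec => d1 d2; split; first by move=> j; rewrite (same_ar _ s2) // (same_ar _ s1) //; apply: d1.
  by rewrite (same_val s2) // (same_val s1).
have p32 : val a2 3 = size p by rewrite (same_val s2) // (same_val s1).
have l52 : val a2 5 = val a 5 by rewrite (same_val s2) // (same_val s1).
case: h2 => [[ik [z72 st2]]|[v [vts iv z72 st2]]].
  exists (height ts i lab ex + (k - i)); first by lia.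
  exists i, lab, ex, T', p, s, L; rewrite z72 addn0; split=> //; split=> //.
  by split=> //; rewrite l52.
have iltk : i < k by have := idx_le vts; rewrite iv.
have hs := height_stage uts lab (absorb E ts i.+1 lab v) ex iltk.
exists (height ts i.+1 (absorb E ts i.+1 lab v) ex + (k - i.+1) + 1); first by lia.
exists i.+1, (absorb E ts i.+1 lab v), ex, T', p, s, L.
have z7a : val a2 7 = val a 7 by rewrite z72 (same_val s1).
rewrite z7a nz; split=> //; split=> //; first exact: good_stage.
  exact: (grows_none gr pv vts iv).
split=> //; first by lia.
  by rewrite l52.
by rewrite z7a => e; rewrite e in nz.
Qed.

Lemma spec_descent a r : base a -> descent r a ->
  spec (While 7 descend) a (r * cost.+1).+1 (fun a' =>
    val a' 7 = 0 /\ exists r', descent r' a').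
Proof.
move=> ba dr.
apply: spec_weak (leqnn _) _.
  apply: (spec_while (I := fun q a' => exists2 r', q = r' * cost.+1 & descent r' a')).
    by exists r.
  move=> q a1 [r1 -> d1] s1 nz; exists cost.
    case: r1 d1 => [[? [? [? [? [? [? [? [_ /esym]]]]]]]]|r1 _]; last by rewrite mulSn; lia.
    by move=> /eqP; rewrite nz addn1.
  apply: spec_weak (spec_descend (same_base s1 isT ba) nz d1) _ _ => //.
  move=> a2 _ [r2 lt d2]; exists (r2 * cost.+1); first by exists r2.
  apply: (@leq_trans (r2.+1 * cost.+1)); last by rewrite leq_mul2r lt orbT.
  by rewrite mulSn addnC; lia.
by move=> a' _ [[q [r' _ d']] z]; split=> //; exists r'.
Qed.

End Descent.

Definition lab0 : {ffun V -> nat} := [ffun => 0].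
Definition ex0 : {ffun V -> nat} := [ffun u => if u \in ts then k.+1 else 0].

Lemma spec_init a : instance a -> spec init a (7 * n + 7 * k + 14) (fun a' =>
  [/\ state 0 lab0 ex0 a', val a' 3 = 0, val a' 5 = 0 & val a' 7 = 1]).
Proof.
move=> ia.
apply: (spec_seq (N1 := 7 * n + 4) (N2 := 7 * k + 10)
  (Q := fun a' => forall u, ar a' LAB (ix u) = 0 /\ ar a' EX (ix u) = 0)); last lia.
  apply: (spec_seq (N1 := 1) (N2 := 7 * n + 3) (Q := fun a' => val a' 8 = 0)); last lia.
    by apply: spec_wp => //=; rewrite rval_set.
  move=> a1 s1 x1.
  apply: (spec_seq (N1 := 1) (N2 := 7 * n + 2) (Q := fun a' => val a' 12 = 0)); last lia.
    by apply: spec_wp => //=; rewrite rval_set.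
  move=> a2 s2 z2; have x2 : val a2 8 = 0 by rewrite (same_val s2).
  apply: spec_weak (leqnn _) _.
    apply: (spec_for (cst := consts n m k) erefl (K := 4)
      (I := fun j a' => forall u, ix u < j -> ar a' LAB (ix u) = 0 /\ ar a' EX (ix u) = 0
         )) => //.
    - by rewrite v21; lia.
    - by rewrite x2.
    - by rewrite x2.
    - rewrite v21 => j a3 jn s3 I3 xj; have [u uj] := ixP jn.
      have z3 : val a3 12 = 0 by rewrite (same_val s3).
      apply: spec_wp => //=; rewrite !rval_put xj z3; split=> //; split=> // u0.
      rewrite ltnS leq_eqVlt uj ix_eq; case: (u0 =P u) => [-> //|_] /=.
      by rewrite -uj => /I3 [].
    - by rewrite v21 x2; lia.
  by move=> a3 _ [+ _] u; rewrite v21; apply; apply: ix_lt.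
move=> a1 s1 h1; have i1 := same_instance s1 isT ia.
apply: (spec_seq (N1 := 7 * k + 4) (N2 := 6)
  (Q := fun a' => arr a' LAB lab0 /\ arr a' EX ex0)); last lia.
  apply: (spec_seq (N1 := 1) (N2 := 7 * k + 3) (Q := fun a' => val a' 8 = 0)); last lia.
    by apply: spec_wp => //=; rewrite rval_set.
  move=> a2 s2 x2.
  apply: (spec_seq (N1 := 1) (N2 := 7 * k + 2) (Q := fun a' => val a' 13 = k.+1)); last lia.
    apply: spec_wp => //=; rewrite v20 v23; split; first lia.
    by move=> w ->; rewrite rval_set //= addn1.
  move=> a3 s3 x3; have x83 : val a3 8 = 0 by rewrite (same_val s3).
  apply: spec_weak (leqnn _) _.
    apply: (spec_for (cst := consts n m k) erefl (K := 4)
      (I := fun j a' => forall u, ar a' EX (ix u) = if u \in take j ts then k.+1 else 0)) => //.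
    - by rewrite v23; lia.
    - by rewrite x83.
    - by rewrite x83 take0 => u; rewrite (same_ar _ s3) // (same_ar _ s2) //; case: (h1 u).
    - rewrite v23 => j a4 jk s4 I4 xj.
      have [t0 _] : exists t0, t0 \in ts.
        by case: ts jk => // t s _; exists t; rewrite inE eqxx.
      apply: spec_wp => //=; rewrite xj; split=> // w ->.
      have i4 := same_instance s4 isT (same_instance s3 isT (same_instance s2 isT i1)).
      rewrite !rval_set //= (proj2 i4 t0) // (same_val s4) // x3; split; first exact: ix_lt.
      move=> u; rewrite ix_eq (take_nthS t0 jk) mem_cat inE.
      by case: (u =P _) => [_|_]; rewrite ?orbT ?orbF.
    - by rewrite v23 x83; lia.
  move=> a4 s4 [h4 _]; split=> u; last by rewrite h4 v23 take_size ffunE.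
  rewrite (same_ar _ s4) // (same_ar _ s3) // (same_ar _ s2) // ffunE; by case: (h1 u).
move=> a2 s2 [h2 e2]; apply: spec_wp => //=; do 3!split=> //.
by split; [lia|split; [split|..]; rewrite ?rval_set].
Qed.

Definition cut_prefix (lab : {ffun V -> nat}) (j : nat) : seq nat :=
  [seq l <- iota 0 j | nth false [seq lab e.1 != lab e.2 | e <- es] l].

Arguments cut_prefix : simpl never.

Definition cut_word lab := cut_prefix lab m.

Lemma cut_prefixS lab e0 j : j < m -> cut_prefix lab j.+1 = cut_prefix lab j ++
  if lab (nth e0 es j).1 == lab (nth e0 es j).2 then [::] else [:: j].
Proof.
move=> lt; rewrite /cut_prefix -addn1 iotaD filter_cat /= (nth_map e0) //.
by case: eqP.
Qed.

Lemma spec_output a (lab : {ffun V -> nat}) : instance a -> arr a LAB lab -> ob a = [::] ->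
  spec output a (18 * m + 4) (fun a' =>
    ob a' = [::] /\ os a' = rcons (os a) (cut_word lab)).
Proof.
move=> ia hl o0.
apply: (spec_seq (N1 := 18 * m + 3) (N2 := 1)
  (Q := fun a' => ob a' = cut_word lab /\ os a' = os a)); last lia; last first.
  by move=> a1 _ [h1 h2]; apply: spec_wp => //=; rewrite h1 h2.
apply: (spec_seq (N1 := 1) (N2 := 18 * m + 2)
  (Q := fun a' => [/\ val a' 8 = 0, ob a' = [::] & os a' = os a])); last lia.
  by apply: spec_wp => //=; rewrite rval_set.
move=> a1 s1 [x1 o1 p1]; have i1 := same_instance s1 isT ia.
have hl1 := same_arr (j := LAB) s1 isT hl.
apply: spec_weak (leqnn _) _.
  apply: (spec_for (cst := consts n m k) erefl (K := 15)
    (I := fun j a' => ob a' = cut_prefix lab j /\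
       os a' = os a)) => //.
  - by rewrite v22; lia.
  - by rewrite x1.
  - by rewrite x1.
  - rewrite v22 => j a2 jm s2 [I2 J2] xj.
    have [e0 _] : exists e0, e0 \in es.
      by case: es jm => // e s _; exists e; rewrite inE eqxx.
    have i2 := same_instance s2 isT i1; have xj' : val a2 8 < m by rewrite xj.
    apply: (spec_seq (N1 := 6) (N2 := 9) (spec_read_edge e0 i2 xj')); last by [].
    rewrite xj => a3 s3 []; set e := nth e0 es j => u3 w3.
    have hl3 := same_arr (j := LAB) s3 isT (same_arr (j := LAB) s2 isT hl1).
    have [_ _ /(_ isT) [o3 p3]] := s3.
    have x3 : val a3 8 = j by rewrite (same_val s3).
    have := cut_prefixS lab e0 jm; rewrite -/e => cS.
    apply: spec_wp => //=; rewrite u3; split; first exact: ix_lt.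
    move=> t1; rewrite hl3 => ->; rewrite !rval_set //= w3; split; first exact: ix_lt.
    move=> t2; rewrite hl3 => ->.
    move=> t3; rewrite !rval_set //= => ->.
    case: (ltngtP (lab e.1) (lab e.2)) => lt.
    + rewrite (_ : lab e.1 - lab e.2 = 0) /=; last by apply/eqP; rewrite subn_eq0 ltnW.
      move=> t4; rewrite !rval_set //= => ->.
      rewrite (_ : (lab e.2 - lab e.1 == 0) = false) /=; last by rewrite subn_eq0 leqNgt lt.
      by rewrite ?rval_set //= x3 o3 p3 I2 J2 cS ?(ltn_eqF lt) ?(gtn_eqF lt) /= cats1.
    + rewrite (_ : (lab e.1 - lab e.2 == 0) = false) /=; last by rewrite subn_eq0 leqNgt lt.
      by rewrite ?rval_set //= x3 o3 p3 I2 J2 cS ?(ltn_eqF lt) ?(gtn_eqF lt) /= cats1.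
    + rewrite lt subnn /= => t4; rewrite !rval_set //= ?subnn => ->; rewrite ?rval_set //= ?subnn ?eqxx /=.
      by rewrite o3 p3 I2 J2 cS lt eqxx /= cats0.
  - by rewrite v22 x1; lia.
by move=> a2 _ [+ _]; rewrite v22.
Qed.

Lemma good0 : connected_graph E -> 0 < k -> good E ts 0 lab0 ex0.
Proof.
move=> conn k0; have [t0 t0ts] : exists t0, t0 \in ts.
  by case: ts k0 => // t s _; exists t; rewrite inE eqxx.
split=> //.
- by move=> u; rewrite ffunE.
- by move=> t tts; rewrite ffunE.
- by move=> u; rewrite ffunE.
- move=> u _; exists t0; split=> //.
  have /forallP /(_ t0) /forallP /(_ u) := conn.
  by apply: connect_sub => x y xy; apply: connect1; rewrite /mono xy !ffunE eqxx.
- by move=> t tts; rewrite ffunE tts.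
- by move=> u uts'; rewrite ffunE (negbTE uts').
Qed.

(** At class 0 nothing is free, as [ex u < 0] never holds. *)
Lemma height0 : height ts 0 lab0 ex0 = k * n.
Proof.
rewrite /height /free subn0 [X in _ + X](_ : _ = 0); last first.
  by apply: eq_card0 => u; rewrite inE ltn0 andbF.
rewrite addn0; congr (_ * _); rewrite -(card_uniqP uvs); apply: eq_card => u.
by rewrite mvs.
Qed.

(** Setting decision [l] to 1 and cutting the replay at length [l.+1] yields the path in [pending];
    beyond it the next descent goes left by default. *)
Lemma spec_advance (T : tree V) s0 a p L : vpath T s0 ->
  size p <= k * n -> decisions a p [::] -> pending T p L (val a 5) ->
  spec advance a 6 (fun a' => [/\ ob a' = ob a, os a' = os a
    & (val a' 6 = 0 /\ L = [::]) \/
      (val a' 6 = val a 6 /\ exists s, [/\ vpath T s, L = rest T s & decisions a' [::] s])]).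
Proof.
move=> vs0 pk [dec _]; rewrite /pending; case e5 : (val a 5) => [|l] hl.
  by apply: spec_wp => //=; rewrite e5 /=; split=> //; split=> //; left; rewrite ?rval_set.
case: hl => lp vp ->.
apply: spec_wp => //=; rewrite e5 v20 /= => w; rewrite subn1 => ->.
rewrite !rval_set //=; split; first exact: leq_trans lp pk.
split=> //; rewrite !rval_put !rval_set //= v20 addn1.
have lS : l.+1 <= S by lia.
split=> // w' ->; split=> //; right; split; first by rewrite !rval_set.
exists (rcons (take l p) true); split=> //.
have sz : size (rcons (take l p) true) = l.+1 by rewrite size_rcons size_takel // ltnW.
split=> [j|] /=; last first.
  rewrite !rval_set //= sz; by case: (rcons _ _) sz.
rewrite sz ltnS leq_eqVlt nth_rcons size_takel ?(ltnW lp) // => /orP [/eqP ->|jl].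
  by rewrite ?eqxx ltnn ?v20.
rewrite jl (ltn_eqF jl) nth_take // dec cats0 //; exact: ltn_trans lp.
Qed.

(** The first factor is the initial measure of a descent: [k * n] branchings, [k] new classes and
    the final flag. *)
Definition round_cost := (k * n + k).+1 * cost.+1 + 18 * m + 7 * n + 7 * k + 30.

Lemma spec_round (T : tree V) s0 a : connected_graph E -> 0 < k ->
  grows E ts es 0 lab0 ex0 T -> base a -> vpath T s0 -> decisions a [::] s0 ->
  ob a = [::] ->
  spec round a round_cost (fun a' => exists lab L, [/\ rest T s0 = lab :: L,
     ob a' = [::], os a' = rcons (os a) (cut_word lab)
    & (val a' 6 = 0 /\ L = [::]) \/
      (val a' 6 = val a 6 /\ exists s, [/\ vpath T s, L = rest T s & decisions a' [::] s])]).
Proof.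
move=> conn k0 gT ba vp dec oa.
apply: (spec_seq (N1 := 7 * n + 7 * k + 14)
   (N2 := (k * n + k).+1 * cost.+1 + 18 * m + 12) (spec_init (proj1 ba))).
  move=> a1 s1 [st1 p31 l51 z71].
  have ba1 := same_base s1 isT ba.
  have de1 : descent T s0 (k * n + k).+1 a1.
    exists 0, lab0, ex0, T, [::], s0, [::]; split; last by rewrite height0 z71 subn0 addn1.
    split=> //; first exact: good0.
    split.
    - by rewrite height0.
    - by rewrite l51; apply: pathinv_start.
    - case: dec => d1 d2; split; last by rewrite (same_val s1).
      by move=> j; rewrite (same_ar _ s1) //; apply: d1.
    - by rewrite z71.
  apply: (spec_seq (N1 := ((k * n + k).+1 * cost.+1).+1) (N2 := 18 * m + 10)
    (spec_descent ba1 de1)); last by lia.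
  move=> a2 s2 [z72 [r' [i [lab [ex [T' [p [s [L [[g gr [i2 hl he] p3 [hp hpi dc zz]] _]]]]]]]]]].
  have [ik np] := zz z72.
  have eT := grows_leaf gr np ik; rewrite eT in hpi.
  have [vs' r1 r2 r3 r4] := hpi.
  (* A leaf has no nonempty path below it, so the replay is over and [advance] may start from [p]
     alone. *)
  have es' : s = [::] by case: s vs' {hpi r1 dc} => // -[].
  have [o1 p1] : ob a1 = ob a /\ os a1 = os a by case: s1 => _ _; apply.
  have [o2 p2] : ob a2 = ob a1 /\ os a2 = os a1 by case: s2 => _ _; apply.
  have oa2 : ob a2 = [::] by rewrite o2 o1.
  apply: (spec_seq (N1 := 18 * m + 4) (N2 := 6)
    (spec_output (proj1 (same_base s2 isT ba1)) hl oa2)); last by lia.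
  move=> a3 s3 [o3 p3'].
  have dc3 : decisions a3 p [::].
    rewrite es' in dc; case: dc => d1 d2; split; last by rewrite (same_val s3).
    by move=> j; rewrite (same_ar _ s3) //; apply: d1.
  have r43 : pending T p L (val a3 5) by rewrite (same_val s3).
  have pk : size p <= k * n by lia.
  apply: spec_weak (spec_advance vp pk dc3 r43) _ _ => //.
  move=> a4 s4 [o4 p4 h4]; exists lab, L; split.
  - exact: pathinv_leaf hpi.
  - by rewrite o4.
  - by rewrite p4 p3' p2 p1.
  - have <- : val a3 6 = val a 6.
      by rewrite (same_val s3) // (same_val s2) // (same_val s1).
    exact: h4.
by rewrite /round_cost; lia.
Qed.

Lemma spec_setup a : instance a -> (forall i, ar a DEG i = 0) ->
  spec setup a (27 * m + 5) (fun a' => [/\ base a', val a' 4 = 0 & val a' 6 = 1]).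
Proof.
move=> ia d0.
apply: (spec_seq (N1 := 1) (N2 := 27 * m + 4) (Q := fun a' => val a' 4 = 0)); last lia.
  by apply: spec_wp => //=; rewrite rval_set.
move=> a1 s1 x1.
apply: (spec_seq (N1 := 1) (N2 := 27 * m + 3) (Q := fun a' => val a' 6 = 1)); last lia.
  by apply: spec_wp => //=; rewrite rval_set //; split=> //; lia.
move=> a2 s2 x2.
have i2 := same_instance s2 isT (same_instance s1 isT ia).
apply: spec_weak (spec_build i2 _) _ _ => //.
  by move=> i; rewrite (same_ar _ s2) // (same_ar _ s1).
move=> a3 s3 ad3; split; first by split=> //; apply: (same_instance s3).
  by rewrite (same_val s3) // (same_val s2).
by rewrite (same_val s3).
Qed.

Section Loop.

Hypotheses (conn : connected_graph E) (k0 : 0 < k).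
Hypothesis spaceS : nreg + abase (lens n m k) narr <= S.

Local Notation repr := (repr (lens n m k) (consts n m k) S).
Local Notation main_loop := (While 6 round).

(** Induction on the number of leaves not on the left of [s]: a round outputs the first of them and
    prepares a path to the others. *)
Lemma main_loop_run (T : tree V) : grows E ts es 0 lab0 ex0 T ->
  forall s R M a, repr R M a -> base a -> vpath T s -> decisions a [::] s ->
  ob a = [::] -> val a 6 != 0 ->
  let c := Config (compile main_loop) R M (ob a) (os a) in
  exists u R' M', [/\ iter u step c = Config [::] R' M' [::] (os a ++ map cut_word (rest T s)),
     forall u', u' <= u -> space_at_most S (iter u' step c) & prog round_cost.+1 c].
Proof.
move=> gT s; have [N] := ubnP (size (rest T s)); elim: N s => // N IH s lt R M a r ba vp dec oa nz c.
have [t [a1 [e1 le1 [lab [L [eL o1 p1 h1]]]]]] := spec_round conn k0 gT ba vp dec oa.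
have [R1 [M1 [r1 x1]]] := compile_ok spaceS (isT : wf round) e1 r.
have [y1 y2] := x1 (compile main_loop).
have f1 : step c = Config (compile round ++ compile main_loop) R M (ob a) (os a).
  by rewrite /c /= (repr_rg r) // nz.
have sp0 : space_at_most S c by apply: repr_space r.
have sp1 : space_at_most S (Config (compile round ++ compile main_loop) R M (ob a) (os a)).
  exact: repr_space r.
have [x3 x4] := step1 f1 sp0 sp1.
have [z1 z2] := iter_step_cat x3 y1 x4 y2.
have pr : prog round_cost.+1 (iter (1 + t) step c) -> prog round_cost.+1 c.
  by move=> p; apply: prog_out p; rewrite ?z1 /= ?p1 ?size_rcons // add1n ltnS.
case: h1 => [[w6 L0]|[w6 [s1 [vp1 eL1 dec1]]]].
  exists (1 + t + 1), R1, M1; rewrite eL L0 -[map _ _]/[:: cut_word lab] cats1 -p1.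
  have last : step (Config (compile main_loop) R1 M1 (ob a1) (os a1)) =
              Config [::] R1 M1 (ob a1) (os a1) by rewrite /= (repr_rg r1) // w6.
  have sp2 : space_at_most S (Config [::] R1 M1 (ob a1) (os a1)) by apply: repr_space r1.
  have sp3 : space_at_most S (Config (compile main_loop) R1 M1 (ob a1) (os a1)).
    exact: repr_space r1.
  have [x5 x6] := step1 last sp3 sp2; have [q1 q2] := iter_step_cat z1 x5 z2 x6.
  split; [by rewrite q1 o1|exact: q2|].
  by apply: pr; apply: (@prog_halt _ _ 1) => //; rewrite z1 -[iter 1 _ _]/(step _) last.
have lt1 : size (rest T s1) < N by rewrite -eL1; rewrite eL /= in lt.
have nz1 : val a1 6 != 0 by rewrite w6.
have ba1 : base a1 by apply: (same_base (ev_same e1)).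
have [u [R2 [M2 [q1 q2 q3]]]] := IH s1 lt1 R1 M1 a1 r1 ba1 vp1 dec1 o1 nz1.
have [w1 w2] := iter_step_cat z1 q1 z2 q2.
exists (1 + t + u), R2, M2; split=> //; first by rewrite w1 p1 eL eL1 /= cat_rcons.
by apply: pr; rewrite z1.
Qed.

End Loop.

End Correctness.

(** * Running the program on an encoded instance *)

Lemma prog_mono f f' s : f <= f' -> prog f s -> prog f' s.
Proof.
move=> le; elim=> [s2 t tf h|s2 t tf lt _ IH].
  exact: (prog_halt (leq_trans tf le) h).
exact: (prog_out (leq_trans tf le) lt).
Qed.

(** The preparation may be silent; its time is charged to the first segment. *)
Lemma prog_prefix f u s : prog f (iter u step s) -> prog (f + u) s.
Proof.
move E : (iter u step s) => s1 p; case: p E => s2 t tf.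
  by move=> h e; apply: (@prog_halt _ _ (t + u)); rewrite ?iterD ?e ?leq_add2r.
move=> lt p e; apply: (@prog_out _ _ (t + u)); rewrite ?iterD ?e ?leq_add2r //.
  by apply: leq_ltn_trans lt; rewrite -e; apply: (csols_mono s (leq0n u)).
exact: prog_mono (leq_addr _ _) p.
Qed.

Lemma space_at_mostW S S' c : S <= S' -> space_at_most S c -> space_at_most S' c.
Proof.
move=> le /andP [h1 h2]; rewrite /space_at_most (leq_trans h1) //=.
by apply/allP => v /(allP h2) /leq_trans; apply.
Qed.

Lemma run_halts p w u : halted (run p w u) ->
  exists2 h, halts_at p w h & run p w h = run p w u.
Proof.
move=> hu; have ex : exists h, halted (run p w h) by exists u.
case: (ex_minnP ex) => h hh hmin; exists h; last first.
  by apply/esym/halted_stay => //; apply: hmin.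
by split=> // t lt; apply/negP => /hmin; rewrite leqNgt lt.
Qed.

(** A symbolic check of the space used by straight-line code. The prologue needs it because it
    writes the registers above [nuser], which well-formed commands may not touch. *)
Fixpoint straight (S : nat) (p : program) (R w : seq nat) : Prop :=
  let next x v q := [/\ x < nreg, v <= S & straight S q (set_nth 0 R x v) w] in
  match p with
  | [::] => True
  | IConst x v :: q => next x v q
  | IAdd x y z :: q => next x (nth 0 R y + nth 0 R z) q
  | IMul x y z :: q => next x (nth 0 R y * nth 0 R z) q
  | IRead x y :: q => next x (nth 0 w (nth 0 R y)) q
  | _ => False
  end.

Lemma straight_space S p R w c B O u : straight S p R w ->
  size R <= nreg -> all (fun v => v <= S) R ->
  nreg + size w <= S -> all (fun v => v <= S) w -> u <= size p ->
  space_at_most S (iter u step (Config (p ++ c) R w B O)).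
Proof.
move=> + + + sw aw; elim: u p R => [|u IH] p R hp sR aR le.
  rewrite /space_at_most /= size_cat all_cat aR aw !andbT.
  by apply: leq_trans sw; rewrite leq_add2r.
have key x v q : step (Config (p ++ c) R w B O) = Config (q ++ c) (set_nth 0 R x v) w B O ->
    [/\ x < nreg, v <= S & straight S q (set_nth 0 R x v) w] -> u <= size q ->
    space_at_most S (iter u.+1 step (Config (p ++ c) R w B O)).
  move=> e [xn vS hq] uq; rewrite iterSr e; apply: IH => //.
    by rewrite size_set_nth geq_max xn.
  apply/(all_nthP 0) => j _; rewrite nth_set_nth /=; case: eqP => // _.
  by case: (ltnP j (size R)) => lt; [apply: (all_nthP 0 aR)|rewrite nth_default].
case: p hp le key => [|i p] //; case: i => [x v|x y z|x y z|x y z|x y|x y|x||x b1 b2|x b];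
  by move=> //= hp le key; apply: (key _ _ p erefl hp le).
Qed.

Definition prologue : program :=
  [:: IConst 20 1; IRead 21 0; IRead 22 20; IConst 25 2; IRead 23 25;
      IAdd 24 22 22; IConst 26 3; IAdd 27 26 24; IAdd 28 27 23; IAdd 29 28 21;
      IAdd 30 29 21; IAdd 31 30 21; IAdd 32 31 21; IAdd 33 32 21; IMul 25 21 24;
      IAdd 34 33 25].

Definition enumerator : program :=
  prologue ++ [:: IIf 23 (compile setup ++ compile (While 6 round)) [:: IEndSol]].

Section Start.

Variables (n m k : nat) (input : seq nat) (S : nat).
Hypothesis size_input : size input = 2 * m + k.
Hypothesis hS : 40 + 2 * m + k + 5 * n + n * (2 * m) + k * n <= S.
Hypothesis input_le : all (fun v => v <= S) input.

Let w := [:: n, m, k & input].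

(** Written with [m + m], as the machine computes it, so that [prologue_run] holds by mere
    evaluation. *)
Definition start_regs : seq nat :=
  nseq 20 0 ++ [:: 1; n; m; k; m + m; n * (m + m); 3; 3 + (m + m); 3 + (m + m) + k;
    3 + (m + m) + k + n; 3 + (m + m) + k + n + n; 3 + (m + m) + k + n + n + n;
    3 + (m + m) + k + n + n + n + n; 3 + (m + m) + k + n + n + n + n + n;
    3 + (m + m) + k + n + n + n + n + n + n * (m + m)].

Lemma prologue_run c B O :
  iter 16 step (Config (prologue ++ c) [::] w B O) = Config c start_regs w B O.
Proof. by []. Qed.

Lemma prologue_space c B O u : u <= 16 ->
  space_at_most S (iter u step (Config (prologue ++ c) [::] w B O)).
Proof.
move=> le; have sw : nreg + size w <= S by rewrite /= size_input /nreg; lia.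
have aw : all (fun v => v <= S) w.
  by rewrite /= input_le andbT; apply/and3P; split; lia.
have st : straight S prologue [::] w.
  have hm : m + m = 2 * m by lia.
  cbv [straight prologue set_nth nth ncons ssrnat.iter w].
  by do 16!(split; [by []|by rewrite ?hm; lia|]).
exact: (straight_space c B O st isT isT sw aw le).
Qed.

Definition start_state : ast :=
  Ast (fun=> 0) (fun j i => nth 0 w (abase (lens n m k) j + i)) [::] [::].

Lemma abase_lens :
  [seq abase (lens n m k) j | j <- iota 0 10] =
  [:: 3; 3 + 2 * m; 3 + 2 * m + k; 3 + 2 * m + k + n; 3 + 2 * m + k + n + n;
      3 + 2 * m + k + n + n + n; 3 + 2 * m + k + n + n + n + n;
      3 + 2 * m + k + n + n + n + n + n;
      3 + 2 * m + k + n + n + n + n + n + n * (2 * m);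
      3 + 2 * m + k + n + n + n + n + n + n * (2 * m) + k * n].
Proof. by rewrite /= /abase !big_ord_recr big_ord0 /= ?addnA addn0. Qed.

Lemma abase_lens_nth j : j < 10 ->
  abase (lens n m k) j = nth 0 [seq abase (lens n m k) j | j <- iota 0 10] j.
Proof. by move=> lt; rewrite (nth_map 0) ?size_iota // nth_iota. Qed.

Lemma start_repr : repr (lens n m k) (consts n m k) S start_regs w start_state.
Proof.
have hm : m + m = 2 * m by lia.
have aw : all (fun v => v <= S) w by rewrite /= input_le andbT; apply/and3P; split; lia.
have aR : all (fun v => v <= S) start_regs.
  rewrite /= hm; do 14!(apply/andP; split; first by lia).
  by rewrite andbT; lia.
split=> //.
- rewrite abase_lens_nth // abase_lens /= size_input; lia.
- move=> x; case: (ltnP x (size start_regs)) => lt; last by rewrite nth_default.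
  exact: (allP aR _ (mem_nth 0 lt)).
- move=> x; case: (ltnP x (size w)) => lt; last by rewrite nth_default.
  exact: (allP aw _ (mem_nth 0 lt)).
- by rewrite /noper; do 25!(case=> [_|]; first by rewrite /rval /= ?hm).
- move=> j jn; rewrite abase_lens_nth ?(ltn_trans jn) // abase_lens.
  by move: j jn; do 9!(case=> [_|]; first by rewrite /= ?hm).
Qed.

End Start.

Lemma nth_flatten_pairs (T : Type) (f g : T -> nat) (s : seq T) (r : seq nat) e0 j :
  j < size s ->
  nth 0 (flatten [seq [:: f e; g e] | e <- s] ++ r) (2 * j) = f (nth e0 s j) /\
  nth 0 (flatten [seq [:: f e; g e] | e <- s] ++ r) (2 * j).+1 = g (nth e0 s j).
Proof.
elim: s j => // e s IH [|j] // lt.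
have -> : 2 * j.+1 = (2 * j).+2 by lia.
exact: IH.
Qed.

Lemma size_flatten_pairs (T : Type) (f g : T -> nat) (s : seq T) :
  size (flatten [seq [:: f e; g e] | e <- s]) = 2 * size s.
Proof. by elim: s => //= e s ->; rewrite mulnS. Qed.

(** For [n = 1] everything is constant. Otherwise [n <= 2 * m] and [k <= n] bound the two factors by
    [3 * (k * n)] and [219 * m], where 219 = 76 + 69 + 26 + 48. *)
Lemma cost_bound n m k : 0 < k -> k <= n -> (n <= 1 -> m = 0) -> (1 < n -> n <= 2 * m) ->
  ((k * n + k).+1 * (38 * n + 69 * m + 13 * k + 47).+1 + 18 * m + 7 * n + 7 * k + 30).+1
    + (27 * m + 22) <= 2000 * (k * n * m) + 2000.
Proof.
move=> k0 kn small large; case: (leqP n 1) => n1.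
  have -> : n = 1 by lia.
  have -> : k = 1 by lia.
  by rewrite small.
have nm := large n1.
have kn0 : 1 <= k * n by rewrite muln_gt0 k0; lia.
have kkn : k <= k * n by apply: leq_pmulr; lia.
have mP : m <= k * n * m by apply: leq_pmull.
have : (k * n + k).+1 * (38 * n + 69 * m + 13 * k + 47).+1 <= (3 * (k * n)) * (219 * m).
  by apply: leq_mul; lia.
rewrite mulnACA; lia.
Qed.

Section Encoded.

Variables (V : finType) (E : {set {set V}}) (T : {set V}).
Variables (vs : seq V) (es : seq (V * V)) (ts : seq V).
Hypotheses (sg : simple_graph E) (cg : connected_graph E).
Hypothesis pres : presents E T vs es ts.

Local Notation n := (size vs).
Local Notation m := (size es).
Local Notation k := (size ts).

Lemma pres_facts : [/\ uniq vs, forall u, u \in vs, uniq ts,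
  T = [set t in ts] & [/\ #|V| = n, #|E| = m & #|T| = k]].
Proof.
have [pv pe pt] := pres; split.
- by rewrite (perm_uniq pv) enum_uniq.
- by move=> u; rewrite (perm_mem pv) mem_enum.
- by rewrite (perm_uniq pt) enum_uniq.
- by apply/setP => t; rewrite inE (perm_mem pt) mem_enum.
- by rewrite cardT -(perm_size pv) !cardE -(perm_size pe) -(perm_size pt) size_map.
Qed.

Lemma pres_adj x y : adj E x y = ((x, y) \in es) || ((y, x) \in es).
Proof.
have [_ pe _] := pres; rewrite /adj -mem_enum -(perm_mem pe).
apply/mapP/orP => [[[a b] ab /set2_inj []] [-> ->]|[h|h]]; [by left|by right|..].
  by exists (x, y).
by exists (y, x); rewrite // setUC.
Qed.

Lemma small_instance : n <= 1 -> m = 0.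
Proof.
move=> n1; have [_ _ _ _ [cV cE _]] := pres_facts.
rewrite -cE; apply/eqP; rewrite cards_eq0; apply/eqP/setP => e; rewrite inE.
apply/negP => /(forall_inP sg) /eqP e2.
by have := max_card (mem e); rewrite e2 cV; lia.
Qed.

Lemma large_instance : 1 < n -> n <= 2 * m.
Proof.
have [_ _ _ _ [cV cE _]] := pres_facts; rewrite -cV -cE; exact: card_le_edges.
Qed.

Lemma terminals_le : k <= n.
Proof. by have [_ _ _ _ [<- _ <-]] := pres_facts; apply: max_card. Qed.

Definition word_space := 40 + 2 * m + k + 5 * n + n * (2 * m) + k * n.

(** The encoding does not list the vertices; connectivity bounds their number by [2 * m + 1], hence
    by the input length. *)
Lemma word_space_le : word_space <= 48 * size (encode vs es ts) ^ 2.
Proof.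
have -> : size (encode vs es ts) = 3 + 2 * m + k.
  by rewrite /encode /= size_cat size_flatten_pairs size_map; lia.
have nm : n <= 2 * m + 1.
  by case: (leqP n 1) => [/[dup] n1 /small_instance ->|/large_instance]; lia.
rewrite /word_space; set N := 3 + 2 * m + k.
have h1 : n * (2 * m) <= N * N by apply: leq_mul; lia.
have h2 : k * n <= N * N by apply: leq_mul; lia.
have h3 : 3 * N <= N * N by apply: leq_mul; lia.
have : 40 + 2 * m + k + 5 * n <= 20 * N by lia.
rewrite expnS expn1; lia.
Qed.

Lemma decode_cut (f : {ffun V -> nat}) : decode es (cut_word es f) = cut E f.
Proof.
have [_ pe _] := pres; apply/setP => e; rewrite inE.
apply/mapP/idP => [[j]|].
  rewrite /cut_word /cut_prefix mem_filter mem_iota add0n => /andP [+ /= jm].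
  have [e0 _] : exists e0, e0 \in es.
    by case: es jm => // e' s _; exists e'; rewrite inE eqxx.
  rewrite !(nth_map e0) // => ne ->; rewrite cutE ne andbT /adj -mem_enum -(perm_mem pe).
  by apply/mapP; exists (nth e0 es j); rewrite // mem_nth.
rewrite inE => /andP [eE] /existsP [x /existsP [y /andP [/eqP exy xy]]].
move: eE; rewrite -mem_enum -(perm_mem pe) => /mapP [p pes ep].
exists (index p es); last by rewrite (nth_map p) ?index_mem // nth_index.
rewrite /cut_word /cut_prefix mem_filter mem_iota /= add0n index_mem pes andbT.
rewrite (nth_map p) ?index_mem // nth_index //.
by move: ep; rewrite exy => /set2_inj [[<- <-] //|[<- <-]]; rewrite eq_sym.
Qed.

Lemma valid_cut_word (f : {ffun V -> nat}) : valid_output es (cut_word es f).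
Proof.
apply/andP; split; first by rewrite filter_uniq ?iota_uniq.
by apply/allP => j; rewrite mem_filter mem_iota => /andP [_].
Qed.

Lemma no_terminals : k = 0 -> [set M | minimal_multiway_cut E T M] = [set set0].
Proof.
move=> k0; have [_ _ _ eT _] := pres_facts.
have T0 : T = set0 by apply/setP => t; rewrite eT !inE; case: ts k0.
have c0 M : multiway_cut E T M = (M \subset E).
  rewrite /multiway_cut T0; case: (M \subset E) => //=.
  by apply/forall_inP => s; rewrite inE.
apply/setP => M; rewrite !inE; apply/minsetP/eqP => [[_ h]|->].
  by apply/esym/h; rewrite ?sub0set // c0 sub0set.
split; first by rewrite c0 sub0set.
by move=> B _; rewrite subset0 => /eqP.
Qed.

Local Notation c0 := (Config enumerator [::] (encode vs es ts) [::] [::]).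

(** Here 22 is the 5 of [spec_setup] plus 17 steps for the prologue and the test on the number of
    terminals. *)
Definition delay_bound := (round_cost vs ts es).+1 + (27 * m + 22).

Lemma input_facts : let input := flatten [seq [:: index e.1 vs; index e.2 vs] | e <- es]
    ++ [seq index t vs | t <- ts] in
  size input = 2 * m + k /\ all (fun v => v <= word_space) input.
Proof.
have [_ mvs _ _ _] := pres_facts; split.
  by rewrite size_cat size_flatten_pairs size_map.
have le u : index u vs <= word_space.
  have le_n : n <= word_space by rewrite /word_space; lia.
  by apply: leq_trans le_n; rewrite ltnW // index_mem.
rewrite all_cat; apply/andP; split; last by apply/allP => _ /mapP [t _ ->].
by apply/allP => v /flatten_mapP [e _]; rewrite !inE => /orP [] /eqP ->.
Qed.

Lemma base_space : nreg + abase (lens n m k) narr <= word_space.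
Proof. by rewrite /nreg /narr abase_lens_nth // abase_lens /word_space /=; lia. Qed.

Local Notation input :=
  (flatten [seq [:: index e.1 vs; index e.2 vs] | e <- es] ++ [seq index t vs | t <- ts]).

Lemma start_instance : instance vs ts es (start_state n m k input).
Proof.
split=> [e0 j jm|t0 j jk]; rewrite /start_state /= !add0n.
  rewrite big_ord0 !add0n; exact: (nth_flatten_pairs (fun e => index e.1 vs)
    (fun e => index e.2 vs) [seq index t vs | t <- ts] e0 jm).
rewrite big_ord_recr big_ord0 /= add0n nth_cat size_flatten_pairs ltnNge leq_addr /= addKn.
by rewrite (nth_map t0).
Qed.

Lemma start_deg i : ar (start_state n m k input) DEG i = 0.
Proof.
rewrite /start_state -[LHS]/(nth 0 [:: n, m, k & input] (abase (lens n m k) DEG + i)) abase_lens_nth // abase_lens nth_default //=.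
by rewrite (proj1 input_facts); lia.
Qed.

Lemma start_run : exists R,
  [/\ repr (lens n m k) (consts n m k) word_space R (encode vs es ts)
        (start_state n m k input),
      iter 17 step c0 = Config (if k != 0 then compile setup ++ compile (While 6 round)
                                else [:: IEndSol]) R (encode vs es ts) [::] [::]
    & forall u, u <= 17 -> space_at_most word_space (iter u step c0)].
Proof.
have [si li] := input_facts.
have r := start_repr si (leqnn word_space) li.
set w := encode vs es ts; pose R := start_regs n m k.
have spS := base_space.
have sp c' : space_at_most word_space (Config c' R w [::] [::]).
  exact: repr_space r.
pose b := compile setup ++ compile (While 6 round).
have x1 := @prologue_run n m k input [:: IIf 23 b [:: IEndSol]] [::] [::].
have x2 u : u <= 16 -> space_at_most word_space (iter u step c0).
  by move=> le; apply: (prologue_space si (leqnn word_space) li).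
have st : step (Config [:: IIf 23 b [:: IEndSol]] R w [::] [::]) =
    Config (if k != 0 then b else [:: IEndSol]) R w [::] [::].
  by rewrite -[LHS]/(Config ((if k != 0 then b else [:: IEndSol]) ++ [::]) R w [::] [::]) cats0.
have [y1 y2] := step1 st (sp _) (sp _).
have [z1 z2] := iter_step_cat x1 y1 x2 y2.
by exists R; split; [exact: r|exact: z1|exact: z2].
Qed.

Lemma run_no_terminals : k = 0 -> exists R M,
  [/\ iter 18 step c0 = Config [::] R M [::] [:: [::]],
      forall u, u <= 18 -> space_at_most word_space (iter u step c0)
    & prog 18 c0].
Proof.
move=> k0; have [R [r x0 x2]] := start_run.
have x1 : iter 17 step c0 = Config [:: IEndSol] R (encode vs es ts) [::] [::].
  by rewrite x0 k0.
have spS := base_space.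
have sp c' O : space_at_most word_space (Config c' R (encode vs es ts) [::] O).
  exact: repr_space r.
have [y1 y2] := step1 (s := Config [:: IEndSol] R (encode vs es ts) [::] [::])
  erefl (sp _ _) (sp _ _).
have [z1 z2] := iter_step_cat (t1 := 17) (t2 := 1) x1 y1 x2 y2.
exists R, (encode vs es ts); split; [exact: z1|exact: z2|].
have hh : halted (iter (17 + 1) step c0) by rewrite z1.
exact: (prog_halt (leqnn 18) hh).
Qed.

Lemma run_terminals : 0 < k -> exists u R M tr,
  [/\ grows E ts es 0 (lab0 V) (ex0 ts) tr,
      iter u step c0 = Config [::] R M [::] [seq cut_word es f | f <- leaves tr],
      forall u', u' <= u -> space_at_most word_space (iter u' step c0)
    & prog delay_bound c0].
Proof.
move=> k0; have [uvs mvs uts _ _] := pres_facts.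
have spS := base_space.
have hS : n + 2 * m + k + n * (2 * m) + k * n + 3 <= word_space.
  by rewrite /word_space; clear; lia.
have [tr gr] := grows_exists uts pres_adj (good0 cg k0).
have [t [a1 [e1 le1 [ba v4 v6]]]] := spec_setup uvs mvs uts hS start_instance start_deg.
have [o1 p1] : ob a1 = [::] /\ os a1 = [::] by case: (ev_same e1) => _ _; apply.
have dc : decisions vs ts es a1 [::] [::] by split; rewrite ?v4.
have nz : rval (consts n m k) a1 6 != 0 by rewrite v6.
have [R [r x0 x2]] := start_run.
have [R1 [M1 [r1 y1]]] := compile_ok spS (isT : wf setup) e1 r.
have [y2 y3] := y1 (compile (While 6 round)).
have [u [R2 [M2 [q1 q2 q3]]]] := main_loop_run uvs mvs uts pres_adj hS cg k0 spS gr r1 ba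
  (isT : vpath tr [::]) dc o1 nz.
rewrite -lt0n k0 in x0.
have [z1 z2] := iter_step_cat x0 y2 x2 y3.
have [w1 w2] := iter_step_cat z1 q1 z2 q2.
exists (17 + t + u), R2, M2, tr; split; [exact: gr|by rewrite w1 p1|exact: w2|].
have -> : delay_bound = (round_cost vs ts es).+1 + (27 * m + 5 - t) + (17 + t).
  by rewrite /delay_bound; clear -le1; lia.
apply: prog_prefix; rewrite z1.
by apply: prog_mono q3; apply: leq_addr.
Qed.

Lemma delay_bound_le : 0 < k -> delay_bound <= 2000 * (#|T| * #|V| * #|E|) + 2000.
Proof.
move=> k0; have [_ _ _ _ [-> -> ->]] := pres_facts.
exact: (cost_bound k0 terminals_le small_instance large_instance).
Qed.

Lemma listing_leaves tr (x : config) : 0 < k ->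
  grows E ts es 0 (lab0 V) (ex0 ts) tr ->
  csols x = [seq cut_word es f | f <- leaves tr] -> cbuf x = [::] ->
  lists_exactly es [set M | minimal_multiway_cut E T M] x.
Proof.
move=> k0 gr ex bx; have [_ _ uts eT _] := pres_facts.
have [ul hl] := leavesP uts pres_adj gr (good0 cg k0).
(* At the root nothing is assigned and class 0 is current, so being compatible only requires labels
   to be nonzero. *)
have sl f : f \in leaves tr <-> sol E ts f.
  rewrite hl; split=> [[]//|sf]; have [f1 _ _] := sf; split=> //.
  - by move=> u; rewrite ffunE.
  - by move=> u _ _; rewrite -lt0n; case/andP: (f1 u).
apply/and3P; split; last by rewrite bx.
  by rewrite ex; apply/allP => _ /mapP [f _ ->]; apply: valid_cut_word.
rewrite ex -map_comp (eq_map (g := cut E)); last by move=> f; apply: decode_cut.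
apply: uniq_perm; [|exact: enum_uniq|move=> M].
  by rewrite map_inj_in_uniq // => f g /sl sf /sl sg'; apply: (cut_inj uts sf sg').
rewrite mem_enum inE eT; apply/mapP/idP => [[f /sl sf ->]|/(minimal_cut uts cg k0) [f sf ->]].
  exact: cut_minimal.
by exists f => //; apply/sl.
Qed.

Lemma listing_empty (x : config) : k = 0 -> csols x = [:: [::]] -> cbuf x = [::] ->
  lists_exactly es [set M | minimal_multiway_cut E T M] x.
Proof.
move=> k0 ex bx; rewrite /lists_exactly ex bx no_terminals //= andbT.
by rewrite enum_set1 /decode /= (_ : [set:: [::]] = set0) //; apply/setP => e; rewrite !inE.
Qed.

End Encoded.

(** The additive constant covers the instances where the product vanishes, with no terminal or a
    single vertex, while the program still takes some steps. *)
Theorem theorem2 :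
  exists (p : program) (c a d : nat),
  forall (V : finType) (E : {set {set V}}) (T : {set V})
         (vs : seq V) (es : seq (V * V)) (ts : seq V),
    simple_graph E -> connected_graph E ->
    presents E T vs es ts ->
    let w := encode vs es ts in
    exists h : nat,
      [/\ halts_at p w h,
          lists_exactly es [set M | minimal_multiway_cut E T M]
            (run p w h),
          delay_at_most p w h (c * (#|T| * #|V| * #|E|) + c)
        & forall t : nat, space_at_most (a * size w ^ d) (run p w t)].
Proof.
(* 4000 is twice the 2000 of [cost_bound], the doubling coming from [prog_delay]; 48 and 2 come from
   [word_space_le]. *)
exists enumerator, 4000, 48, 2 => V E T vs es ts sg cg pres w.
set b := #|T| * #|V| * #|E|.
suff [u [R [M [os [eu hl sp pr]]]]] : exists u R M os,
    [/\ run enumerator w u = Config [::] R M [::] os,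
      lists_exactly es [set M | minimal_multiway_cut E T M] (Config [::] R M [::] os),
      forall u', u' <= u -> space_at_most (word_space vs es ts) (run enumerator w u')
    & prog (2000 * b + 2000) (run enumerator w 0)].
  have hu : halted (run enumerator w u) by rewrite eu.
  have [h hh eh] := run_halts hu; exists h; split=> //.
  - by rewrite eh eu.
  - apply: delay_of_prog hh => t; have := prog_delay pr t.
    by rewrite (_ : (2000 * b + 2000).*2 = 4000 * b + 4000) //; clear; lia.
  - move=> t; apply: space_at_mostW (word_space_le sg cg pres) _.
    case: (leqP t u) => [|/ltnW le]; first exact: sp.
    by rewrite /run (halted_stay le hu); apply: sp.
have [k0|k0] := posnP (size ts).
  have [R [M [eu sp pr]]] := run_no_terminals sg cg pres k0.
  exists 18, R, M, [:: [::]]; split; [exact: eu| |exact: sp|].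
    by apply: (listing_empty pres).
  by apply: prog_mono pr; rewrite addnC; apply: leq_trans (leq_addr _ _).
have [u [R [M [tr [gr eu sp pr]]]]] := run_terminals sg cg pres k0.
exists u, R, M, [seq cut_word es f | f <- leaves tr]; split; [exact: eu| |exact: sp|].
  exact: (listing_leaves cg pres k0 gr).
exact: prog_mono (delay_bound_le sg cg pres k0) pr.
Qed.
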